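(* Let $R,V:[0,\pi]\to\mathbb{C}$ be continuous functions such that $R(\pi-x)\sim C_\alpha x^\alpha$ and $V(x)\sim D_\beta x^\beta$ as $x\to+0$, for some real $\alpha,\beta$ and complex $C_\alpha,D_\beta$ with $C_\alpha D_\beta\neq 0$, and such that $R(x)\neq 0$ for a.e. $x\in(0,\pi)$. Let $\tilde R,\tilde V:[0,\pi]\to\mathbb{C}$ be another pair of functions satisfying the same conditions (possibly with different exponents and constants). Let $\{\lambda_n,\beta_n\}_{n\ge1}$ and $\{\tilde\lambda_n,\tilde\beta_n\}_{n\ge1}$ be the spectral data (eigenvalues counted with multiplicities, and Levinson's weight numbers) of the boundary value problems $L=L(R,V)$ and $\tilde L=L(\tilde R,\tilde V)$, respectively. If $\lambda_n=\tilde\lambda_n$ and $\beta_n=\tilde\beta_n$ for all $n\ge 1$, then $R(x)=\tilde R(x)$ and $V(x)=\tilde V(x)$ for all $x\in[0,\pi]$.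
   Context: For continuous $R,V:[0,\pi]\to\mathbb{C}$ as in the claim, $L=L(R,V)$ denotes the boundary value problem consisting of the integro-differential equation $$ i y'(x)+\int_0^x R(x)V(t)y(t)\,dt=\lambda y(x),\quad x\in[0,\pi], \qquad (\ast)$$ with the condition $y(\pi)=0$, where $\lambda\in\mathbb{C}$ is the spectral parameter. Let $\varphi(x,\lambda)$ be the solution of $(\ast)$ with $\varphi(0,\lambda)=1$, and put $\Delta(\lambda):=\varphi(\pi,\lambda)$, which is an entire function of $\lambda$. The eigenvalues $\{\lambda_n\}_{n\ge1}$ of $L$ are the zeros of $\Delta$, counted with multiplicities and numbered so that equal eigenvalues occupy consecutive positions. Let $$S:=\{1\}\cup\{n\ge 2:\ \lambda_{n-1}\ne\lambda_n\},$$ and for $n\in S$ let $m_n$ be the multiplicity of $\lambda_n$ as a zero of $\Delta$, so that $\lambda_n=\lambda_{n+1}=\dots=\lambda_{n+m_n-1}$. Let $\eta(x,\lambda)$ be the solution of the problem $$ i\eta'(x,\lambda)-R(x)\int_x^\pi V(t)\eta(t,\lambda)\,dt+R(x)=\lambda\eta(x,\lambda),\quad x\in[0,\pi],\qquad \eta(\pi,\lambda)=0,$$ where $'$ denotes $d/dx$. For $\nu\ge0$ set $$\varphi_\nu(x,\lambda):=\frac{1}{\nu!}\frac{\partial^\nu\varphi(x,\lambda)}{\partial\lambda^\nu},\qquad \eta_\nu(x,\lambda):=\frac{1}{\nu!}\frac{\partial^\nu\eta(x,\lambda)}{\partial\lambda^\nu},$$ and for $n\in S$, $\nu=0,1,\dots,m_n-1$,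 set $$s_{n+\nu}(x):=\varphi_\nu(x,\lambda_n),\qquad \psi_{n+\nu}(x):=\eta_\nu(x,\lambda_n).$$ The functions $\{s_n\}_{n\ge1}$ and $\{\psi_n\}_{n\ge1}$ are both eigen- and associated functions of $L$, and there are coefficients $\{\beta_n\}_{n\ge1}$, called Levinson's weight numbers, determined by the relations $$\psi_{n+\nu}(x)=\sum_{j=0}^{\nu}\beta_{n+\nu-j}\,s_{n+j}(x),\qquad n\in S,\ \nu=0,1,\dots,m_n-1.$$ The data $\{\lambda_n,\beta_n\}_{n\ge1}$ are called the spectral data of $L$. (The weight numbers $\beta_n$ are not to be confused with the exponent $\beta$ in the asymptotics of $V$.) Quantities with a tilde are the analogous objects for $\tilde L=L(\tilde R,\tilde V)$. *)

(* Defs.v *)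
(* World: Stdlib classical reals + Coquelicot. *)
From Stdlib Require Import Reals Factorial.
From Coquelicot Require Import Coquelicot.
Open Scope C_scope.

(** Functions on [[0,PI]] are represented by functions on [R]; nothing below
    depends on their values outside [[0,PI]]. *)
Definition seg (x : R) : Prop := (0 <= x <= PI)%R.

Definition RIntC (f : R -> C) (a b : R) : C :=
  @RInt C_R_CompleteNormedModule f a b.

(** Derivative relative to [[0,PI]], hence one-sided at the two endpoints. *)
Definition is_derive_seg (f : R -> C) (x : R) (l : C) : Prop :=
  @filterdiff R_AbsRing (AbsRing_NormedModule R_AbsRing) C_R_NormedModule
    f (within seg (locally x)) (fun h : R => @scal R_AbsRing C_R_NormedModule h l).

(** Iterated complex derivative.  It is only applied to entire functions, where
    the total operator [C_derive] is the genuine complex derivative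
    ([is_C_derive_unique]). *)
Fixpoint C_derive_n (f : C -> C) (n : nat) (z : C) : C :=
  match n with
  | O => f z
  | S k => C_derive (C_derive_n f k) z
  end.

Definition taylor_coef (f : C -> C) (n : nat) (z : C) : C :=
  RtoC (/ INR (fact n)) * C_derive_n f n z.

Definition zero_mult (f : C -> C) (z : C) (m : nat) : Prop :=
  (forall k, (k < m)%nat -> C_derive_n f k z = 0) /\ C_derive_n f m z <> 0.

(** Lebesgue-null subsets of the line (outer measure zero). *)
Definition null_set (A : R -> Prop) : Prop :=
  forall eps : R, (0 < eps)%R ->
  exists a b : nat -> R,
    (forall n, (a n <= b n)%R) /\
    (forall x, A x -> exists n, (a n < x < b n)%R) /\
    (forall N, (sum_n (fun n => b n - a n)%R N <= eps)%R).

Definition is_equiv_right0 (f g : R -> C) : Prop :=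
  @is_equiv R R_AbsRing C_R_NormedModule (at_right 0) f g.

Definition admissible (r v : R -> C) : Prop :=
  @continuous_on R_UniformSpace C_UniformSpace seg r /\
  @continuous_on R_UniformSpace C_UniformSpace seg v /\
  (exists (al be : R) (Ca Db : C),
     Ca * Db <> 0 /\
     is_equiv_right0 (fun x => r (PI - x)%R) (fun x => Ca * RtoC (Rpower x al)) /\
     is_equiv_right0 v (fun x => Db * RtoC (Rpower x be))) /\
  null_set (fun x => (0 < x < PI)%R /\ r x = 0).

(** [i y'(x) + int_0^x r(x) v(t) y(t) dt = z y(x)] on [[0,PI]]. *)
Definition solves_L (r v : R -> C) (z : C) (y : R -> C) : Prop :=
  forall x, seg x ->
  exists dy : C, is_derive_seg y x dy /\
    Ci * dy + RIntC (fun t => r x * v t * y t) 0 x = z * y x.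

Definition is_phi (r v : R -> C) (z : C) (y : R -> C) : Prop :=
  solves_L r v z y /\ y 0%R = 1.

Definition is_eta (r v : R -> C) (z : C) (y : R -> C) : Prop :=
  (forall x, seg x ->
   exists dy : C, is_derive_seg y x dy /\
     Ci * dy - r x * RIntC (fun t => v t * y t) x PI + r x = z * y x) /\
  y PI = 0.

(** [lam 1, lam 2, ...] lists the zeros of [Delta]: every zero [z] occupies
    exactly a block of consecutive positions whose length is its multiplicity.
    The value [lam 0] is irrelevant here and below. *)
Definition eigenvalue_numbering (Delta : C -> C) (lam : nat -> C) : Prop :=
  (forall n, (1 <= n)%nat -> Delta (lam n) = 0) /\
  (forall z, Delta z = 0 ->
   exists n m : nat, (1 <= n)%nat /\ (1 <= m)%nat /\ zero_mult Delta z m /\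
     forall k, (1 <= k)%nat -> (lam k = z <-> (n <= k < n + m)%nat)).

Definition in_S (lam : nat -> C) (n : nat) : Prop :=
  n = 1%nat \/ ((2 <= n)%nat /\ lam (n - 1)%nat <> lam n).

(** [lam] is a numbering of the eigenvalues of [L(r,v)] and [beta] are the
    corresponding Levinson weight numbers.  On [[0,PI]] the solutions [phi x z]
    and [eta x z] are uniquely determined, so the existential quantifier merely
    names them. *)
Definition spectral_data (r v : R -> C) (lam beta : nat -> C) : Prop :=
  exists phi eta : R -> C -> C,
    (forall z, is_phi r v z (fun x => phi x z)) /\
    (forall z, is_eta r v z (fun x => eta x z)) /\
    eigenvalue_numbering (phi PI) lam /\
    (forall n m nu : nat,
       (1 <= n)%nat -> in_S lam n -> zero_mult (phi PI) (lam n) m -> (nu < m)%nat ->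
       forall x, seg x ->
       taylor_coef (eta x) nu (lam n) =
       sum_n (fun j => beta (n + nu - j)%nat * taylor_coef (phi x) j (lam n)) nu).

(* Main.v *)
Require Import Defs.
From Stdlib Require Import Reals Lra Lia Psatz Classical ClassicalEpsilon FunctionalExtensionality.
From Coquelicot Require Import Coquelicot.
Open Scope C_scope.

(* Put a = i r, b = v, so that the equation becomes the first-order system
   y' = - i z y + a w, w' = b y.  Let (ph, W), (th, X) be its solutions starting at 0 from
   (1, 0), (0, 1), and (et, Z) the one ending at PI in (0, 1).  Wronskians give
   Z(0) = e^{i z PI} ph(PI) and et(0) = - e^{i z PI} th(PI), and the weight numbers are the
   Taylor coefficients of et(0, .) at the zeros of ph(PI, .).  So the differences of the
   functions Z(0, .) and of et(0, .) for the two problems are divisible by Z(0, .).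

   Everything then rests on one principle.  Let D = Z(0, .) and let D G = N with G and N
   entire, N of exponential type, N = O(1 / Im z) in the upper half-plane, and
   N(- i t) = O(e^{PI t}).  Then G = 0: G has exponential type because it is a quotient of two
   functions of exponential type (zeros are removed by Blaschke factors and the remaining
   zero-free function is bounded below by means of its high order roots); it is bounded for
   large Im z since D tends to 1 there; and it is polynomially bounded on the negative
   imaginary axis, where the asymptotics of r at PI and of v at 0 bound e^{- PI t} D from
   below by a power of t.  Phragmen-Lindelof in two quadrants and Liouville finish.

   Applied to the two differences, the principle shows that both problems have the same
   Z(0, .) and et(0, .).  Applied to the entries of U U~^{-1} - 1, where U and U~ are the two
   transfer matrices on [0, x], it gives U = U~, and the coefficients are read off from U'.

   Holomorphy is encoded by iterated difference quotients ([jet]).  This class is visibly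
   closed under division by (z - a) at a zero a, and second order expansions suffice for the
   maximum principle, so that no integral formula is needed. *)

(** * Functions with difference quotients of all orders *)

Lemma Cmod_pos (z : C) : z <> 0 -> (0 < Cmod z)%R.
Proof. exact (proj1 (Cmod_gt_0 z)). Qed.

Lemma Cmod_pos_neq (z : C) : (0 < Cmod z)%R -> z <> 0.
Proof. exact (proj2 (Cmod_gt_0 z)). Qed.

Fixpoint jet (k : nat) (f : C -> C) (z0 : C) : Prop :=
  match k with
  | O => exists d M : R, (0 < d)%R /\
           forall z, (Cmod (z - z0) < d)%R -> (Cmod (f z) <= M)%R
  | S k => exists g, jet k g z0 /\ forall z, f z = f z0 + (z - z0) * g z
  end.

Definition holo (f : C -> C) (z : C) : Prop := forall k, jet k f z.

Lemma jet_pred k : forall f z0, jet (S k) f z0 -> jet k f z0.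
Proof.
  induction k as [|k IH]; intros f z0 [g [Hg E]].
  - destruct Hg as [d [M [Hd HM]]].
    exists d, (Cmod (f z0) + d * M)%R. split; [exact Hd|]. intros z Hz.
    rewrite E. eapply Rle_trans; [apply Cmod_triangle|].
    rewrite Cmod_mult. apply Rplus_le_compat_l.
    apply Rmult_le_compat; try apply Cmod_ge_0; [lra | now apply HM].
  - exists g. split; [now apply IH | exact E].
Qed.

Lemma jet_le k n f z0 : (k <= n)%nat -> jet n f z0 -> jet k f z0.
Proof. induction 1; [auto|]. intros H1. apply IHle. now apply jet_pred. Qed.

Lemma jet_ext k : forall f g z0, (forall z, f z = g z) -> jet k f z0 -> jet k g z0.
Proof.
  destruct k; intros f g z0 E.
  - intros [d [M [Hd HM]]]. exists d, M. split; [exact Hd|].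
    intros z Hz. rewrite <- E. auto.
  - intros [h [Hh Eh]]. exists h. split; [exact Hh|].
    intros z. now rewrite <- !E.
Qed.

Lemma Cdiff_0 (z : C) : z - z = 0.
Proof. ring. Qed.

Lemma Cminus_neq (z w : C) : z <> w -> z - w <> 0.
Proof. intros H E. apply H. now apply Ceq_minus. Qed.

Lemma jet_loc k : forall f g z0 d, (0 < d)%R ->
  (forall z, (Cmod (z - z0) < d)%R -> f z = g z) -> jet k f z0 -> jet k g z0.
Proof.
  induction k as [|k IH]; intros f g z0 d Hd E.
  - intros [d' [M [Hd' HM]]]. exists (Rmin d d'), M. split; [now apply Rmin_glb_lt|].
    intros z Hz. rewrite <- E; [apply HM|];
    (eapply Rlt_le_trans; [exact Hz|]); [apply Rmin_r | apply Rmin_l].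
  - intros [h [Hh Eh]].
    exists (fun z => if Ceq_dec z z0 then h z0 else (g z - g z0) / (z - z0)).
    split.
    + apply IH with (f := h) (d := d); [exact Hd| |exact Hh].
      intros z Hz. destruct (Ceq_dec z z0) as [->|N]; [reflexivity|].
      rewrite <- !E; [|rewrite Cdiff_0, Cmod_0; lra|exact Hz].
      rewrite (Eh z). field. now apply Cminus_neq.
    + intros z. destruct (Ceq_dec z z0) as [->|N]; [ring|].
      field. now apply Cminus_neq.
Qed.

Lemma jet_const k : forall c z0, jet k (fun _ => c) z0.
Proof.
  induction k as [|k IH]; intros c z0.
  - exists 1%R, (Cmod c). split; [lra|]. intros; lra.
  - exists (fun _ => 0). split; [apply IH | intros; ring].
Qed.

Lemma jet_id k : forall z0, jet k (fun z => z) z0.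
Proof.
  intros z0. apply jet_pred. exists (fun _ => 1). split; [apply jet_const | intros; ring].
Qed.

Lemma jet_plus k : forall f g z0, jet k f z0 -> jet k g z0 -> jet k (fun z => f z + g z) z0.
Proof.
  induction k as [|k IH]; intros f g z0.
  - intros [d [M [Hd HM]]] [d' [M' [Hd' HM']]].
    exists (Rmin d d'), (M + M')%R. split; [now apply Rmin_glb_lt|].
    intros z Hz. eapply Rle_trans; [apply Cmod_triangle|].
    apply Rplus_le_compat; [apply HM|apply HM'];
      (eapply Rlt_le_trans; [exact Hz|]); [apply Rmin_l | apply Rmin_r].
  - intros [h [Hh Eh]] [h' [Hh' Eh']]. exists (fun z => h z + h' z).
    split; [now apply IH|]. intros z. rewrite (Eh z), (Eh' z). ring.
Qed.

Lemma jet_mult k : forall f g z0, jet k f z0 -> jet k g z0 -> jet k (fun z => f z * g z) z0.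
Proof.
  induction k as [|k IH]; intros f g z0.
  - intros [d [M [Hd HM]]] [d' [M' [Hd' HM']]].
    exists (Rmin d d'), (M * M')%R. split; [now apply Rmin_glb_lt|].
    intros z Hz. rewrite Cmod_mult.
    apply Rmult_le_compat; try apply Cmod_ge_0; [apply HM|apply HM'];
      (eapply Rlt_le_trans; [exact Hz|]); [apply Rmin_l | apply Rmin_r].
  - intros Hf0 Hg0. assert (Hg1 := jet_pred _ _ _ Hg0).
    destruct Hf0 as [h [Hh Eh]], Hg0 as [h' [Hh' Eh']].
    exists (fun z => h z * g z + f z0 * h' z). split.
    + apply jet_plus; apply IH; auto using jet_const.
    + intros z. rewrite (Eh z) at 1. rewrite (Eh' z) at 1. rewrite (Eh' z). ring.
Qed.

Lemma jet_cont f z0 : jet 1 f z0 ->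
  exists d M : R, (0 < d)%R /\ (0 <= M)%R /\
    forall z, (Cmod (z - z0) < d)%R -> (Cmod (f z - f z0) <= M * Cmod (z - z0))%R.
Proof.
  intros [g [[d [M [Hd HM]]] E]]. exists d, M. split; [exact Hd|].
  split.
  - eapply Rle_trans; [apply Cmod_ge_0|]. apply (HM z0). rewrite Cdiff_0, Cmod_0. lra.
  - intros z Hz. rewrite (E z). replace (f z0 + (z - z0) * g z - f z0) with (g z * (z - z0)) by ring.
    rewrite Cmod_mult. apply Rmult_le_compat_r; [apply Cmod_ge_0|auto].
Qed.

Lemma jet_cont_eps f z0 eps : jet 1 f z0 -> (0 < eps)%R ->
  exists d : R, (0 < d)%R /\
    forall z, (Cmod (z - z0) < d)%R -> (Cmod (f z - f z0) < eps)%R.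
Proof.
  intros H He. destruct (jet_cont f z0 H) as [d [M [Hd [HM0 HM]]]].
  exists (Rmin d (eps / (M + 1))). 
  assert (0 < eps / (M + 1))%R by (apply Rdiv_lt_0_compat; lra).
  split; [now apply Rmin_glb_lt|].
  intros z Hz. apply Rle_lt_trans with (M * Cmod (z - z0))%R.
  - apply HM. eapply Rlt_le_trans; [exact Hz|apply Rmin_l].
  - assert (Cmod (z - z0) < eps / (M + 1))%R by (eapply Rlt_le_trans; [exact Hz|apply Rmin_r]).
    assert (Cmod (z - z0) * (M + 1) < eps)%R.
    { replace eps with (eps / (M + 1) * (M + 1))%R by (field; lra).
      apply Rmult_lt_compat_r; lra. }
    assert (0 <= Cmod (z - z0))%R by apply Cmod_ge_0. nra.
Qed.

Lemma jet_comp k : forall F f z0,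
  jet k F (f z0) -> jet (S k) f z0 -> jet k (fun z => F (f z)) z0.
Proof.
  induction k as [|k IH]; intros F f z0 HF Hf.
  - destruct HF as [d [M [Hd HM]]].
    destruct (jet_cont_eps f z0 d Hf Hd) as [d' [Hd' H']].
    exists d', M. split; auto.
  - assert (Hf1 := jet_pred _ _ _ Hf).
    destruct HF as [G [HG EG]], Hf as [g [Hg Eg]].
    exists (fun z => g z * G (f z)). split.
    + apply jet_mult; [now apply jet_pred | now apply IH].
    + intros z. rewrite (EG (f z)). rewrite (Eg z) at 1. ring.
Qed.

Lemma jet_recip k : forall f z0 d c, (0 < d)%R -> (0 < c)%R ->
  (forall z, (Cmod (z - z0) < d)%R -> (c <= Cmod (f z))%R) ->
  jet k f z0 -> jet k (fun z => / f z) z0.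
Proof.
  induction k as [|k IH]; intros f z0 d c Hd Hc HM Hf.
  - exists d, (/ c)%R. split; [exact Hd|]. intros z Hz. specialize (HM z Hz).
    rewrite Cmod_inv by (apply Cmod_pos_neq; lra). now apply Rinv_le_contravar.
  - assert (N : forall z, (Cmod (z - z0) < d)%R -> f z <> 0).
    { intros z Hz. apply Cmod_pos_neq. specialize (HM z Hz). lra. }
    assert (Z0 : (Cmod (z0 - z0) < d)%R) by (rewrite Cdiff_0, Cmod_0; exact Hd).
    assert (Hf1 := jet_pred _ _ _ Hf). destruct Hf as [g [Hg Eg]].
    apply jet_loc with
      (f := fun z => / f z0 + (z - z0) * (- / f z0 * (g z * / f z))) (d := d); [exact Hd| |].
    + intros z Hz. assert (N0 := N z0 Z0). assert (Nz := N z Hz).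
      transitivity (/ f z0 - / (f z0 * f z) * (f z0 + (z - z0) * g z - f z0)).
      * field. auto.
      * rewrite <- (Eg z). field. auto.
    + exists (fun z => - / f z0 * (g z * / f z)). split.
      * apply jet_mult; [apply jet_const|]. apply jet_mult; [exact Hg|]. now apply IH with d c.
      * intros z. ring.
Qed.

Lemma jet_inv k (w0 : C) : w0 <> 0 -> jet k Cinv w0.
Proof.
  intros N. assert (P := Cmod_pos w0 N).
  apply (jet_recip k (fun w => w) w0 (Cmod w0 / 2) (Cmod w0 / 2)); [lra|lra| |apply jet_id].
  intros z Hz. assert (T := Cmod_triangle z (- (z - w0))). rewrite Cmod_opp in T.
  replace (z + - (z - w0)) with w0 in T by ring. lra.
Qed.

Lemma holo_ext f g z : (forall w, f w = g w) -> holo f z -> holo g z.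
Proof. intros E H k. now apply jet_ext with f. Qed.

Lemma holo_loc f g z0 d : (0 < d)%R ->
  (forall z, (Cmod (z - z0) < d)%R -> f z = g z) -> holo f z0 -> holo g z0.
Proof. intros Hd E H k. now apply jet_loc with f d. Qed.

Lemma holo_const c z : holo (fun _ => c) z.
Proof. intros k. apply jet_const. Qed.

Lemma holo_id z : holo (fun w => w) z.
Proof. intros k. apply jet_id. Qed.

Lemma holo_plus f g z : holo f z -> holo g z -> holo (fun w => f w + g w) z.
Proof. intros H1 H2 k. now apply jet_plus. Qed.

Lemma holo_mult f g z : holo f z -> holo g z -> holo (fun w => f w * g w) z.
Proof. intros H1 H2 k. now apply jet_mult. Qed.

Lemma holo_opp f z : holo f z -> holo (fun w => - f w) z.
Proof.
  intros H. apply holo_ext with (fun w => - (1) * f w); [intros; ring|].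
  apply holo_mult; auto using holo_const.
Qed.

Lemma holo_minus f g z : holo f z -> holo g z -> holo (fun w => f w - g w) z.
Proof. intros H1 H2. apply holo_plus; auto using holo_opp. Qed.

Lemma holo_comp F f z : holo F (f z) -> holo f z -> holo (fun w => F (f w)) z.
Proof. intros H1 H2 k. now apply jet_comp. Qed.

Lemma holo_inv (f : C -> C) z : f z <> 0 -> holo f z -> holo (fun w => / f w) z.
Proof. intros N H. apply (holo_comp Cinv f); [intros k; now apply jet_inv|exact H]. Qed.

Lemma holo_div (f g : C -> C) z : g z <> 0 -> holo f z -> holo g z -> holo (fun w => f w / g w) z.
Proof. intros N H1 H2. apply (holo_mult f (fun w => / g w)); [exact H1|]. now apply holo_inv. Qed.

Lemma holo_pow f n z : holo f z -> holo (fun w => f w ^ n) z.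
Proof.
  intros H. induction n as [|n IH]; [apply (holo_const 1)|].
  now apply (holo_mult f (fun w => f w ^ n)).
Qed.

Lemma jet_limit_unique f g z0 : jet 1 f z0 -> jet 1 g z0 ->
  (forall z, z <> z0 -> f z = g z) -> f z0 = g z0.
Proof.
  intros Hf Hg E. destruct (Ceq_dec (f z0) (g z0)) as [|N]; [assumption|exfalso].
  assert (P : (0 < Cmod (f z0 - g z0))%R) by now apply Cmod_pos, Cminus_neq.
  destruct (jet_cont_eps f z0 (Cmod (f z0 - g z0) / 2) Hf) as [d [Hd H]]; [lra|].
  destruct (jet_cont_eps g z0 (Cmod (f z0 - g z0) / 2) Hg) as [d' [Hd' H']]; [lra|].
  set (e := Rmin (d / 2) (d' / 2)).
  assert (He : (0 < e)%R) by (apply Rmin_glb_lt; lra).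
  set (z := z0 + RtoC e).
  assert (Hz : Cmod (z - z0) = e).
  { unfold z. replace (z0 + RtoC e - z0) with (RtoC e) by ring.
    rewrite Cmod_R. apply Rabs_pos_eq. lra. }
  assert (e <= d / 2)%R by apply Rmin_l. assert (e <= d' / 2)%R by apply Rmin_r.
  assert (Nz : z <> z0).
  { intros Ez. rewrite Ez, Cdiff_0, Cmod_0 in Hz. lra. }
  specialize (H z). specialize (H' z). rewrite Hz in H, H'.
  rewrite (E z Nz) in H.
  assert (Cmod (f z0 - g z0) <= Cmod (g z - g z0) + Cmod (g z - f z0))%R.
  { replace (f z0 - g z0) with ((g z - g z0) + - (g z - f z0)) by ring.
    eapply Rle_trans; [apply Cmod_triangle|]. rewrite Cmod_opp. lra. }
  specialize (H ltac:(lra)). specialize (H' ltac:(lra)). lra.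
Qed.

Lemma holo_quotient f z0 : holo f z0 ->
  exists g, (forall z, holo f z -> holo g z) /\
    forall z, f z = f z0 + (z - z0) * g z.
Proof.
  intros H. destruct (H 2%nat) as [g [Hg E]].
  exists g. split; [|exact E]. intros z Hz.
  destruct (Ceq_dec z z0) as [->|N].
  - intros k. destruct (H (S (S k))) as [g' [Hg' E']].
    assert (E0 : forall w, w <> z0 -> g' w = g w).
    { intros w Nw. assert (Q : (w - z0) * g' w = (w - z0) * g w).
      { transitivity (f w - f z0); [rewrite (E' w) | rewrite (E w)]; ring. }
      apply Cminus_neq in Nw.
      replace (g' w) with ((w - z0) * g' w / (w - z0)) by (field; exact Nw).
      rewrite Q. field. exact Nw. }
    apply jet_pred. apply jet_ext with g'; [|exact Hg'].
    intros w. destruct (Ceq_dec w z0) as [->|Nw]; [|auto].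
    apply jet_limit_unique; auto. apply jet_le with (S k); [lia|exact Hg'].
  - assert (P : (0 < Cmod (z - z0))%R) by now apply Cmod_pos, Cminus_neq.
    apply holo_loc with (f := fun w => (f w - f z0) / (w - z0)) (d := Cmod (z - z0)); [exact P| |].
    + intros w Hw. assert (Nw : w - z0 <> 0).
      { intros Ew. assert (w = z0) by now apply Ceq_minus.
        subst w. replace (z0 - z) with (- (z - z0)) in Hw by ring.
        rewrite Cmod_opp in Hw. lra. }
      rewrite (E w). field. exact Nw.
    + apply holo_div; [now apply Cminus_neq| |];
        apply holo_minus; auto using holo_const, holo_id.
Qed.

(** * Maximum principle *)

Lemma sqrt_2_lt_2 : (sqrt 2 < 2)%R.
Proof. rewrite <- (sqrt_Rsqr 2) at 2 by lra. apply sqrt_lt_1; unfold Rsqr; lra. Qed.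

Lemma compact_uniform (B : R) (P : C -> R -> Prop) :
  (forall z n m, (n <= m)%R -> P z n -> P z m) ->
  (forall z, exists d n : R, (0 < d)%R /\ forall w, (Cmod (w - z) < d)%R -> P w n) ->
  exists n : R, forall z, (Cmod z <= B)%R -> P z n.
Proof.
  intros Hm Hl.
  assert (H : forall u v : R, exists e : posreal, exists n : R, (n <= / e)%R /\
    forall w : C, (Rabs (fst w - u) < e)%R -> (Rabs (snd w - v) < e)%R -> P w n).
  { intros u v. destruct (Hl (u, v)) as [d [n [Hd Hn]]].
    assert (Q : (0 < Rmin (d / 2) (/ (1 + Rabs n)))%R).
    { apply Rmin_glb_lt; [lra|]. apply Rinv_0_lt_compat. assert (H := Rabs_pos n). lra. }
    exists (mkposreal _ Q), n. simpl. split.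
    - apply Rle_trans with (1 + Rabs n)%R; [assert (H := Rle_abs n); lra|].
      rewrite <- (Rinv_inv (1 + Rabs n)) at 1. apply Rinv_le_contravar; [exact Q|apply Rmin_r].
    - intros w H1 H2. apply Hn.
      eapply Rle_lt_trans; [apply Cmod_2Rmax|]. simpl.
      assert (E : (Rmax (Rabs (fst w - u)) (Rabs (snd w - v)) < d / 2)%R).
      { apply Rmax_lub_lt; (eapply Rlt_le_trans; [eassumption|apply Rmin_l]). }
      assert (S := sqrt_2_lt_2). assert (S0 := sqrt_pos 2).
      assert (E0 : (0 <= Rmax (Rabs (fst w - u)) (Rabs (snd w - v)))%R).
      { eapply Rle_trans; [apply (Rabs_pos (fst w - u))|apply Rmax_l]. }
      unfold Rminus in *. nra. }
  set (delta := fun u v => proj1_sig (constructive_indefinite_description _ (H u v))).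
  destruct (compactness_value_2d (- B) B (- B) B delta) as [d Hd].
  exists (/ d)%R. intros z Hz.
  assert (Hx : (- B <= fst z <= B)%R).
  { apply Rabs_le_between. eapply Rle_trans; [|exact Hz]. apply re_le_Cmod. }
  assert (Hy : (- B <= snd z <= B)%R).
  { apply Rabs_le_between. eapply Rle_trans; [|exact Hz].
    eapply Rle_trans; [|apply Rmax_Cmod]. apply Rmax_r. }
  destruct (NNPP _ (Hd (fst z) (snd z) Hx Hy)) as [u [v [_ [_ [Hu [Hv Hdd]]]]]].
  unfold delta in Hu, Hv, Hdd.
  destruct (constructive_indefinite_description _ (H u v)) as [e [n [Hn HP]]]. simpl in *.
  apply Hm with n; [|auto]. eapply Rle_trans; [exact Hn|].
  apply Rinv_le_contravar; [apply cond_pos|exact Hdd].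
Qed.

Lemma compact_max (u : C -> R) (K : C -> Prop) (B : R) :
  (exists z, K z) -> (forall z, K z -> (Cmod z <= B)%R) ->
  (forall z, ~ K z -> exists d, (0 < d)%R /\ forall w, (Cmod (w - z) < d)%R -> ~ K w) ->
  (forall z eps, K z -> (0 < eps)%R -> exists d, (0 < d)%R /\
     forall w, (Cmod (w - z) < d)%R -> (u w < u z + eps)%R) ->
  exists z, K z /\ forall w, K w -> (u w <= u z)%R.
Proof.
  intros [z0 Hz0] HB Hcl Hu.
  destruct (compact_uniform B (fun w n => K w -> (u w <= n)%R)) as [n Hn].
  { intros z n m Hnm Hz Kz. specialize (Hz Kz). lra. }
  { intros z. destruct (classic (K z)) as [Kz|Kz].
    - destruct (Hu z 1%R Kz ltac:(lra)) as [d [Hd H]].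
      exists d, (u z + 1)%R. split; [exact Hd|]. intros w Hw _. left. now apply H.
    - destruct (Hcl z Kz) as [d [Hd H]]. exists d, 0%R. split; [exact Hd|].
      intros w Hw Kw. now elim (H w Hw). }
  destruct (completeness (fun y => exists z, K z /\ y = u z)) as [S [HS1 HS2]].
  { exists n. intros y [z [Kz ->]]. apply Hn; auto. }
  { now exists (u z0), z0. }
  destruct (classic (exists z, K z /\ u z = S)) as [[z [Kz Ez]]|N].
  { exists z. split; [exact Kz|]. intros w Kw. rewrite Ez. apply HS1. now exists w. }
  exfalso.
  assert (L : forall w, K w -> (u w < S)%R).
  { intros w Kw. destruct (Rle_lt_or_eq_dec (u w) S) as [|E]; [apply HS1; now exists w|assumption|].
    elim N. now exists w. }
  destruct (compact_uniform B (fun w n => K w -> (/ (S - u w) <= n)%R)) as [m Hmm].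
  { intros z a b Hnm Hz Kz. specialize (Hz Kz). lra. }
  { intros z. destruct (classic (K z)) as [Kz|Kz].
    - assert (Lz := L z Kz).
      destruct (Hu z ((S - u z) / 2)%R Kz ltac:(lra)) as [d [Hd H]].
      exists d, (/ ((S - u z) / 2))%R. split; [exact Hd|]. intros w Hw _.
      specialize (H w Hw). apply Rinv_le_contravar; lra.
    - destruct (Hcl z Kz) as [d [Hd H]]. exists d, 0%R. split; [exact Hd|].
      intros w Hw Kw. now elim (H w Hw). }
  assert (Pm : (0 < m)%R).
  { eapply Rlt_le_trans; [|apply (Hmm z0); auto]. apply Rinv_0_lt_compat.
    specialize (L z0 Hz0). lra. }
  assert (Im : (0 < / m)%R) by now apply Rinv_0_lt_compat.
  assert (Q : (S <= S - / m)%R); [|lra].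
  apply HS2. intros y [z [Kz ->]]. specialize (Hmm z (HB z Kz) Kz). specialize (L z Kz).
  assert (/ m <= S - u z)%R; [|lra].
  rewrite <- (Rinv_inv (S - u z)). apply Rinv_le_contravar; [|exact Hmm].
  apply Rinv_0_lt_compat. lra.
Qed.

Lemma Cmod_minus_sym (z w : C) : Cmod (z - w) = Cmod (w - z).
Proof. replace (z - w) with (- (w - z)) by ring. apply Cmod_opp. Qed.

Lemma Cmod_triangle_minus (z w : C) : (Cmod z <= Cmod w + Cmod (z - w))%R.
Proof. replace z with (w + (z - w)) at 1 by ring. apply Cmod_triangle. Qed.

Lemma Cmod_sq (z : C) : (Cmod z * Cmod z = fst z * fst z + snd z * snd z)%R.
Proof. generalize (Cmod2_alt z). unfold Re, Im. lra. Qed.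

(* The four increments [e, i e, -e, -i e] and their squares sum to zero, so the
   average of [f] over them is [f z] up to third order, whereas the average of
   [|.|^2] exceeds [|z|^2] by [e^2]. *)
Lemma four_point f z del :
  holo f z -> (0 < del)%R -> exists d, (0 < d)%R /\ forall e, (0 < e < d)%R ->
  exists w, (Cmod (w - z) = e)%R /\
    (Cmod (f z) + del * (Cmod z * Cmod z) < Cmod (f w) + del * (Cmod w * Cmod w))%R.
Proof.
  intros H Hdel.
  destruct (H 3%nat) as [g [[k [[l [[d [L [Hd HL]]] El]] Ek]] Eg]].
  assert (HL0 : (0 <= L)%R).
  { eapply Rle_trans; [apply Cmod_ge_0|]. apply (HL z). rewrite Cdiff_0, Cmod_0. lra. }
  exists (Rmin d (del / (L + 1))). split.
  { apply Rmin_glb_lt; [exact Hd|]. apply Rdiv_lt_0_compat; lra. }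
  intros e [He1 He2].
  assert (Hed : (e < d)%R) by (eapply Rlt_le_trans; [exact He2|apply Rmin_l]).
  assert (Hel : (e * (L + 1) < del)%R).
  { replace del with (del / (L + 1) * (L + 1))%R by (field; lra).
    apply Rmult_lt_compat_r; [lra|]. eapply Rlt_le_trans; [exact He2|apply Rmin_r]. }
  set (w1 := z + RtoC e). set (w2 := z + RtoC e * Ci).
  set (w3 := z - RtoC e). set (w4 := z - RtoC e * Ci).
  assert (Ce : Cmod (RtoC e) = e) by (rewrite Cmod_R; apply Rabs_pos_eq; lra).
  assert (D1 : Cmod (w1 - z) = e).
  { unfold w1. replace (z + RtoC e - z) with (RtoC e) by ring. exact Ce. }
  assert (D2 : Cmod (w2 - z) = e).
  { unfold w2. replace (z + RtoC e * Ci - z) with (RtoC e * Ci) by ring.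
    rewrite Cmod_mult, Cmod_Ci, Ce. ring. }
  assert (D3 : Cmod (w3 - z) = e).
  { unfold w3. replace (z - RtoC e - z) with (- RtoC e) by ring. now rewrite Cmod_opp. }
  assert (D4 : Cmod (w4 - z) = e).
  { unfold w4. replace (z - RtoC e * Ci - z) with (- (RtoC e * Ci)) by ring.
    rewrite Cmod_opp, Cmod_mult, Cmod_Ci, Ce. ring. }
  assert (S2 : (Cmod w1 * Cmod w1 + Cmod w2 * Cmod w2 + Cmod w3 * Cmod w3 + Cmod w4 * Cmod w4
    = 4 * (Cmod z * Cmod z) + 4 * (e * e))%R).
  { rewrite !Cmod_sq. unfold w1, w2, w3, w4. simpl. ring. }
  assert (F : forall w, f w = f z + (w - z) * g z + (w - z) * (w - z) * k z
                               + (w - z) * (w - z) * (w - z) * l w).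
  { intros w. rewrite (Eg w), (Ek w), (El w). ring. }
  assert (C2 : Ci * Ci = - (1)) by (unfold Ci, Cmult, Copp, RtoC; simpl; f_equal; ring).
  set (T := fun w => (w - z) * (w - z) * (w - z) * l w).
  assert (TB : forall w, Cmod (w - z) = e -> (Cmod (T w) <= e * e * e * L)%R).
  { intros w Ew. unfold T. rewrite !Cmod_mult, Ew. apply Rmult_le_compat_l; [nra|].
    apply HL. lra. }
  assert (SF : f w1 + f w2 + f w3 + f w4 = 4 * f z + (T w1 + T w2 + T w3 + T w4)).
  { rewrite (F w1), (F w2), (F w3), (F w4). unfold T.
    assert (E1 : w1 - z = RtoC e) by (unfold w1; ring).
    assert (E2 : w2 - z = RtoC e * Ci) by (unfold w2; ring).
    assert (E3 : w3 - z = - RtoC e) by (unfold w3; ring).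
    assert (E4 : w4 - z = - (RtoC e * Ci)) by (unfold w4; ring).
    rewrite E1, E2, E3, E4.
    replace (RtoC e * Ci * (RtoC e * Ci)) with (- (RtoC e * RtoC e))
      by (replace (RtoC e * Ci * (RtoC e * Ci)) with (RtoC e * RtoC e * (Ci * Ci)) by ring;
          rewrite C2; ring).
    replace (- (RtoC e * Ci) * - (RtoC e * Ci)) with (- (RtoC e * RtoC e))
      by (replace (- (RtoC e * Ci) * - (RtoC e * Ci)) with (RtoC e * RtoC e * (Ci * Ci)) by ring;
          rewrite C2; ring).
    ring. }
  assert (M4 : (4 * Cmod (f z) <= Cmod (f w1) + Cmod (f w2) + Cmod (f w3) + Cmod (f w4)
                + 4 * (e * e * e * L))%R).
  { assert (E : 4 * f z = f w1 + f w2 + f w3 + f w4 + - (T w1 + T w2 + T w3 + T w4))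
      by (rewrite SF; ring).
    replace (4 * Cmod (f z))%R with (Cmod (4 * f z))
      by (rewrite Cmod_mult, Cmod_R, Rabs_pos_eq; lra).
    rewrite E.
    eapply Rle_trans; [apply Cmod_triangle|]. rewrite Cmod_opp.
    assert (A1 := Cmod_triangle (f w1 + f w2 + f w3) (f w4)).
    assert (A2 := Cmod_triangle (f w1 + f w2) (f w3)).
    assert (A3 := Cmod_triangle (f w1) (f w2)).
    assert (B1 := Cmod_triangle (T w1 + T w2 + T w3) (T w4)).
    assert (B2 := Cmod_triangle (T w1 + T w2) (T w3)).
    assert (B3 := Cmod_triangle (T w1) (T w2)).
    assert (Q1 := TB w1 D1). assert (Q2 := TB w2 D2).
    assert (Q3 := TB w3 D3). assert (Q4 := TB w4 D4). lra. }
  assert (G : (e * e * e * L < del * (e * e))%R).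
  { replace (e * e * e * L)%R with ((e * L) * (e * e))%R by ring.
    apply Rmult_lt_compat_r; nra. }
  set (u := fun w => (Cmod (f w) + del * (Cmod w * Cmod w))%R).
  assert (SU : (4 * u z < u w1 + u w2 + u w3 + u w4)%R).
  { unfold u. nra. }
  unfold u in SU.
  destruct (Rlt_dec (u z) (u w1)) as [|N1]; [now exists w1|].
  destruct (Rlt_dec (u z) (u w2)) as [|N2]; [now exists w2|].
  destruct (Rlt_dec (u z) (u w3)) as [|N3]; [now exists w3|].
  exists w4. split; [exact D4|]. unfold u in *. lra.
Qed.

Theorem max_principle f (K : C -> Prop) (B M : R) :
  (forall z, K z -> (Cmod z <= B)%R) ->
  (forall z, ~ K z -> exists d, (0 < d)%R /\ forall w, (Cmod (w - z) < d)%R -> ~ K w) ->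
  (forall z, K z -> holo f z) ->
  (forall z, K z -> (exists d, (0 < d)%R /\ forall w, (Cmod (w - z) < d)%R -> K w)
                    \/ (Cmod (f z) <= M)%R) ->
  forall z, K z -> (Cmod (f z) <= M)%R.
Proof.
  intros HB Hcl Hf Hbd z Kz.
  assert (B0 : (0 <= B)%R) by (eapply Rle_trans; [apply Cmod_ge_0|apply (HB z Kz)]).
  apply le_epsilon. intros eps Heps.
  set (del := (eps / (B * B + 1))%R).
  assert (Hdel : (0 < del)%R) by (apply Rdiv_lt_0_compat; nra).
  assert (Edel : (del * (B * B) <= eps)%R).
  { replace eps with (del * (B * B + 1))%R at 1 by (unfold del; field; nra). nra. }
  destruct (compact_max (fun w => (Cmod (f w) + del * (Cmod w * Cmod w))%R) K B) as [m [Km Hm]];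
    [now exists z|exact HB|exact Hcl| |].
  - intros w e Kw He.
    destruct (jet_cont_eps f w (e / 2) (Hf w Kw 1%nat)) as [d [Hd H]]; [lra|].
    set (c := (e / 2 / (del * (2 * Cmod w + 1)))%R).
    assert (W0 := Cmod_ge_0 w).
    assert (Hc : (0 < c)%R) by (apply Rdiv_lt_0_compat; nra).
    assert (Ec : (c * (del * (2 * Cmod w + 1)) = e / 2)%R) by (unfold c; field; nra).
    exists (Rmin d (Rmin 1 c)). split; [repeat apply Rmin_glb_lt; lra|].
    intros v Hv.
    assert (V1 : (Cmod (v - w) < d)%R) by (eapply Rlt_le_trans; [exact Hv|apply Rmin_l]).
    assert (V2 : (Cmod (v - w) < Rmin 1 c)%R) by (eapply Rlt_le_trans; [exact Hv|apply Rmin_r]).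
    assert (V3 : (Cmod (v - w) < 1)%R) by (eapply Rlt_le_trans; [exact V2|apply Rmin_l]).
    assert (V4 : (Cmod (v - w) < c)%R) by (eapply Rlt_le_trans; [exact V2|apply Rmin_r]).
    specialize (H v V1). assert (T1 := Cmod_triangle_minus (f v) (f w)).
    assert (T2 := Cmod_triangle_minus v w). assert (T0 := Cmod_ge_0 v).
    set (t := Cmod (v - w)) in *. assert (t0 : (0 <= t)%R) by apply Cmod_ge_0.
    assert (Q : (Cmod v * Cmod v <= Cmod w * Cmod w + t * (2 * Cmod w + 1))%R) by nra.
    assert (Q2 : (t * (del * (2 * Cmod w + 1)) <= c * (del * (2 * Cmod w + 1)))%R).
    { apply Rmult_le_compat_r; nra. }
    nra.
  - assert (Mz := Hm z Kz).
    assert (Pz : (0 <= Cmod z * Cmod z)%R) by (assert (P := Cmod_ge_0 z); nra).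
    destruct (Hbd m Km) as [[d [Hd HK]]|Hle].
    + exfalso. destruct (four_point f m del (Hf m Km) Hdel) as [d' [Hd' H]].
      destruct (H (Rmin d d' / 2)%R) as [w [Ew Hw]].
      { assert (0 < Rmin d d')%R by now apply Rmin_glb_lt. 
        assert (Rmin d d' <= d')%R by apply Rmin_r. lra. }
      assert (0 < Rmin d d')%R by now apply Rmin_glb_lt. 
      assert (Rmin d d' <= d)%R by apply Rmin_l.
      assert (Q := Hm w ltac:(apply HK; lra)). lra.
    + assert (Q := HB m Km). assert (Q0 := Cmod_ge_0 m).
      assert (Cmod m * Cmod m <= B * B)%R by nra. nra.
Qed.

Lemma max_principle_disc f c r M :
  (forall z, (Cmod (z - c) <= r)%R -> holo f z) ->
  (forall z, (Cmod (z - c) = r)%R -> (Cmod (f z) <= M)%R) ->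
  forall z, (Cmod (z - c) <= r)%R -> (Cmod (f z) <= M)%R.
Proof.
  intros Hf Hb. apply (max_principle f (fun z => (Cmod (z - c) <= r)%R) (Cmod c + r)%R).
  - intros z Hz. assert (T := Cmod_triangle_minus z c). lra.
  - intros z Hz. exists (Cmod (z - c) - r)%R. split; [lra|]. intros w Hw Hw'.
    assert (T := Cmod_triangle (z - w) (w - c)).
    replace (z - w + (w - c)) with (z - c) in T by ring. rewrite Cmod_minus_sym in Hw. lra.
  - exact Hf.
  - intros z [Hz|Hz]; [left|right; auto].
    exists (r - Cmod (z - c))%R. split; [lra|]. intros w Hw.
    assert (T := Cmod_triangle (w - z) (z - c)).
    replace (w - z + (z - c)) with (w - c) in T by ring. lra.
Qed.

(** * Complex derivatives and divisibility *)

Definition entire (f : C -> C) : Prop := forall z, holo f z.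

Definition complex_deriv (f : C -> C) (z l : C) : Prop :=
  exists g, holo g z /\ (forall w, f w = f z + (w - z) * g w) /\ g z = l.

Lemma C_derive_eq f z l : complex_deriv f z l -> C_derive f z = l.
Proof.
  intros [g [Hg [E El]]]. unfold C_derive. apply is_C_lim_unique.
  intros P [eps HP].
  destruct (jet_cont_eps g z eps (Hg 1%nat) (cond_pos eps)) as [d [Hd H]].
  assert (Hd2 : (0 < d / 2)%R) by lra.
  exists (mkposreal _ Hd2). intros w Hw Nw. apply HP.
  apply (C_NormedModule_mixin_compat1 l _ eps).
  change (Cmod ((f w - f z) / (w - z) - l) < eps)%R.
  rewrite (E w). replace ((f z + (w - z) * g w - f z) / (w - z)) with (g w)
    by (field; now apply Cminus_neq).
  rewrite <- El. apply H.
  assert (Q := C_NormedModule_mixin_compat2 z w (mkposreal _ Hd2) Hw). simpl in Q.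
  change (Cmod (w - z) < sqrt 2 * (d / 2))%R in Q.
  assert (S := sqrt_2_lt_2).
  nra.
Qed.

Lemma complex_deriv_exists f z : holo f z -> complex_deriv f z (C_derive f z).
Proof.
  intros H. destruct (holo_quotient f z H) as [g [Hg E]].
  assert (Q : complex_deriv f z (g z)) by (exists g; auto).
  now rewrite (C_derive_eq _ _ _ Q).
Qed.

Lemma complex_deriv_ext f g z l : (forall w, f w = g w) ->
  complex_deriv f z l -> complex_deriv g z l.
Proof.
  intros E [h [Hh [E1 E2]]]. exists h. split; [exact Hh|]. split; [|exact E2].
  intros w. now rewrite <- !E.
Qed.

Lemma complex_deriv_mult f g z l l' : holo f z -> complex_deriv f z l -> complex_deriv g z l' ->
  complex_deriv (fun w => f w * g w) z (l * g z + f z * l').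
Proof.
  intros Hf [p [Hp [E1 E2]]] [q [Hq [E3 E4]]].
  exists (fun w => p w * g z + f w * q w). split; [|split].
  - apply holo_plus; apply holo_mult; auto using holo_const.
  - intros w. rewrite (E3 w), (E1 w). ring.
  - now rewrite E2, E4.
Qed.

Lemma complex_deriv_affine a z : complex_deriv (fun w => w - a) z 1.
Proof.
  exists (fun _ => 1). split; [apply holo_const|]. split; [intros; ring|reflexivity].
Qed.

Lemma entire_bounded f B : entire f -> exists M : R, forall z, (Cmod z <= B)%R -> (Cmod (f z) <= M)%R.
Proof.
  intros H. apply (compact_uniform B (fun z n => (Cmod (f z) <= n)%R)).
  - intros; lra.
  - intros z. destruct (jet_cont_eps f z 1 (H z 1%nat)) as [d [Hd Q]]; [lra|].
    exists d, (Cmod (f z) + 1)%R. split; [exact Hd|]. intros w Hw.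
    assert (T := Cmod_triangle_minus (f w) (f z)). specialize (Q w Hw). lra.
Qed.

Lemma C_derive_bound f w M : entire f ->
  (forall z, (Cmod (z - w) <= 1)%R -> (Cmod (f z) <= M)%R) -> (Cmod (C_derive f w) <= 2 * M)%R.
Proof.
  intros H HM. destruct (holo_quotient f w (H w)) as [g [Hg E]].
  rewrite (C_derive_eq f w (g w)) by (exists g; auto).
  assert (W : (Cmod (w - w) <= 1)%R) by (rewrite Cdiff_0, Cmod_0; lra).
  apply (max_principle_disc g w 1); [auto| |exact W].
  intros z Hz. assert (Nz : z - w <> 0) by (apply Cmod_pos_neq; lra).
  replace (g z) with ((f z - f w) / (z - w)) by (rewrite (E z); field; exact Nz).
  rewrite Cmod_div, Hz by exact Nz.
  assert (T := Cmod_triangle (f z) (- f w)). rewrite Cmod_opp in T.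
  assert (Q1 := HM w W). assert (Q2 := HM z ltac:(lra)). unfold Cminus. lra.
Qed.

Lemma entire_C_derive f : entire f -> entire (C_derive f).
Proof.
  intros H z0 k. revert f H. induction k as [|k IH]; intros f H.
  - destruct (entire_bounded f (Cmod z0 + 2)%R H) as [M HM].
    exists 1%R, (2 * M)%R. split; [lra|]. intros w Hw.
    apply C_derive_bound; [exact H|]. intros z Hz. apply HM.
    assert (T1 := Cmod_triangle_minus z w). assert (T2 := Cmod_triangle_minus w z0). lra.
  - destruct (holo_quotient f z0 (H z0)) as [p [Hp E]].
    assert (Ep : entire p) by (intros z; auto).
    assert (D : forall w, C_derive f w = p w + (w - z0) * C_derive p w).
    { intros w. destruct (holo_quotient p w (Ep w)) as [q [Hq Eq]].
      rewrite (C_derive_eq p w (q w)) by (exists q; auto).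
      apply C_derive_eq. exists (fun z => p w + (z - z0) * q z). split; [|split].
      - apply holo_plus; [apply holo_const|]. apply holo_mult; [|auto].
        apply holo_minus; auto using holo_id, holo_const.
      - intros z. rewrite (E z), (E w), (Eq z). ring.
      - reflexivity. }
    apply jet_ext with (fun w => p w + (w - z0) * C_derive p w); [intros; now rewrite D|].
    apply jet_plus; [apply Ep|].
    exists (C_derive p). split; [now apply IH|]. intros z. ring.
Qed.

Lemma C_derive_factor f d z0 m : entire d -> (forall z, f z = (z - z0) ^ S m * d z) ->
  exists d', entire d' /\ d' z0 = RtoC (INR (S m)) * d z0 /\
    forall z, C_derive f z = (z - z0) ^ m * d' z.
Proof.
  intros Hd. revert f. induction m as [|m IH]; intros f E.
  - exists (fun z => d z + (z - z0) * C_derive d z). split; [|split].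
    + intros z. apply holo_plus; [apply Hd|]. apply holo_mult; [|now apply entire_C_derive].
      apply holo_minus; auto using holo_id, holo_const.
    + simpl. ring.
    + intros z. apply C_derive_eq. apply complex_deriv_ext with (fun w => (w - z0) * d w).
      { intros w. rewrite E. simpl. ring. }
      replace ((z - z0) ^ 0 * (d z + (z - z0) * C_derive d z))
        with (1 * d z + (z - z0) * C_derive d z) by (simpl; ring).
      apply (complex_deriv_mult (fun w => w - z0) d).
      * apply holo_minus; auto using holo_id, holo_const.
      * apply complex_deriv_affine.
      * now apply complex_deriv_exists.
  - destruct (IH (fun z => (z - z0) ^ S m * d z)) as [d1 [H1 [V1 D1]]]; [reflexivity|].
    exists (fun z => d z + d1 z). split; [|split].
    + intros z. apply holo_plus; auto.
    + rewrite V1. rewrite (S_INR (S m)). rewrite RtoC_plus. ring.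
    + intros z. apply C_derive_eq.
      apply complex_deriv_ext with (fun w => (w - z0) * ((w - z0) ^ S m * d w)).
      { intros w. rewrite E. simpl. ring. }
      replace ((z - z0) ^ S m * (d z + d1 z))
        with (1 * ((z - z0) ^ S m * d z) + (z - z0) * ((z - z0) ^ m * d1 z)) by (simpl; ring).
      apply (complex_deriv_mult (fun w => w - z0) (fun w => (w - z0) ^ S m * d w)).
      * apply holo_minus; auto using holo_id, holo_const.
      * apply complex_deriv_affine.
      * rewrite <- D1. apply complex_deriv_exists.
        apply (holo_mult (fun w => (w - z0) ^ S m) d); [|apply Hd].
        apply (holo_pow (fun w => w - z0)). apply holo_minus; auto using holo_id, holo_const.
Qed.

Lemma C_derive_n_factor f d z0 m : entire d -> (forall z, f z = (z - z0) ^ m * d z) ->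
  forall k, (k <= m)%nat -> exists (c : R) d', c <> 0%R /\ entire d' /\ d' z0 = RtoC c * d z0 /\
    forall z, C_derive_n f k z = (z - z0) ^ (m - k) * d' z.
Proof.
  intros Hd E k. induction k as [|k IH]; intros Hk.
  - exists 1%R, d. split; [lra|]. split; [exact Hd|]. split; [ring|].
    intros z. simpl. rewrite Nat.sub_0_r. apply E.
  - destruct IH as [c [d1 [Nc [H1 [V1 D1]]]]]; [lia|].
    replace (m - k)%nat with (S (m - S k)) in D1 by lia.
    destruct (C_derive_factor (C_derive_n f k) d1 z0 (m - S k) H1 D1) as [d2 [H2 [V2 D2]]].
    exists (INR (S (m - S k)) * c)%R, d2. split; [|split; [exact H2|split]].
    + apply Rmult_integral_contrapositive_currified; [|exact Nc]. apply not_0_INR. lia.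
    + rewrite V2, V1, RtoC_mult. ring.
    + exact D2.
Qed.

Lemma entire_zero_order f z0 m : entire f ->
  (forall k, (k < m)%nat -> C_derive_n f k z0 = 0) ->
  exists d, entire d /\ (forall z, f z = (z - z0) ^ m * d z) /\
    (C_derive_n f m z0 <> 0 -> d z0 <> 0).
Proof.
  intros H Hz. 
  assert (F : forall j, (j <= m)%nat -> exists d, entire d /\ forall z, f z = (z - z0) ^ j * d z).
  { induction j as [|j IH]; intros Hj.
    - exists f. split; [exact H|]. intros; simpl; ring.
    - destruct IH as [d [Hd E]]; [lia|].
      destruct (C_derive_n_factor f d z0 j Hd E j (le_n j)) as [c [d' [Nc [_ [V D]]]]].
      assert (Z : d z0 = 0).
      { assert (Q : RtoC c * d z0 = 0).
        { rewrite <- V. rewrite <- (Hz j ltac:(lia)), D, Nat.sub_diag. simpl. ring. }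
        replace (d z0) with (RtoC c * d z0 / RtoC c) by (field; intros X; apply Nc; now injection X).
        rewrite Q. field. intros X; apply Nc; now injection X. }
      destruct (holo_quotient d z0 (Hd z0)) as [g [Hg Eg]].
      exists g. split; [intros z; auto|]. intros z. rewrite (E z), (Eg z), Z. simpl. ring. }
  destruct (F m (le_n m)) as [d [Hd E]]. exists d. split; [exact Hd|]. split; [exact E|].
  intros N Z. apply N.
  destruct (C_derive_n_factor f d z0 m Hd E m (le_n m)) as [c [d' [Nc [_ [V D]]]]].
  rewrite D, V, Z. ring.
Qed.

Lemma Cpow_neq_0 (z : C) n : z <> 0 -> z ^ n <> 0.
Proof. intros H. apply Cmod_pos_neq. rewrite Cmod_pow. apply pow_lt. now apply Cmod_pos. Qed.

(* Divisibility of entire functions is local: it only has to be tested at the zeros. *)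
Lemma entire_divide f n : entire f -> entire n ->
  (forall z, f z = 0 -> exists m, zero_mult f z m /\ forall k, (k < m)%nat -> C_derive_n n k z = 0) ->
  exists g, entire g /\ forall z, n z = f z * g z.
Proof.
  intros Hf Hn Hz.
  assert (L : forall z0, exists g d, (0 < d)%R /\ holo g z0 /\ f z0 * g z0 = n z0 /\
             forall w, (Cmod (w - z0) < d)%R -> w <> z0 -> f w <> 0 /\ n w = f w * g w).
  { intros z0. destruct (Ceq_dec (f z0) 0) as [Z|N].
    - destruct (Hz z0 Z) as [m [[Hm1 Hm2] Hm3]].
      destruct (entire_zero_order f z0 m Hf Hm1) as [d [Hd [Ed Nd]]].
      destruct (entire_zero_order n z0 m Hn Hm3) as [e [He [Ee _]]].
      specialize (Nd Hm2). assert (Pd : (0 < Cmod (d z0))%R) by now apply Cmod_pos.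
      destruct (jet_cont_eps d z0 _ (Hd z0 1%nat) Pd) as [r [Hr Q]].
      assert (Nw : forall w, (Cmod (w - z0) < r)%R -> d w <> 0).
      { intros w Hw E. specialize (Q w Hw). rewrite E in Q.
        replace (0 - d z0) with (- d z0) in Q by ring. rewrite Cmod_opp in Q. lra. }
      exists (fun w => e w / d w), r. split; [exact Hr|]. split; [|split].
      + now apply holo_div.
      + rewrite (Ed z0), (Ee z0). field. exact Nd.
      + intros w Hw Nz. split.
        * rewrite Ed. apply Cmult_neq_0; [|auto]. apply Cpow_neq_0. now apply Cminus_neq.
        * rewrite (Ed w), (Ee w). field. auto.
    - assert (Pd : (0 < Cmod (f z0))%R) by now apply Cmod_pos.
      destruct (jet_cont_eps f z0 _ (Hf z0 1%nat) Pd) as [r [Hr Q]].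
      exists (fun w => n w / f w), r. split; [exact Hr|]. split; [|split].
      + now apply holo_div.
      + field. exact N.
      + intros w Hw Nz. assert (Nw : f w <> 0).
        { intros E. specialize (Q w Hw). rewrite E in Q.
          replace (0 - f z0) with (- f z0) in Q by ring. rewrite Cmod_opp in Q. lra. }
        split; [exact Nw|]. field. exact Nw. }
  set (g := fun z => proj1_sig (constructive_indefinite_description _ (L z)) z).
  exists g. split.
  - intros z0. generalize (eq_refl (g z0)). unfold g at 2.
    destruct (constructive_indefinite_description _ (L z0)) as [h [d [Hd [Hh [E0 E]]]]]. simpl.
    intros Eg. apply holo_loc with h d; [exact Hd| |exact Hh].
    intros w Hw. destruct (Ceq_dec w z0) as [->|Nw]; [now symmetry|].
    destruct (E w Hw Nw) as [Nf Ew].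
    unfold g. destruct (constructive_indefinite_description _ (L w)) as [h' [d' [? [? [E0' ?]]]]]. simpl.
    replace (h w) with (f w * h w / f w) by (field; exact Nf).
    rewrite <- Ew, <- E0'. field. exact Nf.
  - intros z. unfold g.
    destruct (constructive_indefinite_description _ (L z)) as [h [d [? [? [E0 ?]]]]]. now symmetry.
Qed.

(** * Quotients of functions of exponential type *)

Definition csqrt (w : C) : C :=
  let s := sqrt ((Cmod w + fst w) / 2) in (s, (snd w / (2 * s))%R).

Lemma csqrt_spec w : (0 < fst w)%R -> (0 < fst (csqrt w))%R /\ csqrt w * csqrt w = w.
Proof.
  intros H. unfold csqrt. set (s := sqrt ((Cmod w + fst w) / 2)).
  assert (M := Cmod_ge_0 w).
  assert (Q : (s * s = (Cmod w + fst w) / 2)%R) by (apply sqrt_sqrt; lra).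
  assert (P : (0 < s)%R) by (apply sqrt_lt_R0; lra).
  split; [exact P|].
  assert (S := Cmod_sq w). destruct w as [x y]. unfold Cmult. simpl fst in *. simpl snd in *.
  f_equal; [|field; lra].
  replace (y / (2 * s) * (y / (2 * s)))%R with (y * y / (4 * (s * s)))%R by (field; lra).
  rewrite Q. set (m := Cmod (x, y)) in *.
  replace (y * y)%R with ((m + x) * (m - x))%R by lra. field. lra.
Qed.

Lemma csqrt_1 : csqrt 1 = 1.
Proof.
  unfold csqrt. rewrite Cmod_1. simpl. replace ((1 + 1) / 2)%R with 1%R by field.
  rewrite sqrt_1. unfold RtoC. f_equal. field.
Qed.

Lemma Cneq_0_fst (w : C) : (0 < fst w)%R -> w <> 0.
Proof. intros H ->. simpl in H. lra. Qed.

Lemma holo_csqrt w0 : (0 < fst w0)%R -> holo csqrt w0.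
Proof.
  intros H. destruct (csqrt_spec w0 H) as [P0 E0].
  assert (N : forall w, (Cmod (w - w0) < fst w0)%R -> (0 < fst w)%R).
  { intros w Hw. assert (Q := re_le_Cmod (w - w0)). unfold Re in Q.
    apply (Rle_lt_trans _ _ _ Q) in Hw. apply Rabs_def2 in Hw. simpl in Hw. lra. }
  intros k. induction k as [|k IH].
  - exists (fst w0), (Cmod w0 + fst w0 + 1)%R. split; [exact H|].
    intros w Hw. destruct (csqrt_spec w (N w Hw)) as [_ E].
    assert (S : (Cmod (csqrt w) * Cmod (csqrt w) = Cmod w)%R) by now rewrite <- Cmod_mult, E.
    assert (T := Cmod_triangle_minus w w0). assert (G := Cmod_ge_0 (csqrt w)).
    assert (G0 := Cmod_ge_0 w0). nra.
  - apply jet_loc with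
      (f := fun w => csqrt w0 + (w - w0) * / (csqrt w + csqrt w0)) (d := fst w0); [exact H| |].
    + intros w Hw. destruct (csqrt_spec w (N w Hw)) as [P E].
      assert (Nz : csqrt w + csqrt w0 <> 0) by (apply Cneq_0_fst; simpl; simpl in *; lra).
      transitivity (csqrt w0 + (csqrt w * csqrt w - csqrt w0 * csqrt w0) * / (csqrt w + csqrt w0)).
      * rewrite E, E0. reflexivity.
      * field. exact Nz.
    + exists (fun w => / (csqrt w + csqrt w0)). split; [|intros; ring].
      apply (jet_recip k (fun w => csqrt w + csqrt w0) w0 (fst w0) (fst (csqrt w0))); auto.
      * intros w Hw. destruct (csqrt_spec w (N w Hw)) as [P E].
        eapply Rle_trans; [|apply re_le_Cmod].
        eapply Rle_trans; [|apply Rle_abs]. unfold Re. simpl in *. lra.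
      * apply jet_plus; [exact IH|apply jet_const].
Qed.

Lemma ratio_Re_pos (u v c : C) : c <> 0 ->
  (3 * Cmod (u - c) < Cmod c)%R -> (3 * Cmod (v - c) < Cmod c)%R -> (0 < fst (v / u)%C)%R.
Proof.
  intros N Hu Hv. assert (P : (0 < Cmod c)%R) by now apply Cmod_pos.
  assert (T1 := Cmod_triangle_minus c u). rewrite Cmod_minus_sym in T1.
  assert (Pu : (0 < Cmod u)%R) by lra. assert (Nu := Cmod_pos_neq u Pu).
  assert (T2 := Cmod_triangle (v - c) (- (u - c))). rewrite Cmod_opp in T2.
  replace (v - c + - (u - c)) with (v - u) in T2 by ring.
  assert (Q : (Cmod (v / u - 1) < 1)%R).
  { replace (v / u - 1) with ((v - u) / u) by (field; exact Nu).
    rewrite Cmod_div by exact Nu. apply Rmult_lt_reg_r with (Cmod u); [exact Pu|].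
    replace (Cmod (v - u) / Cmod u * Cmod u)%R with (Cmod (v - u)) by (field; lra). lra. }
  assert (R := re_le_Cmod (v / u - 1)). unfold Re in R.
  apply (Rle_lt_trans _ _ _ R) in Q. apply Rabs_def2 in Q.
  replace (fst (v / u)%C) with (fst (v / u - 1)%C + 1)%R by (simpl; ring). lra.
Qed.

(* A square root is obtained as a product of principal square roots of the ratios
   [f((k+1)z/n) / f(kz/n)], which are all close to [1]. *)
Lemma zero_free_sqrt f rho : (0 < rho)%R ->
  (forall z, (Cmod z <= rho)%R -> holo f z /\ f z <> 0) -> f 0 = 1 ->
  exists g, (forall z, (Cmod z <= rho)%R -> holo g z) /\ g 0 = 1 /\
    forall z, (Cmod z <= rho)%R -> g z * g z = f z.
Proof.
  intros Hr H H0.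
  destruct (compact_uniform rho (fun z n => (0 < n)%R /\ ((Cmod z <= rho)%R -> forall w,
    (Cmod w <= rho)%R -> (Cmod (w - z) * n <= 1)%R -> (0 < fst (f w / f z)%C)%R))) as [n Hn].
  { intros z n m Hnm [Pn Q]. split; [lra|]. intros Hz w Hw Hwz. apply Q; auto.
    assert (G := Cmod_ge_0 (w - z)). nra. }
  { intros c. destruct (Rle_dec (Cmod c) rho) as [Hc|Hc].
    - destruct (H c Hc) as [Hf N]. assert (P : (0 < Cmod (f c))%R) by now apply Cmod_pos.
      destruct (jet_cont_eps f c (Cmod (f c) / 3) (Hf 1%nat)) as [d [Hd Q]]; [lra|].
      exists (d / 2)%R, (4 / d)%R. split; [lra|]. intros z Hz.
      assert (P4 : (0 < 4 / d)%R) by (apply Rdiv_lt_0_compat; lra).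
      split; [exact P4|]. intros _ w _ Hw.
      assert (W : (Cmod (w - z) <= d / 4)%R).
      { apply Rmult_le_reg_r with (4 / d)%R; [exact P4|]. 
        replace (d / 4 * (4 / d))%R with 1%R by (field; lra). exact Hw. }
      assert (T := Cmod_triangle (w - z) (z - c)).
      replace (w - z + (z - c)) with (w - c) in T by ring.
      apply ratio_Re_pos with (f c); [exact N| |].
      + specialize (Q z ltac:(lra)). lra.
      + specialize (Q w ltac:(lra)). lra.
    - exists (Cmod c - rho)%R, 1%R. split; [lra|]. intros z Hz. split; [lra|]. intros Hz'.
      assert (T := Cmod_triangle_minus c z). rewrite Cmod_minus_sym in T. lra. }
  assert (Pn : (0 < n)%R) by (apply (Hn 0); rewrite Cmod_0; lra).
  destruct (INR_unbounded (rho * n)) as [N0 HN0].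
  set (N := S N0). assert (HN : (rho * n < INR N)%R) by (unfold N; rewrite S_INR; lra).
  assert (PN : (0 < INR N)%R) by (apply lt_0_INR; unfold N; lia).
  set (t := fun k : nat => (INR k / INR N)%R).
  assert (Ht : forall k, (k <= N)%nat -> (0 <= t k <= 1)%R).
  { intros k Hk. unfold t. apply le_INR in Hk. assert (Q := pos_INR k). split.
    - apply Rdiv_le_0_compat; lra.
    - apply Rmult_le_reg_r with (INR N); [exact PN|].
      replace (INR k / INR N * INR N)%R with (INR k) by (field; lra). lra. }
  assert (Hd : forall k z, (k <= N)%nat -> (Cmod z <= rho)%R -> (Cmod (RtoC (t k) * z) <= rho)%R).
  { intros k z Hk Hz. rewrite Cmod_mult, Cmod_R, Rabs_pos_eq by now apply Ht.
    specialize (Ht k Hk). assert (G := Cmod_ge_0 z). nra. }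
  assert (Q : forall K, (K <= N)%nat -> exists g, (forall z, (Cmod z <= rho)%R -> holo g z) /\
    g 0 = 1 /\ forall z, (Cmod z <= rho)%R -> g z * g z = f (RtoC (t K) * z)).
  { induction K as [|K IH]; intros HK.
    - exists (fun _ => 1). split; [intros; apply holo_const|]. split; [reflexivity|].
      intros z _. unfold t. change (INR 0) with 0%R.
      replace (0 / INR N)%R with 0%R by (field; lra).
      replace (RtoC 0 * z) with (RtoC 0) by ring. rewrite H0. ring.
    - destruct IH as [g [Hg [G0 Eg]]]; [lia|].
      assert (Rp : forall z, (Cmod z <= rho)%R ->
        (0 < fst (f (RtoC (t (S K)) * z) / f (RtoC (t K) * z))%C)%R).
      { intros z Hz. apply (Hn (RtoC (t K) * z)); try (apply Hd; auto; lia).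
        replace (RtoC (t (S K)) * z - RtoC (t K) * z) with (RtoC (/ INR N) * z).
        - rewrite Cmod_mult, Cmod_R, Rabs_pos_eq by (left; now apply Rinv_0_lt_compat).
          apply Rmult_le_reg_l with (INR N); [exact PN|].
          replace (INR N * (/ INR N * Cmod z * n))%R with (Cmod z * n)%R by (field; lra).
          assert (Q := Cmod_ge_0 z). nra.
        - unfold t. rewrite S_INR.
          replace (RtoC ((INR K + 1) / INR N)) with (RtoC (INR K / INR N) + RtoC (/ INR N)).
          + ring.
          + rewrite <- RtoC_plus. f_equal. field. lra. }
      exists (fun z => g z * csqrt (f (RtoC (t (S K)) * z) / f (RtoC (t K) * z))).
      split; [|split].
      + intros z Hz. apply holo_mult; [auto|].
        apply (holo_comp csqrt (fun z => f (RtoC (t (S K)) * z) / f (RtoC (t K) * z))).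
        * apply holo_csqrt. auto.
        * assert (L : forall k, (k <= N)%nat -> holo (fun z => f (RtoC (t k) * z)) z).
          { intros k Hk. apply (holo_comp f (fun z => RtoC (t k) * z)).
            - apply H. auto.
            - apply holo_mult; auto using holo_const, holo_id. }
          apply (holo_div (fun z => f (RtoC (t (S K)) * z)) (fun z => f (RtoC (t K) * z))).
          -- apply H. apply Hd; [lia|exact Hz].
          -- apply L. lia.
          -- apply L. lia.
      + rewrite G0. replace (RtoC (t (S K)) * 0) with (RtoC 0) by ring.
        replace (RtoC (t K) * 0) with (RtoC 0) by ring. rewrite H0.
        replace (1 / 1) with (RtoC 1) by field. rewrite csqrt_1. ring.
      + intros z Hz. destruct (csqrt_spec _ (Rp z Hz)) as [_ E].
        replace (g z * csqrt (f (RtoC (t (S K)) * z) / f (RtoC (t K) * z)) *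
          (g z * csqrt (f (RtoC (t (S K)) * z) / f (RtoC (t K) * z)))) with
          (g z * g z * (csqrt (f (RtoC (t (S K)) * z) / f (RtoC (t K) * z)) *
            csqrt (f (RtoC (t (S K)) * z) / f (RtoC (t K) * z)))) by ring.
        rewrite E, (Eg z Hz). field. apply H. apply Hd; [lia|exact Hz]. }
  destruct (Q N (le_n N)) as [g [Hg [G0 Eg]]]. exists g. split; [exact Hg|]. split; [exact G0|].
  intros z Hz. rewrite (Eg z Hz). f_equal. unfold t. replace (INR N / INR N)%R with 1%R by (field; lra). ring.
Qed.

Lemma Cpow_mult_exp (z : C) n m : z ^ (n * m) = (z ^ n) ^ m.
Proof.
  induction m as [|m IH]; [now rewrite Nat.mul_0_r|].
  rewrite Nat.mul_succ_r, Nat.add_comm, Cpow_add_r, IH. reflexivity.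
Qed.

Lemma zero_free_root f rho m : (0 < rho)%R ->
  (forall z, (Cmod z <= rho)%R -> holo f z /\ f z <> 0) -> f 0 = 1 ->
  exists g, (forall z, (Cmod z <= rho)%R -> holo g z) /\ g 0 = 1 /\
    forall z, (Cmod z <= rho)%R -> g z ^ (2 ^ m) = f z.
Proof.
  intros Hr H H0. induction m as [|m [g [Hg [G0 Eg]]]].
  - exists f. split; [intros; now apply H|]. split; [exact H0|]. intros z _. simpl. ring.
  - destruct (zero_free_sqrt g rho Hr) as [h [Hh [H1 Eh]]]; [|exact G0|].
    + intros z Hz. split; [auto|]. intros E. apply (proj2 (H z Hz)).
      rewrite <- (Eg z Hz), E. rewrite <- (Nat.succ_pred (2 ^ m)) by (apply Nat.pow_nonzero; lia).
      simpl. ring.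
    + exists h. split; [exact Hh|]. split; [exact H1|]. intros z Hz.
      rewrite <- (Eg z Hz), <- (Eh z Hz). rewrite Nat.pow_succ_r', Cpow_mult_exp.
      f_equal. simpl. ring.
Qed.

Lemma pow_le_reg a b n : (0 <= a)%R -> (0 <= b)%R -> (0 < n)%nat -> (a ^ n <= b ^ n)%R -> (a <= b)%R.
Proof.
  intros Ha Hb Hn H. destruct (Rle_dec a b) as [|N]; [assumption|exfalso].
  assert (L : (b < a)%R) by lra. clear N.
  assert (b ^ n < a ^ n)%R; [|lra].
  destruct n as [|n]; [lia|]. clear H Hn. induction n as [|n IH]; [simpl; lra|].
  change (b * b ^ S n < a * a ^ S n)%R.
  assert (0 <= b ^ S n)%R by now apply pow_le. nra.
Qed.

Lemma zero_free_lower f rho m : (0 < rho)%R ->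
  (forall z, (Cmod z <= rho)%R -> holo f z /\ f z <> 0) -> f 0 = 1 ->
  (forall z, (Cmod z <= rho)%R -> (Cmod (f z) <= 2 ^ (2 ^ m))%R) ->
  forall z, (Cmod z <= rho / 4)%R -> ((/ 4) ^ (2 ^ m) <= Cmod (f z))%R.
Proof.
  intros Hr H H0 HM z Hz.
  destruct (zero_free_root f rho m Hr H H0) as [g [Hg [G0 Eg]]].
  assert (N2 : (0 < 2 ^ m)%nat) by (apply Nat.neq_0_lt_0, Nat.pow_nonzero; lia).
  assert (B : forall w, (Cmod w <= rho)%R -> (Cmod (g w) <= 2)%R).
  { intros w Hw. apply pow_le_reg with (2 ^ m)%nat; [apply Cmod_ge_0|lra|exact N2|].
    rewrite <- Cmod_pow, (Eg w Hw). auto. }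
  assert (Z0 : (Cmod 0 <= rho)%R) by (rewrite Cmod_0; lra).
  destruct (holo_quotient g 0 (Hg 0 Z0)) as [h [Hh Eh]].
  assert (Bh : forall w, (Cmod w <= rho)%R -> (Cmod (h w) <= 3 / rho)%R).
  { intros w Hw. apply (max_principle_disc h 0 rho).
    - intros v Hv. apply Hh, Hg. now replace (v - 0) with v in Hv by ring.
    - intros v Hv. replace (v - 0) with v in Hv by ring.
      assert (Nv : v <> 0) by (apply Cmod_pos_neq; lra).
      replace (h v) with ((g v - g 0) / v) by (rewrite (Eh v); field; exact Nv).
      rewrite Cmod_div, Hv by exact Nv. apply Rmult_le_compat_r; [left; now apply Rinv_0_lt_compat|].
      assert (T := Cmod_triangle (g v) (- g 0)). rewrite Cmod_opp, G0, Cmod_1 in T.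
      assert (Q := B v ltac:(lra)). rewrite G0. unfold Cminus. lra.
    - now replace (w - 0) with w by ring. }
  assert (Q : (Cmod (g z - 1) <= 3 / 4)%R).
  { rewrite (Eh z), G0. replace (1 + (z - 0) * h z - 1) with (z * h z) by ring.
    rewrite Cmod_mult. replace (3 / 4)%R with (rho / 4 * (3 / rho))%R by (field; lra).
    apply Rmult_le_compat; try apply Cmod_ge_0; [exact Hz|]. apply Bh. lra. }
  assert (T := Cmod_triangle_minus 1 (g z)). rewrite Cmod_1, Cmod_minus_sym in T.
  rewrite <- (Eg z), Cmod_pow by lra. apply pow_incr. lra.
Qed.

(* Each zero in the half disc is divided out by a Blaschke factor, which keeps the
   moduli on the circle and at least doubles [|f 0|]. *)
Lemma strip_zeros n : forall (f G : C -> C) R M, (0 < R)%R -> entire f -> entire G -> f 0 <> 0 ->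
  (forall z, (Cmod z <= R)%R -> (Cmod (f z) <= M)%R /\ (Cmod (f z * G z) <= M)%R) ->
  (M < 2 ^ n * Cmod (f 0))%R ->
  exists f', entire f' /\ (Cmod (f 0) <= Cmod (f' 0))%R /\
    (forall z, (Cmod z <= R / 2)%R -> f' z <> 0) /\
    forall z, (Cmod z <= R)%R -> (Cmod (f' z) <= M)%R /\ (Cmod (f' z * G z) <= M)%R.
Proof.
  induction n as [|n IH]; intros f G R M HR Hf HG N0 HM Hn.
  { exfalso. destruct (HM 0) as [Q _]; [rewrite Cmod_0; lra|]. simpl in Hn. lra. }
  destruct (classic (exists a : C, (Cmod a <= R / 2)%R /\ f a = 0)) as [[a [Ha Za]]|N].
  2: { exists f. split; [exact Hf|]. split; [lra|]. split; [|exact HM].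
       intros z Hz E. apply N. now exists z. }
  destruct (holo_quotient f a (Hf a)) as [k [Hk Ek]]. rewrite Za in Ek.
  assert (Na : a <> 0) by (intros E; apply N0; rewrite E in Za; exact Za).
  assert (Pa : (0 < Cmod a)%R) by now apply Cmod_pos.
  set (B := fun z => / RtoC R * (RtoC (R * R) - Cconj a * z)).
  assert (HB : entire B).
  { intros z. apply holo_mult; [apply holo_const|]. apply holo_minus; [apply holo_const|].
    apply holo_mult; auto using holo_const, holo_id. }
  assert (Hk' : entire (fun z => k z * B z)).
  { intros z. apply holo_mult; [|apply HB]. apply Hk, Hf. }
  assert (NR : RtoC R <> 0) by (intros E; injection E; lra).
  assert (EB : forall z, Cmod z = R -> Cmod (B z) = Cmod (z - a)).
  { intros z Hz. unfold B. rewrite Cmod_mult, Cmod_inv, Cmod_R, Rabs_pos_eq by (auto; lra).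
    apply Rmult_eq_reg_l with R; [|lra]. rewrite <- Rmult_assoc, Rinv_r, Rmult_1_l by lra.
    apply Rsqr_inj; [apply Cmod_ge_0|apply Rmult_le_pos; [lra|apply Cmod_ge_0]|].
    unfold Rsqr. replace (R * Cmod (z - a) * (R * Cmod (z - a)))%R
      with (R * R * (Cmod (z - a) * Cmod (z - a)))%R by ring.
    assert (Sz := Cmod_sq z). rewrite Hz in Sz.
    rewrite !Cmod_sq. destruct z as [x y], a as [p q]. simpl in *.
    replace (R * R)%R with (x * x + y * y)%R by lra. ring. }
  assert (Eb : forall z, Cmod z = R -> Cmod (k z * B z) = Cmod (f z)).
  { intros z Hz. rewrite (Ek z), Cmod_mult, EB by exact Hz.
    replace (0 + (z - a) * k z) with ((z - a) * k z) by ring. rewrite Cmod_mult. ring. }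
  assert (E0 : (2 * Cmod (f 0) <= Cmod (k 0%C * B 0%C))%R).
  { rewrite (Ek 0). unfold B. rewrite !Cmod_mult.
    replace (0 + (0 - a) * k 0) with (- (a * k 0)) by ring.
    rewrite Cmod_opp, Cmod_mult, Cmod_inv, Cmod_R, Rabs_pos_eq by (auto; lra).
    replace (RtoC (R * R) - Cconj a * 0) with (RtoC (R * R)) by ring.
    rewrite Cmod_R, Rabs_pos_eq by nra.
    replace (/ R * (R * R))%R with R by (field; lra). assert (G0 := Cmod_ge_0 (k 0)). nra. }
  assert (P0 := Cmod_pos _ N0).
  destruct (IH (fun z => k z * B z) G R M HR Hk' HG) as [f' [H1 [H2 [H3 H4]]]].
  - apply Cmod_pos_neq. lra.
  - intros z Hz. replace z with (z - 0) in Hz by ring.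
    assert (D : forall F, entire F -> (forall z, Cmod z = R -> (Cmod (F z) <= M)%R) ->
                 (Cmod (F z) <= M)%R).
    { intros F HF HFb. apply (max_principle_disc F 0 R); auto. intros w Hw. apply HFb.
      now replace (w - 0) with w in Hw by ring. }
    split.
    + apply (D (fun z => k z * B z)); [exact Hk'|]. intros w Hw. rewrite (Eb w Hw). apply HM. lra.
    + apply (D (fun z => k z * B z * G z)).
      * intros w. apply (holo_mult (fun z => k z * B z) G); auto.
      * intros w Hw. rewrite Cmod_mult, (Eb w Hw), <- Cmod_mult. apply HM. lra.
  - simpl in Hn. assert (P2 : (0 < 2 ^ n)%R) by (apply pow_lt; lra). nra.
  - exists f'. split; [exact H1|]. split; [lra|]. auto.
Qed.

Lemma Cinv_neq_0 (z : C) : z <> 0 -> / z <> 0.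
Proof.
  intros H. apply Cmod_pos_neq. rewrite Cmod_inv by exact H.
  now apply Rinv_0_lt_compat, Cmod_pos.
Qed.

Lemma quotient_bound f G R m : (0 < R)%R -> entire f -> entire G -> (1 <= Cmod (f 0))%R ->
  (forall z, (Cmod z <= R)%R ->
     (Cmod (f z) <= 2 ^ (2 ^ m))%R /\ (Cmod (f z * G z) <= 2 ^ (2 ^ m))%R) ->
  forall z, (Cmod z <= R / 8)%R -> (Cmod (G z) <= 8 ^ (2 ^ m))%R.
Proof.
  intros HR Hf HG H1 HM z Hz. set (N := (2 ^ m)%nat) in *.
  destruct (strip_zeros (S N) f G R (2 ^ N) HR Hf HG) as [f' [Hf' [Q0 [Nf HM']]]]; auto.
  { apply Cmod_pos_neq. lra. }
  { simpl. assert (0 < 2 ^ N)%R by (apply pow_lt; lra). nra. }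
  assert (P0 : (0 < Cmod (f' 0%C))%R) by lra. assert (N0 := Cmod_pos_neq _ P0).
  assert (I0 : (/ Cmod (f' 0%C) <= 1)%R).
  { rewrite <- Rinv_1. apply Rinv_le_contravar; lra. }
  assert (PN : (0 < 2 ^ N)%R) by (apply pow_lt; lra).
  assert (L := zero_free_lower (fun z => / f' 0 * f' z) (R / 2) m ltac:(lra)).
  assert (NI : / f' 0 <> 0) by now apply Cinv_neq_0.
  assert (L' : ((/ 4) ^ N <= Cmod (/ f' 0 * f' z))%R).
  { apply L.
    - intros w Hw. split; [|apply Cmult_neq_0; auto].
      apply holo_mult; auto using holo_const.
    - field. exact N0.
    - intros w Hw. rewrite Cmod_mult, Cmod_inv by exact N0.
      destruct (HM' w ltac:(lra)) as [Q _]. fold N.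
      assert (G0 := Cmod_ge_0 (f' w)). nra.
    - lra. }
  clear L. rewrite Cmod_mult, Cmod_inv in L' by exact N0.
  assert (G0 := Cmod_ge_0 (f' z)). assert (GG := Cmod_ge_0 (G z)).
  assert (L : ((/ 4) ^ N <= Cmod (f' z))%R) by nra.
  destruct (HM' z ltac:(lra)) as [_ Q]. rewrite Cmod_mult in Q.
  assert (P4 : (0 < (/ 4) ^ N)%R) by (apply pow_lt; lra).
  assert (E : (2 ^ N = 8 ^ N * (/ 4) ^ N)%R) by (rewrite <- Rpow_mult_distr; f_equal; field).
  rewrite E in Q.
  apply Rmult_le_reg_r with ((/ 4) ^ N)%R; [exact P4|].
  eapply Rle_trans; [|exact Q]. rewrite Rmult_comm. now apply Rmult_le_compat_r.
Qed.

Lemma pow2_between X : (1 <= X)%R -> exists m, (X <= INR (2 ^ m) <= 2 * X)%R.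
Proof.
  intros HX. destruct (Pow_x_infinity 2 ltac:(rewrite Rabs_pos_eq; lra) X) as [n Hn].
  specialize (Hn n (le_n n)). rewrite Rabs_pos_eq in Hn by (apply pow_le; lra).
  apply Rge_le in Hn. 
  assert (E : forall k, INR (2 ^ k) = (2 ^ k)%R) by (intros k; rewrite pow_INR; reflexivity).
  induction n as [|n IH].
  - exists 0%nat. simpl in *. lra.
  - destruct (Rle_dec X (2 ^ n)) as [L|L]; [auto|].
    exists (S n). rewrite E. simpl in *. lra.
Qed.

Lemma exp_INR_mult n x : exp (INR n * x) = (exp x ^ n)%R.
Proof.
  induction n as [|n IH]; [simpl; rewrite Rmult_0_l; apply exp_0|].
  rewrite S_INR, Rmult_plus_distr_r, exp_plus, IH, Rmult_1_l. simpl. ring.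
Qed.

Theorem quotient_exp_type f G A B : entire f -> entire G -> (1 <= Cmod (f 0))%R ->
  (1 <= A)%R -> (0 <= B)%R ->
  (forall z, (Cmod (f z) <= exp (A + B * Cmod z))%R /\ (Cmod (f z * G z) <= exp (A + B * Cmod z))%R) ->
  forall z, (Cmod (G z) <= exp (12 * (A + B) + 96 * B * Cmod z))%R.
Proof.
  intros Hf HG H1 HA HB HM z. set (R := (8 * Cmod z + 1)%R).
  assert (Z0 := Cmod_ge_0 z).
  destruct (pow2_between (2 * (A + B * R))) as [m Hm]; [unfold R; nra|].
  assert (E2 : (exp (1 / 2) <= 2)%R).
  { assert (Q : (exp (1 / 2) * exp (1 / 2) <= 3)%R).
    { rewrite <- exp_plus. replace (1 / 2 + 1 / 2)%R with 1%R by field. apply exp_le_3. }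
    assert (P := exp_pos (1 / 2)). nra. }
  assert (E1 : (2 <= exp 1)%R).
  { assert (Q := exp_ineq1 1 ltac:(lra)). lra. }
  assert (Q : (Cmod (G z) <= 8 ^ (2 ^ m))%R).
  { apply (quotient_bound f G R m); auto; [unfold R; lra| |unfold R; lra].
    intros w Hw. 
    assert (L : (exp (A + B * Cmod w) <= 2 ^ (2 ^ m))%R).
    { apply Rle_trans with (exp (INR (2 ^ m) * (1 / 2))).
      - assert (A + B * Cmod w <= INR (2 ^ m) * (1 / 2))%R by nra.
        destruct (Req_dec (A + B * Cmod w) (INR (2 ^ m) * (1 / 2))) as [->|]; [lra|].
        left. apply exp_increasing. lra.
      - rewrite exp_INR_mult. apply pow_incr. split; [left; apply exp_pos|exact E2]. }
    destruct (HM w) as [Q1 Q2]. split; lra. }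
  eapply Rle_trans; [exact Q|].
  apply Rle_trans with (exp (INR (2 ^ m) * 3)).
  - rewrite exp_INR_mult. apply pow_incr. split; [lra|].
    replace 3%R with (1 + 1 + 1)%R by ring. rewrite !exp_plus. nra.
  - destruct (Req_dec (INR (2 ^ m) * 3) (12 * (A + B) + 96 * B * Cmod z)) as [->|]; [lra|].
    left. apply exp_increasing. unfold R in *. nra.
Qed.

(** * Calculus of complex functions of a real variable *)

Definition cderiv (f : R -> C) (x : R) (l : C) : Prop :=
  is_derive (fun t => fst (f t)) x (fst l) /\ is_derive (fun t => snd (f t)) x (snd l).

Definition ccont (f : R -> C) (x : R) : Prop :=
  continuous (fun t => fst (f t)) x /\ continuous (fun t => snd (f t)) x.

Lemma cderiv_ccont f x l : cderiv f x l -> ccont f x.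
Proof.
  intros [H1 H2]. split;
  apply (ex_derive_continuous (K := R_AbsRing) (V := R_NormedModule)); eexists; eassumption.
Qed.

Lemma cderiv_eq f x l l' : cderiv f x l -> l = l' -> cderiv f x l'.
Proof. intros H <-. exact H. Qed.

Lemma cderiv_const c x : cderiv (fun _ => c) x 0.
Proof. split; apply (is_derive_const (K := R_AbsRing) (V := R_NormedModule)). Qed.

Lemma cderiv_plus f g x l l' : cderiv f x l -> cderiv g x l' ->
  cderiv (fun t => f t + g t) x (l + l').
Proof.
  intros [H1 H2] [H3 H4].
  split; [exact (is_derive_plus _ _ _ _ _ H1 H3) | exact (is_derive_plus _ _ _ _ _ H2 H4)].
Qed.

Lemma cderiv_mult f g x l l' : cderiv f x l -> cderiv g x l' ->
  cderiv (fun t => f t * g t) x (l * g x + f x * l').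
Proof.
  intros [H1 H2] [H3 H4].
  assert (M : forall u v x l l', is_derive u x l -> is_derive v x l' ->
    is_derive (fun t : R => u t * v t)%R x (l * v x + u x * l')%R).
  { intros u v x0 k k' Hu Hv. apply (is_derive_mult u v x0 k k' Hu Hv). exact Rmult_comm. }
  split.
  - evar_last; [exact (is_derive_minus _ _ _ _ _ (M _ _ _ _ _ H1 H3) (M _ _ _ _ _ H2 H4))|].
    unfold minus, plus, opp; simpl. ring.
  - evar_last; [exact (is_derive_plus _ _ _ _ _ (M _ _ _ _ _ H1 H4) (M _ _ _ _ _ H2 H3))|].
    unfold plus; simpl. ring.
Qed.

Lemma cderiv_opp f x l : cderiv f x l -> cderiv (fun t => - f t) x (- l).
Proof.
  intros [H1 H2].
  split; [exact (is_derive_opp _ _ _ H1) | exact (is_derive_opp _ _ _ H2)].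
Qed.

Lemma cderiv_minus f g x l l' : cderiv f x l -> cderiv g x l' ->
  cderiv (fun t => f t - g t) x (l - l').
Proof. intros H1 H2. apply cderiv_plus; [exact H1|]. now apply cderiv_opp. Qed.

Lemma cderiv_scal c f x l : cderiv f x l -> cderiv (fun t => c * f t) x (c * l).
Proof.
  intros H. eapply cderiv_eq; [apply (cderiv_mult _ _ _ _ _ (cderiv_const c x) H)|]. ring.
Qed.

Lemma cderiv_loc f g x l (d : R) : (0 < d)%R -> (forall t, (Rabs (t - x) < d)%R -> f t = g t) ->
  cderiv f x l -> cderiv g x l.
Proof.
  intros Hd E [H1 H2].
  assert (L : locally x (fun t => f t = g t)).
  { exists (mkposreal d Hd). intros t Ht. apply E, Ht. }
  split; (eapply is_derive_ext_loc; [|eassumption]);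
  apply filter_imp with (2 := L); intros t Et; now rewrite Et.
Qed.

Lemma ccont_const c x : ccont (fun _ => c) x.
Proof. split; apply continuous_const. Qed.

Lemma ccont_plus f g x : ccont f x -> ccont g x -> ccont (fun t => f t + g t) x.
Proof.
  intros [H1 H2] [H3 H4]. split; simpl.
  - now apply (continuous_plus (V := R_NormedModule) (fun t => fst (f t)) (fun t => fst (g t))).
  - now apply (continuous_plus (V := R_NormedModule) (fun t => snd (f t)) (fun t => snd (g t))).
Qed.

Lemma ccont_opp f x : ccont f x -> ccont (fun t => - f t) x.
Proof.
  intros [H1 H2]. split; simpl.
  - now apply (continuous_opp (V := R_NormedModule) (fun t => fst (f t))).
  - now apply (continuous_opp (V := R_NormedModule) (fun t => snd (f t))).
Qed.

Lemma ccont_minus f g x : ccont f x -> ccont g x -> ccont (fun t => f t - g t) x.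
Proof. intros H1 H2. apply ccont_plus; [exact H1|]. now apply ccont_opp. Qed.

Lemma ccont_mult f g x : ccont f x -> ccont g x -> ccont (fun t => f t * g t) x.
Proof.
  intros [H1 H2] [H3 H4].
  assert (M : forall u v : R -> R, continuous u x -> continuous v x ->
                continuous (fun t => u t * v t)%R x).
  { intros u v Hu Hv. now apply (continuous_mult (K := R_AbsRing) u v). }
  split; simpl.
  - apply (continuous_minus (V := R_NormedModule) (fun t => fst (f t) * fst (g t))%R
      (fun t => snd (f t) * snd (g t))%R); now apply M.
  - apply (continuous_plus (V := R_NormedModule) (fun t => fst (f t) * snd (g t))%R
      (fun t => snd (f t) * fst (g t))%R); now apply M.
Qed.

Lemma ccont_comp f (g : R -> R) x : ccont f (g x) -> continuous g x -> ccont (fun t => f (g t)) x.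
Proof.
  intros [H1 H2] Hg. split.
  - now apply (continuous_comp g (fun t => fst (f t))).
  - now apply (continuous_comp g (fun t => snd (f t))).
Qed.

Lemma continuous_continuity_pt (f : R -> R) x : continuous f x -> continuity_pt f x.
Proof. intros H. apply continuity_pt_filterlim. exact H. Qed.

Lemma mean_value_le (g : R -> R) (B u x : R) :
  (forall t, continuous g t) -> (u <= x)%R ->
  (forall t, (u < t < x)%R -> exists l, is_derive g t l /\ (l <= B)%R) ->
  (g x - g u <= B * (x - u))%R.
Proof.
  intros Hc Hx Hd.
  (* [Rmin] keeps the derivative bounded by [B] even if the mean value is taken at an endpoint. *)
  destruct (MVT_gen g u x (fun t => Rmin (Derive g t) B)) as [c [_ Hc2]].
  - rewrite Rmin_left, Rmax_right by lra. intros t Ht.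
    destruct (Hd t Ht) as [l [Hl Bl]]. rewrite (is_derive_unique _ _ _ Hl).
    now rewrite Rmin_left.
  - intros t _. now apply continuous_continuity_pt.
  - rewrite Hc2. assert (Q := Rmin_r (Derive g c) B). nra.
Qed.

Lemma is_derive_Rmult (u v : R -> R) x l l' : is_derive u x l -> is_derive v x l' ->
  is_derive (fun t => u t * v t)%R x (l * v x + u x * l')%R.
Proof. intros Hu Hv. apply (is_derive_mult u v x l l' Hu Hv). exact Rmult_comm. Qed.

Lemma is_derive_exp_scal (k x : R) : is_derive (fun t => exp (k * t)) x (k * exp (k * x))%R.
Proof. auto_derive; [exact I|ring]. Qed.

Lemma continuous_exp_scal (k x : R) : continuous (fun t => exp (k * t)) x.
Proof.
  apply (ex_derive_continuous (K := R_AbsRing) (V := R_NormedModule)).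
  eexists. apply is_derive_exp_scal.
Qed.

Lemma gronwall (N : R -> R) (k c L x : R) : k <> 0%R ->
  (forall t, continuous N t) -> (0 <= x <= L)%R ->
  (forall t, (0 < t < L)%R -> exists l, is_derive N t l /\ (l <= k * N t + c)%R) ->
  (N x + c / k <= (N 0 + c / k) * exp (k * x))%R.
Proof.
  intros Hk Hc Hx Hd.
  assert (Q : ((N x + c / k) * exp (- k * x) - (N 0 + c / k) * exp (- k * 0) <= 0 * (x - 0))%R).
  { apply (mean_value_le (fun t => (N t + c / k) * exp (- k * t))%R); [|lra|].
    - intros t. apply (continuous_mult (K := R_AbsRing) (fun t => (N t + c / k)%R));
        [|apply continuous_exp_scal].
      apply (continuous_plus (V := R_NormedModule) N (fun _ => (c / k)%R)); [auto|].
      apply continuous_const.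
    - intros t Ht. destruct (Hd t ltac:(lra)) as [l [Hl Bl]].
      exists (l * exp (- k * t) + (N t + c / k) * (- k * exp (- k * t)))%R. split.
      + apply (is_derive_Rmult (fun t => (N t + c / k)%R) (fun t => exp (- k * t)));
          [|apply (is_derive_exp_scal (- k) t)].
        evar_last; [apply (is_derive_plus N (fun _ => (c / k)%R)); [exact Hl|apply is_derive_const]|].
        unfold plus, zero; simpl. ring.
      + assert (P := exp_pos (- k * t)).
        replace (l * exp (- k * t) + (N t + c / k) * (- k * exp (- k * t)))%R
          with ((l - (k * N t + c)) * exp (- k * t))%R by (field; exact Hk). nra. }
  rewrite Rmult_0_r, exp_0, Rmult_0_l in Q.
  assert (E : (exp (- k * x) * exp (k * x) = 1)%R).
  { rewrite <- exp_plus. replace (- k * x + k * x)%R with 0%R by ring. apply exp_0. }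
  assert (P := exp_pos (k * x)). 
  replace (N x + c / k)%R with ((N x + c / k) * exp (- k * x) * exp (k * x))%R
    by (rewrite Rmult_assoc, E; ring).
  apply Rmult_le_compat_r; lra.
Qed.

Lemma Cmod_le_abs (z : C) : (Cmod z <= Rabs (fst z) + Rabs (snd z))%R.
Proof.
  assert (S := Cmod_sq z). assert (P := Cmod_ge_0 z).
  assert (P1 := Rabs_pos (fst z)). assert (P2 := Rabs_pos (snd z)).
  assert (E1 : (Rabs (fst z) * Rabs (fst z) = fst z * fst z)%R) by (symmetry; apply Rsqr_abs).
  assert (E2 : (Rabs (snd z) * Rabs (snd z) = snd z * snd z)%R) by (symmetry; apply Rsqr_abs).
  nra.
Qed.

Lemma fst_le_Cmod (z : C) : (Rabs (fst z) <= Cmod z)%R.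
Proof. apply (re_le_Cmod z). Qed.

Lemma snd_le_Cmod (z : C) : (Rabs (snd z) <= Cmod z)%R.
Proof. eapply Rle_trans; [|apply Rmax_Cmod]. apply Rmax_r. Qed.

Lemma is_derive_continuous_R (f : R -> R) x l : is_derive f x l -> continuous f x.
Proof.
  intros H. apply (ex_derive_continuous (K := R_AbsRing) (V := R_NormedModule)). now exists l.
Qed.

Lemma mean_value_abs (g h : R -> R) (h' : R -> R) (u x : R) :
  (forall t, continuous g t) -> (u <= x)%R -> (forall t, is_derive h t (h' t)) ->
  (forall t, (u < t < x)%R -> exists l, is_derive g t l /\ (Rabs l <= h' t)%R) ->
  (Rabs (g x - g u) <= h x - h u)%R.
Proof.
  intros Hc Hx Hh Hd. apply Rabs_le. split.
  - assert (Q : (- g x - h x - (- g u - h u) <= 0 * (x - u))%R); [|lra].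
    apply (mean_value_le (fun t => (- g t - h t)%R)); [|exact Hx|].
    + intros t. apply (continuous_minus (V := R_NormedModule) (fun t => (- g t)%R) h).
      * apply (continuous_opp (V := R_NormedModule) g). apply Hc.
      * eapply is_derive_continuous_R, Hh.
    + intros t Ht. destruct (Hd t Ht) as [l [Hl Bl]]. exists (- l - h' t)%R. split.
      * apply (is_derive_minus (fun t => (- g t)%R) h); [|apply Hh]. now apply (is_derive_opp g).
      * assert (Q := Rabs_maj2 l). lra.
  - assert (Q : (g x - h x - (g u - h u) <= 0 * (x - u))%R); [|lra].
    apply (mean_value_le (fun t => (g t - h t)%R)); [|exact Hx|].
    + intros t. apply (continuous_minus (V := R_NormedModule) g h); [apply Hc|].
      eapply is_derive_continuous_R, Hh.
    + intros t Ht. destruct (Hd t Ht) as [l [Hl Bl]]. exists (l - h' t)%R. split.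
      * now apply (is_derive_minus g h).
      * assert (Q := Rle_abs l). lra.
Qed.

(* The majorant [h] bounds each component separately, hence the factor [2]. *)
Lemma cderiv_majorant (F f : R -> C) (h h' : R -> R) (u x : R) :
  (forall t, ccont F t) -> (u <= x)%R -> (forall t, is_derive h t (h' t)) ->
  (forall t, (u < t < x)%R -> cderiv F t (f t) /\ (Cmod (f t) <= h' t)%R) ->
  (Cmod (F x - F u) <= 2 * (h x - h u))%R.
Proof.
  intros Hc Hx Hh Hd. eapply Rle_trans; [apply Cmod_le_abs|].
  assert (Q1 : (Rabs (fst (F x) - fst (F u)) <= h x - h u)%R).
  { apply (mean_value_abs (fun t => fst (F t)) h h' u x); auto; [intros t; exact (proj1 (Hc t))|].
    intros t Ht. destruct (Hd t Ht) as [[H1 _] H2]. exists (fst (f t)). split; [exact H1|].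
    eapply Rle_trans; [apply fst_le_Cmod|exact H2]. }
  assert (Q2 : (Rabs (snd (F x) - snd (F u)) <= h x - h u)%R).
  { apply (mean_value_abs (fun t => snd (F t)) h h' u x); auto; [intros t; exact (proj2 (Hc t))|].
    intros t Ht. destruct (Hd t Ht) as [[_ H1] H2]. exists (snd (f t)). split; [exact H1|].
    eapply Rle_trans; [apply snd_le_Cmod|exact H2]. }
  simpl. unfold Rminus in *. lra.
Qed.

Lemma cderiv_bounded (F f : R -> C) (B x : R) :
  (forall t, ccont F t) -> (0 <= x)%R ->
  (forall t, (0 < t < x)%R -> cderiv F t (f t) /\ (Cmod (f t) <= B)%R) ->
  (Cmod (F x - F 0%R) <= 2 * (B * x))%R.
Proof.
  intros Hc Hx Hd.
  replace (B * x)%R with (B * x - B * 0)%R by ring.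
  apply (cderiv_majorant F f (fun t => B * t)%R (fun _ => B) 0 x); auto.
  intros t. auto_derive; [exact I|ring].
Qed.

Lemma cderiv_0_const (F : R -> C) (x : R) : (forall t, ccont F t) -> (0 <= x)%R ->
  (forall t, (0 < t < x)%R -> cderiv F t 0) -> F x = F 0%R.
Proof.
  intros Hc Hx Hd.
  assert (Q := cderiv_bounded F (fun _ => 0) 0 x Hc Hx).
  rewrite Rmult_0_l, Rmult_0_r in Q.
  apply Ceq_minus, Cmod_eq_0. apply Rle_antisym; [|apply Cmod_ge_0]. apply Q.
  intros t Ht. split; [auto|rewrite Cmod_0; lra].
Qed.

Definition clamp (x : R) : R := Rmax 0 (Rmin PI x).

Lemma clamp_id x : (0 <= x <= PI)%R -> clamp x = x.
Proof. intros H. unfold clamp. rewrite Rmin_right, Rmax_right; lra. Qed.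

Lemma clamp_seg x : (0 <= clamp x <= PI)%R.
Proof.
  assert (P := PI_RGT_0). unfold clamp. split; [apply Rmax_l|].
  apply Rmax_lub; [lra|apply Rmin_l].
Qed.

Lemma clamp_lipschitz x y : (Rabs (clamp x - clamp y) <= Rabs (x - y))%R.
Proof.
  assert (P := PI_RGT_0). unfold clamp, Rmax, Rmin.
  repeat destruct Rle_dec; unfold Rabs; repeat destruct Rcase_abs; lra.
Qed.

Lemma clamp_continuous x : continuous clamp x.
Proof.
  intros P [e He]. exists e. intros y Hy. apply He.
  apply (Rle_lt_trans _ (Rabs (y - x))); [apply (clamp_lipschitz y x)|apply Hy].
Qed.

Definition CI (f : R -> C) (x : R) : C :=
  (RInt (fun t => fst (f t)) 0 x, RInt (fun t => snd (f t)) 0 x).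

Lemma cderiv_CI f x : (forall t, ccont f t) -> cderiv (CI f) x (f x).
Proof.
  intros H. assert (D : forall g : R -> R, (forall t, continuous g t) ->
    is_derive (fun x => RInt g 0 x) x (g x)).
  { intros g Hg. apply (is_derive_RInt g (fun x => RInt g 0 x) 0 x); [|apply Hg].
    apply filter_forall. intros y. apply (RInt_correct (V := R_CompleteNormedModule)).
    apply (ex_RInt_continuous (V := R_CompleteNormedModule)). auto. }
  split; [apply (D (fun t => fst (f t)) (fun t => proj1 (H t)))
    | apply (D (fun t => snd (f t)) (fun t => proj2 (H t)))].
Qed.

Lemma CI_0 f : CI f 0%R = 0.
Proof. unfold CI. rewrite !RInt_point. reflexivity. Qed.

Lemma cderiv_FTC F f x : (forall t, ccont F t) -> (forall t, ccont f t) -> (0 <= x)%R ->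
  (forall t, (0 < t < x)%R -> cderiv F t (f t)) -> F x = F 0%R + CI f x.
Proof.
  intros HF Hf Hx Hd.
  assert (Q := cderiv_0_const (fun t => F t - CI f t) x).
  simpl in Q. rewrite CI_0 in Q.
  replace (F 0%R) with (F 0%R - 0) by ring. rewrite <- Q; auto; [ring| |].
  - intros t. apply ccont_minus; [apply HF|]. eapply cderiv_ccont, cderiv_CI, Hf.
  - intros t Ht. eapply cderiv_eq; [apply cderiv_minus; [now apply Hd|now apply cderiv_CI]|]. ring.
Qed.

Lemma INR_le_pow2 n : (INR n <= 2 ^ n)%R.
Proof.
  induction n as [|n IH]; [simpl; lra|]. rewrite S_INR. simpl.
  assert (1 <= 2 ^ n)%R by (apply pow_R1_Rle; lra). lra.
Qed.

Lemma unif_lim_R (u : nat -> R -> R) (K : R) :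
  (forall n x, continuous (u n) x) ->
  (forall n x, (Rabs (u (S n) x - u n x) <= K / 2 ^ n)%R) ->
  exists v, (forall x, continuous v x) /\ forall n x, (Rabs (v x - u n x) <= 2 * K / 2 ^ n)%R.
Proof.
  intros Hc H.
  assert (P2 : forall n, (0 < 2 ^ n)%R) by (intros n; apply pow_lt; lra).
  assert (HK : (0 <= K)%R).
  { eapply Rle_trans; [apply (Rabs_pos (u 1%nat 0%R - u 0%nat 0%R))|].
    specialize (H 0%nat 0%R). simpl in H. lra. }
  assert (D : forall x n k, (Rabs (u (n + k)%nat x - u n x) <= 2 * K / 2 ^ n - 2 * K / 2 ^ (n + k))%R).
  { intros x n k. induction k as [|k IH].
    - rewrite Nat.add_0_r. rewrite Rminus_diag, Rabs_R0. lra.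
    - rewrite Nat.add_succ_r.
      replace (u (S (n + k)) x - u n x)%R
        with ((u (S (n + k)) x - u (n + k)%nat x) + (u (n + k)%nat x - u n x))%R by ring.
      eapply Rle_trans; [apply Rabs_triang|]. specialize (H (n + k)%nat x).
      assert (E : (2 * K / 2 ^ S (n + k) = K / 2 ^ (n + k))%R).
      { simpl. field. apply Rgt_not_eq, P2. }
      rewrite E. replace (2 * K / 2 ^ (n + k))%R with (K / 2 ^ (n + k) + K / 2 ^ (n + k))%R in IH.
      + lra.
      + field. apply Rgt_not_eq, P2. }
  assert (D' : forall x n k, (Rabs (u (n + k)%nat x - u n x) <= 2 * K / 2 ^ n)%R).
  { intros x n k. specialize (D x n k). assert (0 <= 2 * K / 2 ^ (n + k))%R; [|lra].
    apply Rdiv_le_0_compat; [lra|auto]. }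
  assert (T : forall eps : R, (0 < eps)%R -> exists n, (2 * K / 2 ^ n < eps)%R).
  { intros eps He. destruct (INR_unbounded (2 * K / eps)) as [n Hn]. exists n.
    assert (G := INR_le_pow2 n).
    apply Rmult_lt_reg_r with (2 ^ n)%R; [auto|].
    replace (2 * K / 2 ^ n * 2 ^ n)%R with (2 * K)%R by (field; apply Rgt_not_eq, P2).
    apply Rlt_le_trans with (eps * INR n)%R.
    - apply Rmult_lt_reg_l with (/ eps)%R; [now apply Rinv_0_lt_compat|].
      replace (/ eps * (eps * INR n))%R with (INR n) by (field; lra).
      replace (/ eps * (2 * K))%R with (2 * K / eps)%R by (field; lra). exact Hn.
    - apply Rmult_le_compat_l; lra. }
  set (v := fun x => real (Lim_seq (fun n => u n x))).
  assert (L : forall x, is_lim_seq (fun n => u n x) (v x)).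
  { intros x. apply Lim_seq_correct'. apply ex_lim_seq_cauchy_corr.
    intros eps. destruct (T (pos_div_2 eps) (cond_pos _)) as [n Hn]. exists n.
    intros p q Hp Hq. replace p with (n + (p - n))%nat by lia. replace q with (n + (q - n))%nat by lia.
    assert (Q1 := D' x n (p - n)%nat). assert (Q2 := D' x n (q - n)%nat).
    replace (u (n + (p - n))%nat x - u (n + (q - n))%nat x)%R with
      ((u (n + (p - n))%nat x - u n x) - (u (n + (q - n))%nat x - u n x))%R by ring.
    eapply Rle_lt_trans; [apply Rabs_triang|]. rewrite Rabs_Ropp. simpl in Hn. lra. }
  assert (V : forall n x, (Rabs (v x - u n x) <= 2 * K / 2 ^ n)%R).
  { intros n x.
    assert (L1 : is_lim_seq (fun k => Rabs (u (n + k)%nat x - u n x)) (Rabs (v x - u n x))).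
    { apply (is_lim_seq_abs _ (Finite (v x - u n x))).
      apply (is_lim_seq_minus' (fun k => u (n + k)%nat x) (fun _ => u n x)); [|apply is_lim_seq_const].
      apply is_lim_seq_ext with (fun k => u (k + n)%nat x); [intros k; now rewrite Nat.add_comm|].
      now apply (is_lim_seq_incr_n (fun k => u k x) n). }
    apply (is_lim_seq_le _ _ (Finite (Rabs (v x - u n x))) (Finite (2 * K / 2 ^ n)) (D' x n) L1).
    apply is_lim_seq_const. }
  exists v. split; [|exact V].
  intros x P [e He]. destruct (T (e / 3)%R) as [n Hn]; [assert (Q := cond_pos e); lra|].
  assert (Pe : (0 < e / 3)%R) by (assert (Q := cond_pos e); lra).
  destruct (Hc n x (ball (u n x) (mkposreal _ Pe)) (locally_ball _ _)) as [d Hd].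
  exists d. intros y Hy. apply He. specialize (Hd y Hy).
  change (Rabs (v y - v x) < e)%R. change (Rabs (u n y - u n x) < e / 3)%R in Hd.
  assert (Q1 := V n y). assert (Q2 := V n x). rewrite <- Rabs_Ropp in Q2.
  replace (v y - v x)%R with ((v y - u n y) + (u n y - u n x) + - (v x - u n x))%R by ring.
  assert (T1 := Rabs_triang (v y - u n y + (u n y - u n x)) (- (v x - u n x))).
  assert (T2 := Rabs_triang (v y - u n y) (u n y - u n x)). lra.
Qed.

Lemma unif_lim_C (u : nat -> R -> C) (K : R) :
  (forall n x, ccont (u n) x) ->
  (forall n x, (Cmod (u (S n) x - u n x) <= K / 2 ^ n)%R) ->
  exists v, (forall x, ccont v x) /\ forall n x, (Cmod (v x - u n x) <= 4 * K / 2 ^ n)%R.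
Proof.
  intros Hc H.
  destruct (unif_lim_R (fun n x => fst (u n x)) K) as [v1 [C1 H1]].
  { intros n x. exact (proj1 (Hc n x)). }
  { intros n x. eapply Rle_trans; [|apply (H n x)]. apply (fst_le_Cmod (u (S n) x - u n x)). }
  destruct (unif_lim_R (fun n x => snd (u n x)) K) as [v2 [C2 H2]].
  { intros n x. exact (proj2 (Hc n x)). }
  { intros n x. eapply Rle_trans; [|apply (H n x)]. apply (snd_le_Cmod (u (S n) x - u n x)). }
  exists (fun x => (v1 x, v2 x)). split.
  - intros x. split; simpl; [apply C1|apply C2].
  - intros n x. eapply Rle_trans; [apply Cmod_le_abs|].
    specialize (H1 n x). specialize (H2 n x). simpl. unfold Rminus in *.
    replace (4 * K / 2 ^ n)%R with (2 * K / 2 ^ n + 2 * K / 2 ^ n)%R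
      by (field; apply pow_nonzero; lra). lra.
Qed.

(** * Existence of solutions *)

Definition forced_system (a b f : R -> C) (z : C) (y w : R -> C) : Prop :=
  (forall x, ccont y x /\ ccont w x) /\
  forall x, (0 < x < PI)%R ->
    cderiv y x (- (Ci * z) * y x + a x * w x + f x) /\ cderiv w x (b x * y x).

Definition system (a b : R -> C) := forced_system a b (fun _ => 0).

Lemma ccont_Cmod f x : ccont f x -> continuous (fun t => Cmod (f t)) x.
Proof.
  intros [H1 H2]. unfold Cmod.
  apply (continuous_comp (fun t => (fst (f t) ^ 2 + snd (f t) ^ 2)%R) sqrt); [|apply continuous_sqrt].
  assert (S : forall u : R -> R, continuous u x -> continuous (fun t => u t ^ 2)%R x).
  { intros u Hu. simpl. apply (continuous_mult (K := R_AbsRing) u (fun t => u t * 1)%R); [exact Hu|].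
    apply (continuous_mult (K := R_AbsRing) u (fun _ => 1%R)); [exact Hu|]. apply continuous_const. }
  apply (continuous_plus (V := R_NormedModule) (fun t => fst (f t) ^ 2)%R (fun t => snd (f t) ^ 2)%R);
    auto.
Qed.

Lemma ccont_bounded f L : (forall x, ccont f x) ->
  exists M : R, (0 <= M)%R /\ forall x, (0 <= x <= L)%R -> (Cmod (f x) <= M)%R.
Proof.
  intros H. destruct (Rle_dec 0 L) as [HL|HL].
  - destruct (continuity_ab_maj (fun t => Cmod (f t)) 0 L HL) as [m [Hm _]].
    + intros c _. now apply continuous_continuity_pt, ccont_Cmod.
    + exists (Cmod (f m)). split; [apply Cmod_ge_0|auto].
  - exists 0%R. split; [lra|]. intros; lra.
Qed.

Lemma CI_clamp_cont g c x : (forall t, ccont g t) -> ccont (fun t => c + CI g (clamp t)) x.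
Proof.
  intros Hg. apply ccont_plus; [apply ccont_const|].
  apply (ccont_comp (CI g) clamp); [|apply clamp_continuous].
  eapply cderiv_ccont, cderiv_CI, Hg.
Qed.

Lemma CI_clamp_diff g g' (h h' : R -> R) x c : (forall t, ccont g t) -> (forall t, ccont g' t) ->
  (forall t, is_derive h t (h' t)) ->
  (forall t, (0 <= t <= PI)%R -> (Cmod (g t - g' t) <= h' t)%R) ->
  (Cmod ((c + CI g (clamp x)) - (c + CI g' (clamp x))) <= 2 * (h (clamp x) - h 0))%R.
Proof.
  intros Hg Hg' Hh Hb'. assert (S := clamp_seg x).
  replace ((c + CI g (clamp x)) - (c + CI g' (clamp x))) with
    ((CI g (clamp x) - CI g' (clamp x)) - (CI g 0 - CI g' 0)) by (rewrite !CI_0; ring).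
  apply (cderiv_majorant (fun x => CI g x - CI g' x) (fun t => g t - g' t) h h' 0); auto; [|lra|].
  - intros t. apply ccont_minus; eapply cderiv_ccont, cderiv_CI; auto.
  - intros t Ht. split; [|apply Hb'; lra].
    apply cderiv_minus; now apply cderiv_CI.
Qed.

Lemma cderiv_CI_clamp g c x : (forall t, ccont g t) -> (0 < x < PI)%R ->
  cderiv (fun t => c + CI g (clamp t)) x (g x).
Proof.
  intros Hg Hx.
  apply cderiv_loc with (f := fun x => c + CI g x) (d := Rmin x (PI - x)).
  - apply Rmin_glb_lt; lra.
  - intros t Ht. assert (T1 := Rlt_le_trans _ _ _ Ht (Rmin_l _ _)).
    assert (T2 := Rlt_le_trans _ _ _ Ht (Rmin_r _ _)).
    apply Rabs_def2 in T1. apply Rabs_def2 in T2. rewrite clamp_id by lra. reflexivity.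
  - eapply cderiv_eq; [apply (cderiv_plus (fun _ => c) (CI g)); [apply cderiv_const|now apply cderiv_CI]|].
    ring.
Qed.

Lemma geometric_eq (u v : C) (M : R) : (forall n, (Cmod (u - v) <= M / 2 ^ n)%R) -> u = v.
Proof.
  assert (P2 : forall n, (0 < 2 ^ n)%R) by (intros n; apply pow_lt; lra).
  intros H. apply Ceq_minus, Cmod_eq_0. apply Rle_antisym; [|apply Cmod_ge_0].
  apply le_epsilon. intros e He. rewrite Rplus_0_l.
  destruct (Rle_dec M 0) as [HM|HM].
  { specialize (H 0%nat). rewrite pow_O, Rdiv_1_r in H. lra. }
  destruct (INR_unbounded (M / e)) as [n Hn]. eapply Rle_trans; [apply (H n)|].
  assert (G := INR_le_pow2 n).
  apply Rmult_le_reg_r with (2 ^ n)%R; [auto|].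
  replace (M / 2 ^ n * 2 ^ n)%R with M by (field; apply Rgt_not_eq, P2).
  replace M with (e * (M / e))%R by (field; lra). apply Rmult_le_compat_l; lra.
Qed.

Lemma forced_system_exists a b f z y0 w0 :
  (forall x, ccont a x) -> (forall x, ccont b x) -> (forall x, ccont f x) ->
  exists y w, forced_system a b f z y w /\ y 0%R = y0 /\ w 0%R = w0.
Proof.
  intros Ha Hb Hf.
  set (Fy := fun (y w : R -> C) (t : R) => - (Ci * z) * y t + a t * w t + f t).
  set (Fw := fun (y : R -> C) (t : R) => b t * y t).
  assert (CFy : forall y w, (forall x, ccont y x) -> (forall x, ccont w x) -> forall x, ccont (Fy y w) x).
  { intros y w Hy Hw x. apply ccont_plus; [apply ccont_plus; apply ccont_mult|]; auto using ccont_const. }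
  assert (CFw : forall y, (forall x, ccont y x) -> forall x, ccont (Fw y) x).
  { intros y Hy x. apply ccont_mult; auto. }
  assert (U : exists u v : nat -> R -> C, u 0%nat = (fun _ => RtoC 0) /\ v 0%nat = (fun _ => RtoC 0) /\
    forall n, u (S n) = (fun x => y0 + CI (Fy (u n) (v n)) (clamp x)) /\
              v (S n) = (fun x => w0 + CI (Fw (u n)) (clamp x))).
  { set (P := nat_rect (fun _ => ((R -> C) * (R -> C))%type) ((fun _ => RtoC 0), (fun _ => RtoC 0))
      (fun _ p => ((fun x => y0 + CI (Fy (fst p) (snd p)) (clamp x)),
                   (fun x => w0 + CI (Fw (fst p)) (clamp x))))).
    exists (fun n => fst (P n)), (fun n => snd (P n)). repeat split. }
  destruct U as [u [v [Eu0 [Ev0 Euv]]]].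
  assert (Cu : forall n x, ccont (u n) x /\ ccont (v n) x).
  { induction n as [|n IH]; intros x; [rewrite Eu0, Ev0; split; apply ccont_const|].
    destruct (Euv n) as [-> ->]. split; apply CI_clamp_cont.
    - apply CFy; intros t; apply (IH t).
    - apply CFw; intros t; apply (IH t). }
  destruct (ccont_bounded a PI Ha) as [A [A0 HA]].
  destruct (ccont_bounded b PI Hb) as [B [B0 HB]].
  assert (Z0 := Cmod_ge_0 z). assert (PI0 := PI_RGT_0).
  set (k := (4 * (Cmod z + A + B) + 1)%R). assert (Hk : (1 <= k)%R) by (unfold k; lra).
  assert (P2 : forall n, (0 < 2 ^ n)%R) by (intros n; apply pow_lt; lra).
  assert (Cu1 : forall n x, ccont (u n) x) by (intros n x; exact (proj1 (Cu n x))).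
  assert (Cv1 : forall n x, ccont (v n) x) by (intros n x; exact (proj2 (Cu n x))).
  assert (Eu : forall n x, u (S n) x = y0 + CI (Fy (u n) (v n)) (clamp x)).
  { intros n x. now rewrite (proj1 (Euv n)). }
  assert (Ev : forall n x, v (S n) x = w0 + CI (Fw (u n)) (clamp x)).
  { intros n x. now rewrite (proj2 (Euv n)). }
  clear Euv Cu.
  destruct (ccont_bounded (u 1%nat) PI (Cu1 1%nat)) as [M1 [M10 HM1]].
  destruct (ccont_bounded (v 1%nat) PI (Cv1 1%nat)) as [M2 [M20 HM2]].
  set (K := (M1 + M2)%R).
  assert (E1 : forall t, (0 <= t)%R -> (1 <= exp (k * t))%R).
  { intros t Ht. assert (Q := exp_ineq1_le (k * t)). nra. }
  assert (LipY : forall y w y' w' t X, (0 <= t <= PI)%R -> (0 <= X)%R ->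
    (Cmod (y t - y' t) <= X)%R -> (Cmod (w t - w' t) <= X)%R ->
    (Cmod (Fy y w t - Fy y' w' t) <= (Cmod z + A) * X)%R).
  { intros y w y' w' t X Ht HX Q1 Q2. unfold Fy.
    replace (- (Ci * z) * y t + a t * w t + f t - (- (Ci * z) * y' t + a t * w' t + f t))
      with (- (Ci * z * (y t - y' t)) + a t * (w t - w' t)) by ring.
    eapply Rle_trans; [apply Cmod_triangle|].
    rewrite Cmod_opp, !Cmod_mult, Cmod_Ci, Rmult_1_l, Rmult_plus_distr_r.
    apply Rplus_le_compat; apply Rmult_le_compat; auto using Cmod_ge_0; lra. }
  assert (LipW : forall y y' t X, (0 <= t <= PI)%R -> (0 <= X)%R ->
    (Cmod (y t - y' t) <= X)%R -> (Cmod (Fw y t - Fw y' t) <= B * X)%R).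
  { intros y y' t X Ht HX Q1. unfold Fw.
    replace (b t * y t - b t * y' t) with (b t * (y t - y' t)) by ring.
    rewrite Cmod_mult. apply Rmult_le_compat; auto using Cmod_ge_0. }
  assert (Pc : forall x, u 1%nat x = u 1%nat (clamp x) /\ v 1%nat x = v 1%nat (clamp x)).
  { intros x. rewrite !Eu, !Ev. rewrite (clamp_id (clamp x)) by apply clamp_seg. auto. }
  assert (D : forall n x,
    (Cmod (u (S n) x - u n x) <= K * exp (k * clamp x) / 2 ^ n)%R /\
    (Cmod (v (S n) x - v n x) <= K * exp (k * clamp x) / 2 ^ n)%R).
  { induction n as [|n IH]; intros x.
    - destruct (Pc x) as [-> ->]. assert (S := clamp_seg x).
      assert (Q := E1 (clamp x) ltac:(lra)).
      assert (Q1 := HM1 _ S). assert (Q2 := HM2 _ S).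
      rewrite Eu0, Ev0.
      replace (u 1%nat (clamp x) - 0) with (u 1%nat (clamp x)) by ring.
      replace (v 1%nat (clamp x) - 0) with (v 1%nat (clamp x)) by ring.
      rewrite pow_O, Rdiv_1_r. unfold K. split; nra.
    - assert (K0 : (0 <= K / 2 ^ n)%R) by (apply Rdiv_le_0_compat; [unfold K; lra|auto]).
      set (h := fun t => (K / 2 ^ n * (k / 4) * / k * exp (k * t))%R).
      set (h' := fun t => (K / 2 ^ n * (k / 4) * exp (k * t))%R).
      assert (Hh : forall t, is_derive h t (h' t)).
      { intros t. unfold h, h'. auto_derive; [exact I|]. field.
        repeat split; first [apply pow_nonzero; lra | apply Rgt_not_eq; lra]. }
      assert (Eh : (2 * (h (clamp x) - h 0) <= K * exp (k * clamp x) / 2 ^ S n)%R).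
      { unfold h. assert (Q : (0 <= K / 2 ^ n * (k / 4) * / k * exp (k * 0))%R).
        { rewrite Rmult_0_r, exp_0. apply Rmult_le_pos; [|lra].
          apply Rmult_le_pos; [|left; apply Rinv_0_lt_compat; lra].
          apply Rmult_le_pos; lra. }
        replace (K * exp (k * clamp x) / 2 ^ S n)%R
          with (2 * (K / 2 ^ n * (k / 4) * / k * exp (k * clamp x)))%R; [lra|].
        simpl. field.
        repeat split; first [apply pow_nonzero; lra | apply Rgt_not_eq; lra]. }
      assert (In : forall t, (0 <= t <= PI)%R -> (0 <= K / 2 ^ n * exp (k * t))%R /\
         (Cmod (u (S n) t - u n t) <= K / 2 ^ n * exp (k * t))%R /\
         (Cmod (v (S n) t - v n t) <= K / 2 ^ n * exp (k * t))%R).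
      { intros t Ht. specialize (IH t). rewrite clamp_id in IH by exact Ht.
        replace (K * exp (k * t) / 2 ^ n)%R with (K / 2 ^ n * exp (k * t))%R in IH
          by (field; apply Rgt_not_eq, P2).
        split; [apply Rmult_le_pos; [exact K0|left; apply exp_pos]|exact IH]. }
      split; (eapply Rle_trans; [|exact Eh]).
      + rewrite (Eu (S n)), (Eu n).
        apply (CI_clamp_diff (Fy (u (S n)) (v (S n))) (Fy (u n) (v n)) h h');
          [apply CFy; auto|apply CFy; auto|exact Hh|].
        intros t Ht. destruct (In t Ht) as [Q0 [Q1 Q2]]. unfold h'.
        eapply Rle_trans; [apply (LipY _ _ _ _ t _ Ht Q0 Q1 Q2)|].
        replace (K / 2 ^ n * (k / 4) * exp (k * t))%R
          with (k / 4 * (K / 2 ^ n * exp (k * t)))%R by (field; apply Rgt_not_eq, P2).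
        apply Rmult_le_compat_r; [exact Q0|unfold k; lra].
      + rewrite (Ev (S n)), (Ev n).
        apply (CI_clamp_diff (Fw (u (S n))) (Fw (u n)) h h');
          [apply CFw; auto|apply CFw; auto|exact Hh|].
        intros t Ht. destruct (In t Ht) as [Q0 [Q1 Q2]]. unfold h'.
        eapply Rle_trans; [apply (LipW _ _ t _ Ht Q0 Q1)|].
        replace (K / 2 ^ n * (k / 4) * exp (k * t))%R
          with (k / 4 * (K / 2 ^ n * exp (k * t)))%R by (field; apply Rgt_not_eq, P2).
        apply Rmult_le_compat_r; [exact Q0|unfold k; lra]. }
  set (K' := (K * exp (k * PI))%R).
  assert (D' : forall n x, (K * exp (k * clamp x) / 2 ^ n <= K' / 2 ^ n)%R).
  { intros n x. apply Rmult_le_compat_r; [left; now apply Rinv_0_lt_compat|].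
    unfold K'. apply Rmult_le_compat_l; [unfold K; lra|]. assert (S := clamp_seg x).
    destruct (Req_dec (clamp x) PI) as [->|N]; [lra|]. left. apply exp_increasing. nra. }
  destruct (unif_lim_C u K' Cu1) as [y [Cy Hy]].
  { intros n x. eapply Rle_trans; [exact (proj1 (D n x))|apply D']. }
  destruct (unif_lim_C v K' Cv1) as [w [Cw Hw]].
  { intros n x. eapply Rle_trans; [exact (proj2 (D n x))|apply D']. }
  assert (K'0 : (0 <= K')%R).
  { unfold K'. apply Rmult_le_pos; [unfold K; lra|left; apply exp_pos]. }
  assert (X0 : forall n, (0 <= 4 * K' / 2 ^ n)%R).
  { intros n. apply Rdiv_le_0_compat; [lra|auto]. }
  assert (X1 : forall n, (4 * K' / 2 ^ S n <= 4 * K' / 2 ^ n)%R).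
  { intros n. apply Rmult_le_compat_l; [lra|]. apply Rinv_le_contravar; [auto|].
    simpl. specialize (P2 n). lra. }
  assert (Dl : forall c t, is_derive (fun t => c * t)%R t c).
  { intros c t. auto_derive; [exact I|ring]. }
  assert (Ey : forall x, y x = y0 + CI (Fy y w) (clamp x)).
  { intros x. apply (geometric_eq _ _ (4 * K' + 2 * ((Cmod z + A) * (4 * K') * PI))%R). intros n.
    set (q := y0 + CI (Fy y w) (clamp x)).
    assert (Q1 := Hy (S n) x).
    assert (Q2 : (Cmod (u (S n) x - q) <= 2 * ((Cmod z + A) * (4 * K' / 2 ^ n) * PI))%R).
    { rewrite Eu. unfold q. eapply Rle_trans.
      - apply (CI_clamp_diff (Fy (u n) (v n)) (Fy y w)
          (fun t => (Cmod z + A) * (4 * K' / 2 ^ n) * t)%R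
          (fun _ => (Cmod z + A) * (4 * K' / 2 ^ n))%R); [apply CFy; auto|apply CFy; auto|apply Dl|].
        intros t Ht. apply LipY; auto; rewrite Cmod_minus_sym; auto.
      - rewrite Rmult_0_r, Rminus_0_r. apply Rmult_le_compat_l; [lra|].
        apply Rmult_le_compat_l; [|apply clamp_seg].
        apply Rmult_le_pos; [lra|auto]. }
    replace (y x - q) with ((y x - u (S n) x) + (u (S n) x - q)) by ring.
    eapply Rle_trans; [apply Cmod_triangle|].
    replace ((4 * K' + 2 * ((Cmod z + A) * (4 * K') * PI)) / 2 ^ n)%R with
      (4 * K' / 2 ^ n + 2 * ((Cmod z + A) * (4 * K' / 2 ^ n) * PI))%R
      by (field; apply Rgt_not_eq, P2). specialize (X1 n). lra. }
  assert (Ew : forall x, w x = w0 + CI (Fw y) (clamp x)).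
  { intros x. apply (geometric_eq _ _ (4 * K' + 2 * (B * (4 * K') * PI))%R). intros n.
    set (q := w0 + CI (Fw y) (clamp x)).
    assert (Q1 := Hw (S n) x).
    assert (Q2 : (Cmod (v (S n) x - q) <= 2 * (B * (4 * K' / 2 ^ n) * PI))%R).
    { rewrite Ev. unfold q. eapply Rle_trans.
      - apply (CI_clamp_diff (Fw (u n)) (Fw y) (fun t => B * (4 * K' / 2 ^ n) * t)%R
          (fun _ => B * (4 * K' / 2 ^ n))%R); [apply CFw; auto|apply CFw; auto|apply Dl|].
        intros t Ht. apply LipW; auto; rewrite Cmod_minus_sym; auto.
      - rewrite Rmult_0_r, Rminus_0_r. apply Rmult_le_compat_l; [lra|].
        apply Rmult_le_compat_l; [|apply clamp_seg].
        apply Rmult_le_pos; [lra|auto]. }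
    replace (w x - q) with ((w x - v (S n) x) + (v (S n) x - q)) by ring.
    eapply Rle_trans; [apply Cmod_triangle|].
    replace ((4 * K' + 2 * (B * (4 * K') * PI)) / 2 ^ n)%R with
      (4 * K' / 2 ^ n + 2 * (B * (4 * K' / 2 ^ n) * PI))%R
      by (field; apply Rgt_not_eq, P2). specialize (X1 n). lra. }
  exists y, w. split; [split; [auto|]|].
  - intros x Hx. split.
    + apply cderiv_loc with (f := fun x => y0 + CI (Fy y w) (clamp x)) (d := 1%R);
        [lra|intros; now rewrite <- Ey|].
      apply (cderiv_CI_clamp (Fy y w)); [apply CFy; auto|exact Hx].
    + apply cderiv_loc with (f := fun x => w0 + CI (Fw y) (clamp x)) (d := 1%R);
        [lra|intros; now rewrite <- Ew|].
      apply (cderiv_CI_clamp (Fw y)); [apply CFw; auto|exact Hx].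
  - rewrite Ey, Ew. rewrite clamp_id by lra. rewrite !CI_0. split; ring.
Qed.

(** * Energy estimates and analytic dependence on the spectral parameter *)

Definition inner (u v : C) : R := (fst u * fst v + snd u * snd v)%R.

Lemma inner_le u v : (inner u v <= Cmod u * Cmod v)%R.
Proof.
  assert (P := Rmult_le_pos _ _ (Cmod_ge_0 u) (Cmod_ge_0 v)).
  destruct (Rle_dec (inner u v) 0) as [L|L]; [lra|].
  apply Rsqr_incr_0; [|lra|exact P]. unfold Rsqr, inner.
  replace (Cmod u * Cmod v * (Cmod u * Cmod v))%R
    with ((Cmod u * Cmod u) * (Cmod v * Cmod v))%R by ring.
  rewrite !Cmod_sq. assert (Q := Rle_0_sqr (fst u * snd v - snd u * fst v)). unfold Rsqr in Q. nra.
Qed.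

Lemma inner_plus u v w : inner u (v + w) = (inner u v + inner u w)%R.
Proof. unfold inner. simpl. ring. Qed.

Lemma inner_scal u c : inner u (c * u) = (fst c * (Cmod u * Cmod u))%R.
Proof. rewrite Cmod_sq. unfold inner. simpl. ring. Qed.

Lemma is_derive_Cmod_sq y x l : cderiv y x l ->
  is_derive (fun t => Cmod (y t) * Cmod (y t))%R x (2 * inner (y x) l)%R.
Proof.
  intros [H1 H2].
  apply is_derive_ext with (fun t => fst (y t) * fst (y t) + snd (y t) * snd (y t))%R.
  { intros t. symmetry. apply Cmod_sq. }
  evar_last.
  - apply (is_derive_plus (fun t => fst (y t) * fst (y t))%R (fun t => snd (y t) * snd (y t))%R);
      [exact (is_derive_Rmult _ _ _ _ _ H1 H1)|exact (is_derive_Rmult _ _ _ _ _ H2 H2)].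
  - unfold plus, inner; simpl. ring.
Qed.

Lemma continuous_Cmod_sq y x : ccont y x -> continuous (fun t => Cmod (y t) * Cmod (y t))%R x.
Proof.
  intros H. apply (continuous_mult (K := R_AbsRing) (fun t => Cmod (y t)) (fun t => Cmod (y t)));
  now apply ccont_Cmod.
Qed.

Lemma energy_bound a b f z y w A F s : forced_system a b f z y w ->
  (0 <= A)%R -> (0 <= F)%R -> (0 <= s)%R -> (snd z <= s)%R ->
  (forall x, (0 <= x <= PI)%R -> (Cmod (a x) <= A)%R /\ (Cmod (b x) <= A)%R /\ (Cmod (f x) <= F)%R) ->
  forall x, (0 <= x <= PI)%R ->
  (Cmod (y x) * Cmod (y x) + Cmod (w x) * Cmod (w x) <=
   (Cmod (y 0) * Cmod (y 0) + Cmod (w 0) * Cmod (w 0) + F * F) * exp ((2 * s + 2 * A + 1) * PI))%R.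
Proof.
  intros [Hc Hd] HA HF Hs Hz Hb x Hx. set (k := (2 * s + 2 * A + 1)%R).
  assert (Hk : (1 <= k)%R) by (unfold k; lra).
  set (N := fun x => (Cmod (y x) * Cmod (y x) + Cmod (w x) * Cmod (w x))%R).
  assert (G : (N x + F * F / k <= (N 0 + F * F / k) * exp (k * x))%R).
  { apply gronwall with PI; [lra| |exact Hx|].
    - intros t. apply (continuous_plus (V := R_NormedModule) (fun t => Cmod (y t) * Cmod (y t))%R
        (fun t => Cmod (w t) * Cmod (w t))%R);
      [exact (continuous_Cmod_sq y t (proj1 (Hc t)))|exact (continuous_Cmod_sq w t (proj2 (Hc t)))].
    - intros t Ht. destruct (Hd t Ht) as [H1 H2].
      eexists. split.
      + apply (is_derive_plus (fun t => Cmod (y t) * Cmod (y t))%R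
          (fun t => Cmod (w t) * Cmod (w t))%R); apply is_derive_Cmod_sq; eassumption.
      + unfold plus; simpl. rewrite !inner_plus, inner_scal.
        destruct (Hb t) as [B1 [B2 B3]]; [lra|].
        assert (I1 := inner_le (y t) (a t * w t)). assert (I2 := inner_le (y t) (f t)).
        assert (I3 := inner_le (w t) (b t * y t)). rewrite Cmod_mult in I1, I3.
        replace (fst (- (Ci * z))) with (snd z) by (simpl; ring).
        unfold N. set (Y := Cmod (y t)) in *. set (W := Cmod (w t)) in *.
        assert (Y0 : (0 <= Y)%R) by apply Cmod_ge_0. assert (W0 : (0 <= W)%R) by apply Cmod_ge_0.
        assert (J1 : (Y * (Cmod (a t) * W) <= A * (Y * W))%R).
        { replace (Y * (Cmod (a t) * W))%R with (Cmod (a t) * (Y * W))%R by ring.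
          apply Rmult_le_compat_r; [nra|exact B1]. }
        assert (J3 : (W * (Cmod (b t) * Y) <= A * (Y * W))%R).
        { replace (W * (Cmod (b t) * Y))%R with (Cmod (b t) * (Y * W))%R by ring.
          apply Rmult_le_compat_r; [nra|exact B2]. }
        assert (J2 : (Y * Cmod (f t) <= Y * F)%R) by (apply Rmult_le_compat_l; lra).
        assert (J4 : (2 * (Y * W) <= Y * Y + W * W)%R) by (assert (Q := Rle_0_sqr (Y - W)); unfold Rsqr in Q; lra).
        assert (J5 : (2 * (Y * F) <= Y * Y + F * F)%R) by (assert (Q := Rle_0_sqr (Y - F)); unfold Rsqr in Q; lra).
        assert (J6 : (snd z * (Y * Y) <= s * (Y * Y))%R) by (apply Rmult_le_compat_r; nra).
        assert (J7 : (A * (2 * (Y * W)) <= A * (Y * Y + W * W))%R) by (apply Rmult_le_compat_l; lra).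
        assert (J8 : (0 <= s * (W * W))%R) by (apply Rmult_le_pos; nra).
        assert (J9 : (0 <= W * W)%R) by nra.
        unfold k. lra. }
  assert (N0 : (0 <= N 0)%R).
  { unfold N. assert (Q1 := Cmod_ge_0 (y 0%R)). assert (Q2 := Cmod_ge_0 (w 0%R)). nra. }
  assert (FF : (0 <= F * F)%R) by nra.
  assert (Fk : (0 <= F * F / k <= F * F)%R).
  { split; [apply Rdiv_le_0_compat; lra|]. apply Rmult_le_reg_r with k; [lra|].
    replace (F * F / k * k)%R with (F * F)%R by (field; lra). nra. }
  assert (Ex : (exp (k * x) <= exp (k * PI))%R).
  { destruct (Req_dec x PI) as [->|Nx]; [lra|]. left. apply exp_increasing.
    apply Rmult_lt_compat_l; lra. }
  assert (Pe := exp_pos (k * x)). fold (N x) (N 0%R).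
  apply Rle_trans with ((N 0 + F * F / k) * exp (k * x))%R; [lra|].
  apply Rmult_le_compat; lra.
Qed.

Lemma forced_system_comb a b f f' g z y w y' w' c :
  forced_system a b f z y w -> forced_system a b f' z y' w' ->
  (forall x, (0 < x < PI)%R -> g x = f x + c * f' x) ->
  forced_system a b g z (fun x => y x + c * y' x) (fun x => w x + c * w' x).
Proof.
  intros [C1 D1] [C2 D2] Hg. split.
  - intros x. destruct (C1 x), (C2 x).
    split; (apply ccont_plus; [assumption|apply ccont_mult; [apply ccont_const|assumption]]).
  - intros x Hx. destruct (D1 x Hx) as [D11 D12], (D2 x Hx) as [D21 D22]. split.
    + eapply cderiv_eq; [apply cderiv_plus; [exact D11|apply cderiv_scal; exact D21]|].
      rewrite Hg by exact Hx. ring.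
    + eapply cderiv_eq; [apply cderiv_plus; [exact D12|apply cderiv_scal; exact D22]|]. ring.
Qed.

Lemma seg_bound a b : (forall x, ccont a x) -> (forall x, ccont b x) ->
  exists A : R, (0 <= A)%R /\ forall x, (0 <= x <= PI)%R -> (Cmod (a x) <= A)%R /\ (Cmod (b x) <= A)%R.
Proof.
  intros Ha Hb. destruct (ccont_bounded a PI Ha) as [A [A0 HA]].
  destruct (ccont_bounded b PI Hb) as [B [B0 HB]]. exists (A + B)%R. split; [lra|].
  intros x Hx. specialize (HA x Hx). specialize (HB x Hx). lra.
Qed.

Lemma system_zero a b z y w : (forall x, ccont a x) -> (forall x, ccont b x) ->
  system a b z y w -> y 0%R = 0 -> w 0%R = 0 ->
  forall x, (0 <= x <= PI)%R -> y x = 0 /\ w x = 0.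
Proof.
  intros Ha Hb H Y0 W0 x Hx. destruct (seg_bound a b Ha Hb) as [A [A0 HA]].
  assert (Q := energy_bound a b (fun _ => 0) z y w A 0 (Cmod z) H A0 ltac:(lra) (Cmod_ge_0 z)).
  assert (Sz : (snd z <= Cmod z)%R) by (eapply Rle_trans; [apply Rle_abs|apply snd_le_Cmod]).
  specialize (Q Sz). 
  assert (Hf : forall x, (0 <= x <= PI)%R -> (Cmod (a x) <= A)%R /\ (Cmod (b x) <= A)%R /\ (Cmod 0 <= 0)%R).
  { intros t Ht. destruct (HA t Ht). rewrite Cmod_0. repeat split; auto; lra. }
  specialize (Q Hf x Hx). rewrite Y0, W0, Cmod_0 in Q.
  assert (P1 := Cmod_ge_0 (y x)). assert (P2 := Cmod_ge_0 (w x)).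
  split; apply Cmod_eq_0; nra.
Qed.

Section AnalyticDependence.
Variables (a b : R -> C) (z0 : C).
Hypothesis Ha : forall x, ccont a x.
Hypothesis Hb : forall x, ccont b x.

Lemma response_exists (f : R -> C) : exists p : (R -> C) * (R -> C), (forall x, ccont f x) ->
  forced_system a b f z0 (fst p) (snd p) /\ fst p 0%R = 0 /\ snd p 0%R = 0.
Proof.
  destruct (classic (forall x, ccont f x)) as [Hf|N].
  - destruct (forced_system_exists a b f z0 0 0 Ha Hb Hf) as [y [w H]]. exists (y, w). auto.
  - exists (fun _ => RtoC 0, fun _ => RtoC 0). intros H. now elim N.
Qed.

Definition response (f : R -> C) : (R -> C) * (R -> C) :=
  proj1_sig (constructive_indefinite_description _ (response_exists f)).

Lemma response_spec f : (forall x, ccont f x) ->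
  forced_system a b f z0 (fst (response f)) (snd (response f)) /\
  fst (response f) 0%R = 0 /\ snd (response f) 0%R = 0.
Proof.
  intros Hf. unfold response.
  destruct (constructive_indefinite_description _ (response_exists f)) as [p Hp]. simpl. auto.
Qed.

(* The relation [u z = u z0 + (z - z0) (- i response (u z))] passes from the family [u] to the
   family [- i response u], so it can be iterated and yields difference quotients of all orders. *)
Lemma response_family k : forall u w : C -> R -> C,
  (forall z x, ccont (u z) x) ->
  (exists d M : R, (0 < d)%R /\ forall z, (Cmod (z - z0) < d)%R -> forall x, (0 <= x <= PI)%R ->
     (Cmod (u z x) <= M)%R /\ (Cmod (w z x) <= M)%R) ->
  (forall z x, (0 <= x <= PI)%R ->
     u z x = u z0 x + (z - z0) * (- Ci * fst (response (u z)) x) /\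
     w z x = w z0 x + (z - z0) * (- Ci * snd (response (u z)) x)) ->
  forall x, (0 <= x <= PI)%R -> jet k (fun z => u z x) z0 /\ jet k (fun z => w z x) z0.
Proof.
  induction k as [|k IH]; intros u w Hc [d [M [Hd HM]]] E x Hx.
  - split; exists d, M; (split; [exact Hd|]); intros z Hz; now apply (HM z Hz x Hx).
  - set (u' := fun z x => - Ci * fst (response (u z)) x).
    set (w' := fun z x => - Ci * snd (response (u z)) x).
    assert (Cu' : forall z x, ccont (u' z) x).
    { intros z t. apply ccont_mult; [apply ccont_const|]. exact (proj1 (proj1 (proj1 (response_spec (u z) (Hc z))) t)). }
    assert (Q : forall x, (0 <= x <= PI)%R ->
                  jet k (fun z => u' z x) z0 /\ jet k (fun z => w' z x) z0).
    { apply IH; [exact Cu'| |].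
      - destruct (seg_bound a b Ha Hb) as [A [A0 HA]].
        set (B := (M * M * exp ((2 * Cmod z0 + 2 * A + 1) * PI))%R).
        exists d, (1 + B)%R. split; [exact Hd|]. intros z Hz t Ht.
        destruct (response_spec (u z) (Hc z)) as [R1 [R2 R3]].
        assert (M0 : (0 <= M)%R).
        { eapply Rle_trans; [apply Cmod_ge_0|]. apply (HM z Hz t Ht). }
        assert (Sz : (snd z0 <= Cmod z0)%R) by (eapply Rle_trans; [apply Rle_abs|apply snd_le_Cmod]).
        assert (G := energy_bound a b (u z) z0 _ _ A M (Cmod z0) R1 A0 M0 (Cmod_ge_0 z0) Sz).
        assert (Hf : forall x, (0 <= x <= PI)%R ->
          (Cmod (a x) <= A)%R /\ (Cmod (b x) <= A)%R /\ (Cmod (u z x) <= M)%R).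
        { intros s Hs. destruct (HA s Hs), (HM z Hz s Hs). auto. }
        specialize (G Hf t Ht). rewrite R2, R3, Cmod_0 in G.
        replace ((0 * 0 + 0 * 0 + M * M) * exp ((2 * Cmod z0 + 2 * A + 1) * PI))%R with B in G
          by (unfold B; ring).
        unfold u', w'. rewrite !Cmod_mult, Cmod_opp, Cmod_Ci, !Rmult_1_l.
        set (p := Cmod (fst (response (u z)) t)) in *. set (q := Cmod (snd (response (u z)) t)) in *.
        assert (p0 : (0 <= p)%R) by apply Cmod_ge_0. assert (q0 : (0 <= q)%R) by apply Cmod_ge_0.
        split; nra.
      - intros z t Ht.
        destruct (response_spec (u z) (Hc z)) as [R1 [R2 R3]].
        destruct (response_spec (u z0) (Hc z0)) as [R1' [R2' R3']].
        destruct (response_spec (u' z) (Cu' z)) as [S1 [S2 S3]].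
        assert (H1 := forced_system_comb a b _ _ (fun x => u z x + - (1) * u z0 x) z0 _ _ _ _ (- (1))
          R1 R1' (fun _ _ => eq_refl)).
        assert (H2 : forced_system a b (fun _ => 0) z0
          (fun x => (fst (response (u z)) x + - (1) * fst (response (u z0)) x) + - (z - z0) * fst (response (u' z)) x)
          (fun x => (snd (response (u z)) x + - (1) * snd (response (u z0)) x) + - (z - z0) * snd (response (u' z)) x)).
        { apply (forced_system_comb a b _ _ (fun _ => 0) z0 _ _ _ _ (- (z - z0)) H1 S1).
          intros s Hs. destruct (E z s) as [Q1 _]; [lra|].
          fold (u' z s) in Q1. rewrite Q1. ring. }
        destruct (system_zero a b z0 _ _ Ha Hb H2) with (x := t) as [Z1 Z2]; auto.
        + rewrite R2, R2', S2. ring.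
        + rewrite R3, R3', S3. ring.
        + simpl in Z1, Z2. unfold u' at 1 2, w'.
          replace (fst (response (u z)) t) with (fst (response (u z0)) t + (z - z0) * fst (response (u' z)) t).
          2: { rewrite <- (Cplus_0_r (fst (response (u z)) t)), <- Copp_0. rewrite <- Z1. ring. }
          replace (snd (response (u z)) t) with (snd (response (u z0)) t + (z - z0) * snd (response (u' z)) t).
          2: { rewrite <- (Cplus_0_r (snd (response (u z)) t)), <- Copp_0. rewrite <- Z2. ring. }
          split; ring. }
    destruct (Q x Hx) as [Q1 Q2]. split.
    + exists (fun z => u' z x). split; [exact Q1|]. intros z. apply (E z x Hx).
    + exists (fun z => w' z x). split; [exact Q2|]. intros z. apply (E z x Hx).
Qed.

End AnalyticDependence.

Lemma system_bounded a b A z y w s : (0 <= A)%R ->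
  (forall x, (0 <= x <= PI)%R -> (Cmod (a x) <= A)%R /\ (Cmod (b x) <= A)%R) ->
  system a b z y w -> (0 <= s)%R -> (snd z <= s)%R -> forall x, (0 <= x <= PI)%R ->
  (Cmod (y x) * Cmod (y x) + Cmod (w x) * Cmod (w x) <=
   (Cmod (y 0) * Cmod (y 0) + Cmod (w 0) * Cmod (w 0)) * exp ((2 * s + 2 * A + 1) * PI))%R.
Proof.
  intros A0 HA H Hs Hz x Hx.
  assert (Hf : forall x, (0 <= x <= PI)%R -> (Cmod (a x) <= A)%R /\ (Cmod (b x) <= A)%R /\ (Cmod 0 <= 0)%R).
  { intros t Ht. destruct (HA t Ht). rewrite Cmod_0. repeat split; auto; lra. }
  assert (Q := energy_bound a b (fun _ => 0) z y w A 0 s H A0 ltac:(lra) Hs Hz Hf x Hx).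
  eapply Rle_trans; [exact Q|]. right. ring.
Qed.

Theorem system_entire a b (y w : C -> R -> C) y0 w0 :
  (forall x, ccont a x) -> (forall x, ccont b x) ->
  (forall z, system a b z (y z) (w z) /\ y z 0%R = y0 /\ w z 0%R = w0) ->
  forall x, (0 <= x <= PI)%R -> entire (fun z => y z x) /\ entire (fun z => w z x).
Proof.
  intros Ha Hb H x Hx.
  assert (J : forall z0 k, jet k (fun z => y z x) z0 /\ jet k (fun z => w z x) z0).
  2: { split; intros z0 k; apply J. }
  intros z0 k. apply (response_family a b z0 Ha Hb k y w); [| | |exact Hx].
  - intros z t. exact (proj1 (proj1 (proj1 (H z)) t)).
  - destruct (seg_bound a b Ha Hb) as [A [A0 HA]].
    set (B := ((Cmod y0 * Cmod y0 + Cmod w0 * Cmod w0) * exp ((2 * (Cmod z0 + 1) + 2 * A + 1) * PI))%R).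
    exists 1%R, (1 + B)%R. split; [lra|]. intros z Hz t Ht.
    destruct (H z) as [H1 [H2 H3]]. assert (P0 := Cmod_ge_0 z0).
    assert (T := Cmod_triangle_minus z z0).
    assert (Sz : (snd z <= Cmod z)%R) by (eapply Rle_trans; [apply Rle_abs|apply snd_le_Cmod]).
    assert (Q := system_bounded a b A z (y z) (w z) (Cmod z0 + 1) A0 HA H1 ltac:(lra) ltac:(lra) t Ht).
    rewrite H2, H3 in Q. fold B in Q.
    assert (P1 := Cmod_ge_0 (y z t)). assert (P2 := Cmod_ge_0 (w z t)). split; nra.
  - intros z t Ht. destruct (H z) as [H1 [H2 H3]], (H z0) as [H1' [H2' H3']].
    assert (Cz : forall x, ccont (y z) x) by (intros s; exact (proj1 (proj1 H1 s))).
    destruct (response_spec a b z0 Ha Hb (y z) Cz) as [R1 [R2 R3]].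
    set (p := fst (response a b z0 Ha Hb (y z))) in *.
    set (q := snd (response a b z0 Ha Hb (y z))) in *.
    assert (S0 : system a b z0 (fun x => (y z x + - (1) * y z0 x) + (z - z0) * Ci * p x)
                               (fun x => (w z x + - (1) * w z0 x) + (z - z0) * Ci * q x)).
    { apply (forced_system_comb a b (fun x => - (z - z0) * Ci * y z x) (y z)); [|exact R1|intros; ring].
      destruct H1 as [C1 D1], H1' as [C2 D2]. split.
      - intros s. destruct (C1 s), (C2 s).
        split; (apply ccont_plus; [assumption|apply ccont_mult; [apply ccont_const|assumption]]).
      - intros s Hs. destruct (D1 s Hs) as [D11 D12], (D2 s Hs) as [D21 D22]. split.
        + eapply cderiv_eq; [apply cderiv_plus; [exact D11|apply cderiv_scal; exact D21]|]. ring.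
        + eapply cderiv_eq; [apply cderiv_plus; [exact D12|apply cderiv_scal; exact D22]|]. ring. }
    destruct (system_zero a b z0 _ _ Ha Hb S0) with (x := t) as [Z1 Z2]; auto.
    + rewrite H2, H2', R2. ring.
    + rewrite H3, H3', R3. ring.
    + split.
      * rewrite <- (Cplus_0_r (y z t)), <- Copp_0. rewrite <- Z1. ring.
      * rewrite <- (Cplus_0_r (w z t)), <- Copp_0. rewrite <- Z2. ring.
Qed.

(** * Exponential function and half-plane estimates *)

Definition cexp (w : C) : C := ((exp (fst w) * cos (snd w))%R, (exp (fst w) * sin (snd w))%R).

Lemma cexp_plus u v : cexp (u + v) = cexp u * cexp v.
Proof.
  unfold cexp, Cmult. simpl. rewrite exp_plus, cos_plus, sin_plus. f_equal; ring.
Qed.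

Lemma cexp_0 : cexp 0 = 1.
Proof. unfold cexp. simpl. rewrite exp_0, cos_0, sin_0. unfold RtoC. f_equal; ring. Qed.

Lemma Cmod_cexp w : Cmod (cexp w) = exp (fst w).
Proof.
  apply Rsqr_inj; [apply Cmod_ge_0|left; apply exp_pos|].
  unfold Rsqr. rewrite Cmod_sq. unfold cexp. simpl.
  assert (Q := sin2_cos2 (snd w)). unfold Rsqr in Q.
  replace (exp (fst w) * cos (snd w) * (exp (fst w) * cos (snd w)) +
    exp (fst w) * sin (snd w) * (exp (fst w) * sin (snd w)))%R with
    (exp (fst w) * exp (fst w) * (sin (snd w) * sin (snd w) + cos (snd w) * cos (snd w)))%R by ring.
  rewrite Q. ring.
Qed.

Lemma cexp_opp w : cexp w * cexp (- w) = 1.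
Proof. rewrite <- cexp_plus. replace (w + - w) with (RtoC 0) by ring. apply cexp_0. Qed.

Lemma cderiv_cexp c x : cderiv (fun t => cexp (c * RtoC t)) x (c * cexp (c * RtoC x)).
Proof.
  destruct c as [p q].
  assert (E : forall t, cexp ((p, q) * RtoC t) =
                ((exp (p * t) * cos (q * t))%R, (exp (p * t) * sin (q * t))%R)).
  { intros t. unfold cexp. simpl. replace (p * t - q * 0)%R with (p * t)%R by ring.
    now replace (p * 0 + q * t)%R with (q * t)%R by ring. }
  apply cderiv_loc with (f := fun t => ((exp (p * t) * cos (q * t))%R, (exp (p * t) * sin (q * t))%R))
    (d := 1%R); [lra|intros; now rewrite E|].
  rewrite E. split; simpl; auto_derive; try exact I; ring.
Qed.

Lemma cderiv_mult_cexp c f x l : cderiv f x l ->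
  cderiv (fun t => cexp (c * RtoC t) * f t) x (cexp (c * RtoC x) * (c * f x + l)).
Proof.
  intros H. eapply cderiv_eq; [apply (cderiv_mult _ f); [apply cderiv_cexp|exact H]|]. cbv beta. ring.
Qed.

Lemma ccont_mult_cexp c f x : ccont f x -> ccont (fun t => cexp (c * RtoC t) * f t) x.
Proof.
  intros H. apply (ccont_mult (fun t => cexp (c * RtoC t)) f); [|exact H].
  eapply cderiv_ccont, cderiv_cexp.
Qed.

Lemma entire_cexp : entire cexp.
Proof.
  assert (E : entire (fun z => cexp (- (Ci * z) * RtoC 1))).
  { apply (system_entire (fun _ => 0) (fun _ => 0) (fun z x => cexp (- (Ci * z) * RtoC x)) (fun _ _ => 0) 1 0);
      try (intros; apply ccont_const).
    - intros z. split; [split|split; [|reflexivity]].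
      + intros x. split; [|apply ccont_const]. eapply cderiv_ccont, cderiv_cexp.
      + intros x Hx. split.
        * eapply cderiv_eq; [apply cderiv_cexp|]. ring.
        * eapply cderiv_eq; [apply cderiv_const|]. ring.
      + replace (- (Ci * z) * RtoC 0) with (RtoC 0) by ring. apply cexp_0.
    - split; [lra|]. assert (P := PI2_1). lra. }
  intros w. apply holo_ext with (fun w => cexp (- (Ci * (Ci * w)) * RtoC 1)).
  { intros v. f_equal. assert (C2 : Ci * Ci = - (1)).
    { unfold Ci, Cmult, Copp, RtoC; simpl; f_equal; ring. }
    replace (- (Ci * (Ci * v)) * RtoC 1) with (- (Ci * Ci) * v) by ring. rewrite C2. ring. }
  apply (holo_comp (fun z => cexp (- (Ci * z) * RtoC 1)) (fun w => Ci * w)); [apply E|].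
  apply holo_mult; auto using holo_const, holo_id.
Qed.

Lemma holo_cexp f z : holo f z -> holo (fun w => cexp (f w)) z.
Proof. intros H. apply (holo_comp cexp f); [apply entire_cexp|exact H]. Qed.

Lemma entire_cexp_linear (x : R) : entire (fun z => cexp (Ci * z * RtoC x)).
Proof.
  intros z. apply (holo_cexp (fun z => Ci * z * RtoC x)).
  apply holo_mult; [|apply holo_const]. apply holo_mult; auto using holo_id, holo_const.
Qed.

(* Multiplication by [e^{izx}] exchanges the roles of the two components and changes
   the sign of [z], so estimates in one half-plane give estimates in the other. *)
Lemma system_swap a b z y w : system a b z y w ->
  system b a (- z) (fun x => cexp (Ci * z * RtoC x) * w x) (fun x => cexp (Ci * z * RtoC x) * y x).
Proof.
  intros [Hc Hd]. split.
  - intros x. destruct (Hc x). split; now apply ccont_mult_cexp.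
  - intros x Hx. destruct (Hd x Hx) as [D1 D2]. split.
    + eapply cderiv_eq; [apply cderiv_mult_cexp; exact D2|]. ring.
    + eapply cderiv_eq; [apply cderiv_mult_cexp; exact D1|]. ring.
Qed.

(* A component driven only by a bounded one is damped at rate [|Im z|]. *)
Lemma damped_bound a z y w A M m : (forall x, ccont y x) ->
  (forall x, (0 < x < PI)%R -> cderiv y x (- (Ci * z) * y x + a x * w x)) -> y 0%R = 0 ->
  (0 < m)%R -> (snd z <= - m)%R -> (0 <= A)%R -> (0 <= M)%R ->
  (forall x, (0 <= x <= PI)%R -> (Cmod (a x) <= A)%R /\ (Cmod (w x) <= M)%R) ->
  forall x, (0 <= x <= PI)%R -> (Cmod (y x) <= A * M / m)%R.
Proof.
  intros Hc Hd Y0 Hm Hz HA HM Hb x Hx.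
  assert (G : (Cmod (y x) * Cmod (y x) + (A * A * M * M / m) / (- m) <=
    (Cmod (y 0) * Cmod (y 0) + (A * A * M * M / m) / (- m)) * exp (- m * x))%R).
  { apply (gronwall (fun x => Cmod (y x) * Cmod (y x))%R) with PI; [lra| |exact Hx|].
    - intros t. apply continuous_Cmod_sq. exact (Hc t).
    - intros t Ht. assert (D1 := Hd t Ht).
      eexists. split; [apply is_derive_Cmod_sq; exact D1|].
      rewrite !inner_plus, inner_scal. replace (fst (- (Ci * z))) with (snd z) by (simpl; ring).
      assert (I1 := inner_le (y t) (a t * w t)). rewrite Cmod_mult in I1.
      destruct (Hb t ltac:(lra)) as [B1 B2].
      assert (W0 := Cmod_ge_0 (w t)). assert (A0 := Cmod_ge_0 (a t)).
      assert (J : (Cmod (a t) * Cmod (w t) <= A * M)%R) by (apply Rmult_le_compat; auto).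
      set (Y := Cmod (y t)) in *. assert (P0 : (0 <= Y)%R) by apply Cmod_ge_0.
      assert (J2 : (Y * (Cmod (a t) * Cmod (w t)) <= Y * (A * M))%R) by (apply Rmult_le_compat_l; auto).
      assert (J3 : (snd z * (Y * Y) <= - m * (Y * Y))%R) by (apply Rmult_le_compat_r; nra).
      assert (J4 : (2 * (Y * (A * M)) <= m * (Y * Y) + A * A * M * M / m)%R).
      { assert (Q := Rle_0_sqr (m * Y - A * M)). unfold Rsqr in Q.
        apply Rmult_le_reg_l with m; [exact Hm|].
        replace (m * (m * (Y * Y) + A * A * M * M / m))%R
          with (m * m * (Y * Y) + A * A * M * M)%R by (field; lra). nra. }
      lra. }
  rewrite Y0, Cmod_0 in G.
  assert (P := exp_pos (- m * x)).
  replace (A * A * M * M / m / - m)%R with (- ((A * M / m) * (A * M / m)))%R in G by (field; lra).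
  set (c := (A * M / m)%R) in *.
  assert (C0 : (0 <= c)%R) by (apply Rdiv_le_0_compat; [nra|exact Hm]).
  assert (P0 := Cmod_ge_0 (y x)).
  apply Rsqr_incr_0; [|exact P0|exact C0]. unfold Rsqr. nra.
Qed.

(** * Phragmen-Lindelof and Liouville theorems *)

Lemma sector_closed (R : R) (z : C) : ~ (Rabs (snd z) <= fst z /\ Cmod z <= R)%R ->
  exists d, (0 < d)%R /\ forall w, (Cmod (w - z) < d)%R -> ~ (Rabs (snd w) <= fst w /\ Cmod w <= R)%R.
Proof.
  intros N. destruct (Rle_dec (Rabs (snd z)) (fst z)) as [H|H].
  - assert (HR : (R < Cmod z)%R) by (apply Rnot_le_lt; intros Q; apply N; split; auto).
    exists (Cmod z - R)%R. split; [lra|]. intros w Hw [_ Q].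
    assert (T := Cmod_triangle_minus z w). rewrite Cmod_minus_sym in T. lra.
  - exists ((Rabs (snd z) - fst z) / 2)%R. split; [lra|]. intros w Hw [Q _].
    assert (T1 := fst_le_Cmod (w - z)). assert (T2 := snd_le_Cmod (w - z)).
    assert (T3 := Rabs_triang_inv (snd z) (snd w)).
    assert (T4 := Rle_abs (fst (w - z)%C)).
    replace (snd z - snd w)%R with (- snd (w - z)%C)%R in T3 by (simpl; ring).
    rewrite Rabs_Ropp in T3. simpl in *. lra.
Qed.

Lemma csqrt_sector v : (Rabs (snd v) <= fst v)%R -> (0 < fst v)%R ->
  let s := csqrt v in (0 < fst s)%R /\ (fst s * fst s * fst s / 4 <= fst (s * s * s)%C)%R /\
    (4 * Cmod v <= 5 * (fst s * fst s))%R.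
Proof.
  intros H H0 s. destruct (csqrt_spec v H0) as [P E]. fold s in P, E.
  assert (Ev : (Cmod v = fst s * fst s + snd s * snd s)%R).
  { rewrite <- E at 1. rewrite Cmod_mult. apply Cmod_sq. }
  rewrite Ev.
  assert (E1 : (fst v = fst s * fst s - snd s * snd s)%R) by (rewrite <- E; simpl; ring).
  assert (E2 : (snd v = 2 * (fst s * snd s))%R) by (rewrite <- E; simpl; ring).
  destruct s as [p q]. simpl in *.
  assert (E3 : (2 * (p * Rabs q) <= p * p - q * q)%R).
  { rewrite <- E1. eapply Rle_trans; [|exact H]. rewrite E2, !Rabs_mult.
    rewrite (Rabs_pos_eq 2), (Rabs_pos_eq p) by lra. lra. }
  assert (Q0 := Rabs_pos q). assert (Q2 : (Rabs q * Rabs q = q * q)%R) by (symmetry; apply Rsqr_abs).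
  assert (L : (Rabs q <= p / 2)%R).
  { destruct (Rle_dec (Rabs q) (p / 2)) as [|N]; [assumption|exfalso]. nra. }
  assert (L2 : (q * q <= p * p / 4)%R) by (rewrite <- Q2; nra).
  split; [exact P|]. split; [|lra].
  replace ((p * p - q * q) * p - (p * q + q * p) * q)%R with (p * (p * p - 3 * (q * q)))%R by ring.
  replace (p * p * p / 4)%R with (p * (p * p / 4))%R by field.
  apply Rmult_le_compat_l; lra.
Qed.

Lemma exp_le x y : (x <= y)%R -> (exp x <= exp y)%R.
Proof. intros [H| ->]; [left; now apply exp_increasing|lra]. Qed.

(* The sector has opening [pi/2], so [exp (- eps (w+1)^(3/2))] beats exponential growth
   while staying bounded by [1]. *)
Theorem phragmen_lindelof F A B M k : (0 < M)%R -> (0 <= B)%R ->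
  (forall w, (Rabs (snd w) <= fst w)%R -> holo F w) ->
  (forall w, (Rabs (snd w) <= fst w)%R -> (Cmod (F w) <= exp (A + B * Cmod w))%R) ->
  (forall w, Rabs (snd w) = fst w -> (Cmod (F w) <= M * Cmod (w + 1) ^ k)%R) ->
  forall w, (Rabs (snd w) <= fst w)%R -> (Cmod (F w) <= M * Cmod (w + 1) ^ k)%R.
Proof.
  intros HM HB Hh Hg Hb w Hw.
  assert (Hp : forall v, (Rabs (snd v) <= fst v)%R ->
    (Rabs (snd (v + 1)%C) <= fst (v + 1)%C)%R /\ (0 < fst (v + 1)%C)%R /\
    (1 <= Cmod (v + 1))%R /\ (Cmod v <= Cmod (v + 1))%R).
  { intros v Hv. assert (P := Rabs_pos (snd v)).
    assert (S1 := Cmod_sq v). assert (S2 := Cmod_sq (v + 1)).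
    assert (G1 := Cmod_ge_0 v). assert (G2 := Cmod_ge_0 (v + 1)).
    simpl in *. rewrite Rplus_0_r in *. repeat split; try lra.
    - assert (Q := fst_le_Cmod (v + 1)). simpl in Q. rewrite Rabs_pos_eq in Q; lra.
    - apply Rsqr_incr_0; auto. unfold Rsqr. nra. }
  set (c := fst (csqrt (w + 1) * csqrt (w + 1) * csqrt (w + 1))%C).
  assert (Hc : (0 < c)%R).
  { destruct (Hp w Hw) as [P1 [P2 _]]. destruct (csqrt_sector _ P1 P2) as [Q1 [Q2 _]].
    fold c in Q2. set (p := fst (csqrt (w + 1))) in *.
    assert (0 < p * p * p)%R by (repeat apply Rmult_lt_0_compat; lra). lra. }
  assert (L1 : (1 <= Cmod (w + 1))%R) by exact (proj1 (proj2 (proj2 (Hp w Hw)))).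
  assert (L0 : (0 < M * Cmod (w + 1) ^ k)%R) by (apply Rmult_lt_0_compat; [lra|apply pow_lt; lra]).
  assert (Key : forall e, (0 < e)%R -> (Cmod (F w) <= M * Cmod (w + 1) ^ k * exp (e * c))%R).
  { intros e He.
    set (H := fun v => F v * (/ (v + 1) ^ k * cexp (- RtoC e * (csqrt (v + 1) * csqrt (v + 1) * csqrt (v + 1))))).
    assert (HH : forall v, Cmod (v + 1) <> 0%R -> Cmod (H v) =
      (Cmod (F v) * (/ Cmod (v + 1) ^ k * exp (- e * fst (csqrt (v + 1) * csqrt (v + 1) * csqrt (v + 1))%C)))%R).
    { intros v Nv. unfold H. rewrite !Cmod_mult, Cmod_cexp.
      rewrite Cmod_inv by (apply Cpow_neq_0, Cmod_pos_neq; assert (Q := Cmod_ge_0 (v + 1)); lra).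
      rewrite Cmod_pow. do 3 f_equal. simpl. ring. }
    set (X := (5 * (Rabs A + B + Rabs (ln M)) / e)%R).
    assert (A0 := Rabs_pos A). assert (A1 := Rle_abs A). assert (M0 := Rabs_pos (ln M)).
    assert (M1 := Rabs_maj2 (ln M)).
    assert (X0 : (0 <= X)%R) by (apply Rdiv_le_0_compat; lra).
    set (R := Rmax (Cmod w) (Rmax 1 (2 * (X * X)))).
    assert (R1 : (Cmod w <= R)%R) by apply Rmax_l.
    assert (R2 : (1 <= R)%R) by (eapply Rle_trans; [apply Rmax_l|apply Rmax_r]).
    assert (R3 : (2 * (X * X) <= R)%R) by (eapply Rle_trans; [apply Rmax_r|apply Rmax_r]).
    assert (Hm : (Cmod (H w) <= M)%R).
    { apply (max_principle H (fun v => (Rabs (snd v) <= fst v /\ Cmod v <= R)%R) R); [|apply sector_closed| | |auto].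
      - intros v Hv. apply Hv.
      - intros v [Hv _]. destruct (Hp v Hv) as [P1 [P2 [P3 P4]]].
        assert (A11 : forall z, holo (fun v => v + 1) z) by (intros z; apply holo_plus; auto using holo_id, holo_const).
        assert (Hs : holo (fun v => csqrt (v + 1)) v).
        { apply (holo_comp csqrt (fun v => v + 1)); [now apply holo_csqrt|apply A11]. }
        apply holo_mult; [auto|]. apply holo_mult.
        + apply (holo_inv (fun v => (v + 1) ^ k)).
          * apply Cpow_neq_0, Cmod_pos_neq. lra.
          * apply (holo_pow (fun v => v + 1)), A11.
        + apply holo_cexp. apply holo_mult; [apply holo_const|].
          apply holo_mult; [|exact Hs]. now apply holo_mult.
      - intros v [Hv HvR]. destruct (Hp v Hv) as [P1 [P2 [P3 P4]]].
        destruct (csqrt_sector _ P1 P2) as [Q1 [Q2 Q3]]. cbv zeta in *.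
        rewrite HH by lra. set (s := csqrt (v + 1)) in *.
        assert (Pk : (1 <= Cmod (v + 1) ^ k)%R) by now apply pow_R1_Rle.
        assert (Ik : (0 < / Cmod (v + 1) ^ k <= 1)%R).
        { split; [apply Rinv_0_lt_compat; lra|]. apply Rle_trans with (/ 1)%R; [apply Rinv_le_contravar; lra|rewrite Rinv_1; lra]. }
        assert (S3 : (0 <= fst (s * s * s)%C)%R).
        { eapply Rle_trans; [|exact Q2]. assert (0 < fst s * fst s * fst s)%R; [|lra].
          apply Rmult_lt_0_compat; [apply Rmult_lt_0_compat|]; lra. }
        assert (Fv := Cmod_ge_0 (F v)).
        assert (E0 := exp_pos (- e * fst (s * s * s)%C)).
        assert (E1 : (exp (- e * fst (s * s * s)%C) <= 1)%R).
        { apply Rle_trans with (exp 0); [|rewrite exp_0; lra]. apply exp_le. assert (Q := Rmult_le_pos e _ ltac:(lra) S3). lra. }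
        destruct (Req_dec (Cmod v) R) as [ER|NR]; [right|].
        { assert (S1 : (4 * R <= 5 * (fst s * fst s))%R) by lra.
          assert (S2 : (X <= fst s)%R).
          { apply Rsqr_incr_0; [|exact X0|lra]. unfold Rsqr. lra. }
          assert (S4 : ((Rabs A + B + Rabs (ln M)) * R <= e * fst (s * s * s)%C)%R).
          { assert (T1 : (X * R / 5 <= fst (s * s * s)%C)%R).
            { eapply Rle_trans; [|exact Q2].
              replace (fst s * fst s * fst s / 4)%R with (fst s * (fst s * fst s / 4))%R by field.
              replace (X * R / 5)%R with (X * (R / 5))%R by field.
              apply Rmult_le_compat; lra. }
            replace ((Rabs A + B + Rabs (ln M)) * R)%R with (e * (X * R / 5))%R
              by (unfold X; field; lra).
            apply Rmult_le_compat_l; lra. }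
          assert (S5 : (Rabs A <= Rabs A * R)%R) by nra.
          assert (S6 : (Rabs (ln M) <= Rabs (ln M) * R)%R) by nra.
          apply Rle_trans with (exp (A + B * R) * (1 * exp (- e * fst (s * s * s)%C)))%R.
          - apply Rmult_le_compat; [exact Fv| |rewrite <- ER; now apply Hg|].
            + apply Rmult_le_pos; lra.
            + apply Rmult_le_compat_r; lra.
          - rewrite Rmult_1_l, <- exp_plus. rewrite <- (exp_ln M HM). apply exp_le. lra. }
        destruct (Req_dec (Rabs (snd v)) (fst v)) as [EB|NB]; [right|left].
        { specialize (Hb v EB). rewrite <- Rmult_assoc.
          assert (T1 : (Cmod (F v) * / Cmod (v + 1) ^ k <= M)%R).
          { apply Rmult_le_reg_r with (Cmod (v + 1) ^ k)%R; [lra|].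
            rewrite Rmult_assoc, Rinv_l, Rmult_1_r by lra. exact Hb. }
          assert (T0 : (0 <= Cmod (F v) * / Cmod (v + 1) ^ k)%R) by (apply Rmult_le_pos; lra).
          nra. }
        { exists (Rmin (R - Cmod v) ((fst v - Rabs (snd v)) / 2)). split; [apply Rmin_glb_lt; lra|].
          intros u Hu. assert (U1 := Rlt_le_trans _ _ _ Hu (Rmin_l _ _)).
          assert (U2 := Rlt_le_trans _ _ _ Hu (Rmin_r _ _)).
          assert (T := Cmod_triangle_minus u v).
          assert (T1 := fst_le_Cmod (u - v)). assert (T2 := snd_le_Cmod (u - v)).
          assert (T3 := Rabs_triang_inv (snd u) (snd v)).
          assert (T4 := Rabs_maj2 (fst (u - v)%C)). simpl in *. unfold Rminus in *. split; lra. } }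
    rewrite HH in Hm by lra. fold c in Hm.
    assert (Pk : (0 < Cmod (w + 1) ^ k)%R) by (apply pow_lt; lra).
    assert (E2 : (exp (- e * c) * exp (e * c) = 1)%R).
    { rewrite <- exp_plus. replace (- e * c + e * c)%R with 0%R by ring. apply exp_0. }
    replace (Cmod (F w)) with (Cmod (F w) * (/ Cmod (w + 1) ^ k * exp (- e * c)) * (Cmod (w + 1) ^ k * exp (e * c)))%R.
    - rewrite Rmult_assoc. rewrite (Rmult_assoc M). rewrite <- Rmult_assoc.
      apply Rmult_le_compat_r; [|exact Hm]. apply Rmult_le_pos; [lra|left; apply exp_pos].
    - transitivity (Cmod (F w) * (/ Cmod (w + 1) ^ k * Cmod (w + 1) ^ k) * (exp (- e * c) * exp (e * c)))%R; [ring|].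
      rewrite E2, Rinv_l by lra. ring. }
  apply Rnot_lt_le. intros N. set (L := (M * Cmod (w + 1) ^ k)%R) in *.
  assert (Q : (1 < Cmod (F w) / L)%R).
  { apply Rmult_lt_reg_r with L; [exact L0|]. unfold Rdiv. rewrite Rmult_assoc, Rinv_l by lra. lra. }
  assert (Q1 : (0 < ln (Cmod (F w) / L))%R) by (rewrite <- ln_1; apply ln_increasing; lra).
  specialize (Key (ln (Cmod (F w) / L) / (2 * c))%R).
  assert (Q2 : (0 < ln (Cmod (F w) / L) / (2 * c))%R) by (apply Rdiv_lt_0_compat; lra).
  specialize (Key Q2).
  replace (ln (Cmod (F w) / L) / (2 * c) * c)%R with (ln (Cmod (F w) / L) / 2)%R in Key by (field; lra).
  assert (Q3 : (exp (ln (Cmod (F w) / L) / 2) < Cmod (F w) / L)%R).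
  { rewrite <- (exp_ln (Cmod (F w) / L)) at 2 by lra. apply exp_increasing. lra. }
  assert (Q4 : (L * exp (ln (Cmod (F w) / L) / 2) < Cmod (F w))%R).
  { replace (Cmod (F w)) with (L * (Cmod (F w) / L))%R at 2 by (field; lra).
    apply Rmult_lt_compat_l; lra. }
  lra.
Qed.

Lemma Cmod_imag (t : R) : (0 <= t)%R -> Cmod (0%R, t) = t.
Proof.
  intros Ht. unfold Cmod. simpl. replace (0 * (0 * 1) + t * (t * 1))%R with (Rsqr t) by (unfold Rsqr; ring).
  now apply sqrt_Rsqr.
Qed.

Definition vanishes_up (G : C -> C) : Prop := forall e : R, (0 < e)%R ->
  exists t0 : R, forall t : R, (t0 <= t)%R -> (Cmod (G (0%R, t)) < e)%R.

Lemma const_vanishes_up (G : C -> C) c : vanishes_up G -> (forall z, G z = c) -> c = 0.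
Proof.
  intros H E. destruct (Ceq_dec c 0) as [|N]; [assumption|exfalso].
  destruct (H (Cmod c) (Cmod_pos c N)) as [t0 Ht]. specialize (Ht t0 (Rle_refl t0)).
  rewrite E in Ht. lra.
Qed.

Lemma liouville k : forall G K, entire G ->
  (forall z, (Cmod (G z) <= K * (1 + Cmod z) ^ k)%R) -> vanishes_up G -> forall z, G z = 0.
Proof.
  assert (Step : forall (G H : C -> C), (forall z, G z = G 0 + (z - 0) * H z) -> vanishes_up G ->
            (forall z, H z = 0) -> forall z, G z = 0).
  { intros G H E HG HH z.
    assert (Ec : forall z, G z = G 0) by (intros v; rewrite (E v), HH; ring).
    rewrite Ec. now apply (const_vanishes_up G). }
  induction k as [|k IH]; intros G K HG Hb Hv.
  - destruct (holo_quotient G 0 (HG 0)) as [H [HH E]].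
    apply (Step G H E Hv). intros z.
    assert (K0 : (0 <= K)%R).
    { eapply Rle_trans; [apply (Cmod_ge_0 (G 0))|]. specialize (Hb 0). simpl in Hb. lra. }
    apply Cmod_eq_0, Rle_antisym; [|apply Cmod_ge_0]. apply le_epsilon. intros e He. rewrite Rplus_0_l.
    set (R := (Cmod z + 2 * K / e + 1)%R).
    assert (Q0 := Cmod_ge_0 z). assert (Q1 : (0 <= 2 * K / e)%R) by (apply Rdiv_le_0_compat; lra).
    apply (max_principle_disc H 0 R); [auto| |].
    + intros v Hv'. assert (Ev : v - 0 = v) by ring. rewrite Ev in Hv'.
      assert (Nv : v <> 0) by (apply Cmod_pos_neq; unfold R in Hv'; lra).
      replace (H v) with ((G v - G 0) / v) by (rewrite (E v); field; exact Nv).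
      rewrite Cmod_div, Hv' by exact Nv.
      apply Rmult_le_reg_r with R; [unfold R; lra|]. unfold Rdiv.
      rewrite Rmult_assoc, Rinv_l, Rmult_1_r by (unfold R; lra).
      assert (T := Cmod_triangle (G v) (- G 0)). rewrite Cmod_opp in T.
      assert (B1 := Hb v). assert (B2 := Hb 0). simpl in B1, B2.
      apply Rle_trans with (2 * K)%R; [unfold Cminus; lra|].
      replace (2 * K)%R with (e * (2 * K / e))%R by (field; lra).
      apply Rmult_le_compat_l; unfold R; lra.
    + replace (z - 0) with z by ring. unfold R. lra.
  - destruct (holo_quotient G 0 (HG 0)) as [H [HH E]].
    apply (Step G H E Hv).
    assert (Q : forall z : C, z <> 0 -> H z = (G z - G 0) / z).
    { intros z Nz. rewrite (E z). field. exact Nz. }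
    set (g := Cmod (G 0)). assert (g0 : (0 <= g)%R) by apply Cmod_ge_0.
    assert (K0 : (0 <= K)%R).
    { eapply Rle_trans; [apply (Cmod_ge_0 (G 0))|]. specialize (Hb 0).
      rewrite Cmod_0, Rplus_0_r, pow1 in Hb. lra. }
    assert (B1 : forall z, (1 <= Cmod z)%R -> (Cmod (H z) <= 2 * (K + g) * (1 + Cmod z) ^ k)%R).
    { intros z Hz. assert (Nz : z <> 0) by (apply Cmod_pos_neq; lra).
      rewrite (Q z Nz), Cmod_div by exact Nz.
      apply Rmult_le_reg_r with (Cmod z); [lra|]. unfold Rdiv.
      rewrite (Rmult_assoc (Cmod _)), Rinv_l, Rmult_1_r by lra.
      assert (T := Cmod_triangle (G z) (- G 0)). rewrite Cmod_opp in T. fold g in T.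
      specialize (Hb z). simpl in Hb.
      assert (P : (1 <= (1 + Cmod z) ^ k)%R) by (apply pow_R1_Rle; lra).
      set (p := ((1 + Cmod z) ^ k)%R) in *.
      assert (J1 : (K * ((1 + Cmod z) * p) <= 2 * K * p * Cmod z)%R).
      { replace (2 * K * p * Cmod z)%R with (K * ((2 * Cmod z) * p))%R by ring.
        apply Rmult_le_compat_l; [exact K0|]. apply Rmult_le_compat_r; lra. }
      assert (J2 : (g <= 2 * g * p * Cmod z)%R).
      { replace (2 * g * p * Cmod z)%R with (g * (2 * (p * Cmod z)))%R by ring.
        assert (1 <= p * Cmod z)%R by nra. nra. }
      unfold Cminus. lra. }
    apply (IH H (2 * (K + g) * 2 ^ k)%R); [intros z; auto| |].
    + intros z. assert (P2 : (1 <= 2 ^ k)%R) by (apply pow_R1_Rle; lra).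
      assert (Q0 := Cmod_ge_0 z).
      assert (P1 : (1 <= (1 + Cmod z) ^ k)%R) by (apply pow_R1_Rle; lra).
      destruct (Rle_dec (Cmod z) 1) as [Hz|Hz].
      * apply Rle_trans with (2 * (K + g) * 2 ^ k)%R.
        -- apply (max_principle_disc H 0 1); [auto| |].
           ++ intros v Hv'. replace (v - 0) with v in Hv' by ring.
              eapply Rle_trans; [apply B1; lra|]. rewrite Hv'. right. reflexivity.
           ++ now replace (z - 0) with z by ring.
        -- assert (0 <= 2 * (K + g) * 2 ^ k)%R by (apply Rmult_le_pos; lra). nra.
      * eapply Rle_trans; [apply B1; lra|]. apply Rmult_le_compat_r; [lra|]. nra.
    + intros e He. destruct (Hv e He) as [t0 Ht0].
      exists (Rmax t0 (Rmax 2 (2 * g / e))). intros t Ht.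
      assert (T1 := Rle_trans _ _ _ (Rmax_l t0 (Rmax 2 (2 * g / e))) Ht).
      assert (T2 := Rle_trans _ _ _ (Rmax_r t0 (Rmax 2 (2 * g / e))) Ht).
      assert (T3 := Rle_trans _ _ _ (Rmax_l 2 (2 * g / e)) T2).
      assert (T4 := Rle_trans _ _ _ (Rmax_r 2 (2 * g / e)) T2).
      assert (Ct : Cmod (0%R, t) = t) by (apply Cmod_imag; lra).
      assert (Nz : ((0%R, t) : C) <> 0) by (apply Cmod_pos_neq; rewrite Ct; lra).
      rewrite (Q _ Nz), Cmod_div, Ct by exact Nz.
      specialize (Ht0 t T1). assert (T := Cmod_triangle (G (0%R, t)) (- G 0)).
      rewrite Cmod_opp in T. fold g in T.
      apply Rmult_lt_reg_r with t; [lra|]. unfold Rdiv. rewrite Rmult_assoc, Rinv_l, Rmult_1_r by lra.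
      assert (J : (2 * g <= e * t)%R).
      { replace (2 * g)%R with (e * (2 * g / e))%R by (field; lra). apply Rmult_le_compat_l; lra. }
      unfold Cminus. nra.
Qed.

Lemma quadrant_bound (G : C -> C) (A B M T : R) (k : nat) (u : C) : entire G -> (0 <= B)%R -> (0 < M)%R -> (0 <= T)%R ->
  u = (1, 1)%R \/ u = (- (1), 1)%R ->
  (forall z, (Cmod (G z) <= exp (A + B * Cmod z))%R) ->
  (forall z : C, (T <= snd z)%R -> (Cmod (G z) <= M)%R) ->
  (forall t : R, (1 <= t)%R -> (Cmod (G (0, - t)%R) <= M * t ^ k)%R) ->
  forall w : C, (Rabs (snd w) <= fst w)%R ->
  (Cmod (G ((0%R, T) + w / u)%C) <= (M + exp (Rabs A + B * (T + 1))) * Cmod (w + 1) ^ k)%R.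
Proof.
  intros HG HB HM HT Hu Hexp Hup Hneg.
  set (M' := (M + exp (Rabs A + B * (T + 1)))%R).
  assert (E0 := exp_pos (Rabs A + B * (T + 1))).
  assert (Nu : u <> 0) by (destruct Hu as [-> | ->]; intros E; injection E; lra).
  assert (CT := Cmod_imag T HT).
  assert (Cu : (1 <= Cmod u)%R).
  { destruct Hu as [-> | ->]; (eapply Rle_trans; [|apply snd_le_Cmod]); simpl;
      rewrite Rabs_pos_eq; lra. }
  apply (phragmen_lindelof (fun w => G ((0%R, T) + w / u)) (A + B * T) B M' k); [unfold M'; lra|exact HB| | |].
  - intros w _. apply (holo_comp G (fun w => (0%R, T) + w / u)); [apply HG|].
    apply holo_plus; [apply holo_const|]. apply holo_mult; auto using holo_id, holo_const.
  - intros w _. eapply Rle_trans; [apply Hexp|]. apply exp_le.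
    assert (Q : (Cmod ((0%R, T) + w / u) <= T + Cmod w)%R).
    { eapply Rle_trans; [apply Cmod_triangle|]. rewrite CT, Cmod_div by exact Nu.
      apply Rplus_le_compat_l. assert (W0 := Cmod_ge_0 w).
      apply Rmult_le_reg_r with (Cmod u); [lra|]. unfold Rdiv.
      rewrite Rmult_assoc, Rinv_l by lra. nra. }
    nra.
  - intros w Hw.
    assert (W1 : (1 <= Cmod (w + 1))%R /\ (fst w <= Cmod (w + 1))%R).
    { assert (P := Rabs_pos (snd w)). assert (Q := fst_le_Cmod (w + 1)). simpl in Q.
      rewrite Rabs_pos_eq in Q by lra. lra. }
    destruct W1 as [W1 W2]. assert (P := Rabs_pos (snd w)).
    assert (Pk : (1 <= Cmod (w + 1) ^ k)%R) by now apply pow_R1_Rle.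
    assert (Cases : (T <= snd ((0%R, T) + w / u)%C)%R \/ (0%R, T) + w / u = (0%R, (T - fst w)%R)).
    { destruct w as [p q]. simpl in Hw, P. unfold Rabs in Hw.
      destruct (Rcase_abs q); destruct Hu as [-> | ->]; simpl.
      - right. unfold Cdiv, Cinv, Cplus, Cmult. simpl. replace q with (- p)%R by lra. f_equal; field.
      - left. replace q with (- p)%R by lra.
        replace (T + (p * (- (1) / _) + _))%R with T by field. lra.
      - left. replace q with p by lra. 
        replace (T + _)%R with T by field. lra.
      - right. unfold Cdiv, Cinv, Cplus, Cmult. simpl. replace q with p by lra. f_equal; field. }
    destruct Cases as [C|C].
    + eapply Rle_trans; [apply Hup; exact C|]. unfold M'. nra.
    + rewrite C. destruct (Rle_dec (fst w) (T + 1)) as [L|L].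
      * eapply Rle_trans; [apply Hexp|].
        apply Rle_trans with (exp (Rabs A + B * (T + 1))).
        -- apply exp_le. apply Rplus_le_compat; [apply Rle_abs|]. apply Rmult_le_compat_l; [exact HB|].
           eapply Rle_trans; [apply Cmod_le_abs|]. simpl. rewrite Rabs_R0.
           unfold Rabs; destruct Rcase_abs; lra.
        -- unfold M'. nra.
      * replace (T - fst w)%R with (- (fst w - T))%R by ring.
        eapply Rle_trans; [apply Hneg; lra|]. apply Rmult_le_compat; [lra| | |].
        -- apply pow_le. lra.
        -- unfold M'. lra.
        -- apply pow_incr. lra.
Qed.

Theorem entire_zero_criterion (G : C -> C) (A B M T : R) (k : nat) : entire G -> (0 <= B)%R -> (0 < M)%R -> (0 <= T)%R ->
  (forall z, (Cmod (G z) <= exp (A + B * Cmod z))%R) ->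
  (forall z : C, (T <= snd z)%R -> (Cmod (G z) <= M)%R) ->
  (forall t : R, (1 <= t)%R -> (Cmod (G (0, - t)%R) <= M * t ^ k)%R) ->
  vanishes_up G -> forall z, G z = 0.
Proof.
  intros HG HB HM HT Hexp Hup Hneg Hv.
  set (M' := (M + exp (Rabs A + B * (T + 1)))%R).
  assert (E0 := exp_pos (Rabs A + B * (T + 1))).
  apply (liouville k G (M' * (3 + 2 * T) ^ k)%R HG); [|exact Hv].
  intros z. assert (Z0 := Cmod_ge_0 z).
  assert (P3 : (1 <= (3 + 2 * T) ^ k)%R) by (apply pow_R1_Rle; lra).
  assert (P4 : (1 <= (1 + Cmod z) ^ k)%R) by (apply pow_R1_Rle; lra).
  destruct (Rle_dec T (snd z)) as [L|L].
  { eapply Rle_trans; [apply Hup; exact L|]. unfold M'.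
    assert (1 <= (3 + 2 * T) ^ k * (1 + Cmod z) ^ k)%R by nra. nra. }
  assert (CT := Cmod_imag T HT).
  assert (Fin : forall u : C, u = (1, 1)%R \/ u = (- (1), 1)%R ->
    (Rabs (snd ((z - (0, T)%R) * u)%C) <= fst ((z - (0, T)%R) * u)%C)%R ->
    (Cmod (G z) <= M' * (3 + 2 * T) ^ k * (1 + Cmod z) ^ k)%R).
  { intros u Hu Hw.
    assert (Nu : u <> 0) by (destruct Hu as [-> | ->]; intros E; injection E; lra).
    assert (Q := quadrant_bound G A B M T k u HG HB HM HT Hu Hexp Hup Hneg _ Hw).
    replace ((0%R, T) + (z - (0%R, T)) * u / u) with z in Q by (field; exact Nu).
    eapply Rle_trans; [exact Q|]. fold M'. rewrite Rmult_assoc.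
    apply Rmult_le_compat_l; [unfold M'; lra|]. rewrite <- Rpow_mult_distr.
    apply pow_incr. split; [apply Cmod_ge_0|].
    eapply Rle_trans; [apply Cmod_triangle|]. rewrite Cmod_1, Cmod_mult.
    assert (Cu : (Cmod u <= 2)%R).
    { eapply Rle_trans; [apply Cmod_le_abs|]. destruct Hu as [-> | ->]; simpl;
        unfold Rabs; repeat destruct Rcase_abs; lra. }
    assert (Cz : (Cmod (z - (0%R, T)) <= Cmod z + T)%R).
    { eapply Rle_trans; [apply Cmod_triangle|]. rewrite Cmod_opp, CT. lra. }
    assert (Q1 := Cmod_ge_0 u). assert (Q2 := Cmod_ge_0 (z - (0%R, T))). nra. }
  destruct (Rle_dec 0 (fst z)) as [X|X].
  - apply (Fin (1, 1)%R); [now left|]. destruct z as [x y]. simpl in *.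
    unfold Rabs; destruct Rcase_abs; lra.
  - apply (Fin (- (1), 1)%R); [now right|]. destruct z as [x y]. simpl in *.
    unfold Rabs; destruct Rcase_abs; lra.
Qed.

(** * Lower bound on the negative imaginary axis *)

(* What is kept of the asymptotics [g ~ D x^be] at [0]: near [0] the values of [g] lie
   in a fixed sector and do not vanish faster than a power. *)
Definition power_like (g : R -> C) : Prop :=
  exists (d c : R) (k : nat) (om : C), (0 < d)%R /\ (0 < c)%R /\ Cmod om = 1%R /\
    forall t, (0 < t < d)%R -> (3 / 5 * Cmod (g t) <= fst (om * g t)%C)%R /\ (c * t ^ k <= Cmod (g t))%R.

Lemma exp_beats_pow (d C c : R) (k : nat) : (0 < d)%R -> (0 < c)%R ->
  exists t0 : R, (1 <= t0)%R /\ forall t, (t0 <= t)%R -> (C * t ^ k <= c * exp (d * t))%R.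
Proof.
  intros Hd Hc. set (n := S k). assert (Hn : (0 < INR n)%R) by (apply lt_0_INR; unfold n; lia).
  set (q := (c * (d / INR n) ^ n)%R).
  assert (Hq : (0 < q)%R) by (apply Rmult_lt_0_compat; [exact Hc|apply pow_lt, Rdiv_lt_0_compat; lra]).
  exists (Rmax 1 (C / q)). split; [apply Rmax_l|]. intros t Ht.
  assert (T1 := Rle_trans _ _ _ (Rmax_l _ _) Ht). assert (T2 := Rle_trans _ _ _ (Rmax_r _ _) Ht).
  assert (E : ((d / INR n * t) ^ n <= exp (d * t))%R).
  { replace (d * t)%R with (INR n * (d / INR n * t))%R by (field; lra).
    rewrite exp_INR_mult. apply pow_incr. split.
    - apply Rmult_le_pos; [apply Rdiv_le_0_compat|]; lra.
    - assert (Q := exp_ineq1_le (d / INR n * t)). lra. }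
  apply Rle_trans with (c * (d / INR n * t) ^ n)%R; [|apply Rmult_le_compat_l; lra].
  rewrite Rpow_mult_distr, <- Rmult_assoc. fold q. unfold n. simpl.
  rewrite <- Rmult_assoc. apply Rmult_le_compat_r; [apply pow_le; lra|].
  replace C with (q * (C / q))%R by (field; lra). apply Rmult_le_compat_l; lra.
Qed.

Lemma is_derive_primitive (g : R -> R) x : (forall t, continuous g t) ->
  is_derive (fun x => RInt g 0 x) x (g x).
Proof.
  intros Hg. apply (is_derive_RInt g (fun x => RInt g 0 x) 0 x); [|apply Hg].
  apply filter_forall. intros y. apply (RInt_correct (V := R_CompleteNormedModule)).
  apply (ex_RInt_continuous (V := R_CompleteNormedModule)). auto.
Qed.

Lemma continuous_Rmult (f g : R -> R) x : continuous f x -> continuous g x ->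
  continuous (fun t => f t * g t)%R x.
Proof. intros Hf Hg. exact (continuous_mult (K := R_AbsRing) f g x Hf Hg). Qed.

Definition laplace (g : R -> C) (s : R) : C := CI (fun t => RtoC (exp (- s * t)) * g t) PI.
Definition laplace_abs (g : R -> C) (s : R) : R :=
  RInt (fun t => exp (- s * t) * Cmod (g t))%R 0 PI.

Lemma ccont_RtoC (f : R -> R) x : continuous f x -> ccont (fun t => RtoC (f t)) x.
Proof. intros H. split; simpl; [exact H|apply continuous_const]. Qed.

Lemma laplace_lower (g : R -> C) : (forall x, ccont g x) -> power_like g ->
  exists (c : R) (k : nat) (t0 : R), (0 < c)%R /\ (1 <= t0)%R /\ forall s, (t0 <= s)%R ->
    (c <= Cmod (laplace g s) * s ^ k)%R /\ (laplace_abs g s <= 2 * Cmod (laplace g s))%R.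
Proof.
  intros Hg [d [c [k [om [Hd [Hc [Hom Hst]]]]]]].
  destruct (ccont_bounded g PI Hg) as [B [B0 HB]].
  assert (PI0 := PI_RGT_0).
  set (c1 := (c * (/ 2) ^ k * exp (-1) / 2)%R).
  assert (Hc1 : (0 < c1)%R).
  { unfold c1. assert (P1 := exp_pos (-1)). assert (P2 : (0 < (/ 2) ^ k)%R) by (apply pow_lt; lra).
    apply Rdiv_lt_0_compat; [|lra]. repeat apply Rmult_lt_0_compat; auto. }
  destruct (exp_beats_pow d (2 * B * PI) (c1 / 10) (S k) Hd ltac:(lra)) as [t1 [Ht1 Hexp]].
  set (t0 := Rmax t1 (Rmax (2 / d) 1)).
  exists (c1 / 2)%R, (S k), t0. split; [lra|].
  assert (T1 : (t1 <= t0)%R) by apply Rmax_l.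
  assert (T2 : (2 / d <= t0)%R) by (eapply Rle_trans; [apply Rmax_l|apply Rmax_r]).
  split; [lra|]. intros s Hs.
  assert (Ce : forall x, continuous (fun t => exp (- s * t)) x) by (intros x; apply continuous_exp_scal).
  assert (Cg : forall x, continuous (fun t => exp (- s * t) * Cmod (g t))%R x).
  { intros x. apply continuous_Rmult; [apply Ce|now apply ccont_Cmod]. }
  set (J := fun x => RInt (fun t => exp (- s * t) * Cmod (g t))%R 0 x).
  assert (DJ : forall x, is_derive J x (exp (- s * x) * Cmod (g x))%R).
  { intros x. exact (is_derive_primitive (fun t => exp (- s * t) * Cmod (g t))%R x Cg). }
  assert (CJ : forall x, continuous J x) by (intros x; eapply is_derive_continuous_R, DJ).
  set (F := fun x => fst (om * CI (fun t => RtoC (exp (- s * t)) * g t) x)).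
  assert (CF : forall x, ccont (fun t => RtoC (exp (- s * t)) * g t) x).
  { intros x. apply ccont_mult; [apply ccont_RtoC, Ce|apply Hg]. }
  assert (DF : forall x, is_derive F x (exp (- s * x) * fst (om * g x)%C)%R).
  { intros x. assert (D := cderiv_scal om _ x _ (cderiv_CI _ x CF)). destruct D as [D _].
    unfold F. evar_last; [exact D|]. simpl. ring. }
  (* The excess [Re (om I) - 3/5 J] can only decrease on [[d, PI]], where the weight is small. *)
  assert (Dec : (3 / 5 * J PI - F PI <= 2 * B * PI * exp (- s * d))%R).
  { assert (Q : ((3 / 5 * J PI - F PI) - (3 / 5 * J 0 - F 0) <= 2 * B * exp (- s * d) * (PI - 0))%R).
    { apply (mean_value_le (fun x => 3 / 5 * J x - F x)%R).
      - intros t. apply (continuous_minus (V := R_NormedModule) (fun x => 3 / 5 * J x)%R F).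
        + apply continuous_Rmult; [apply continuous_const|apply CJ].
        + eapply is_derive_continuous_R, DF.
      - lra.
      - intros t Ht. exists (3 / 5 * (exp (- s * t) * Cmod (g t)) - exp (- s * t) * fst (om * g t)%C)%R. split.
        + apply (is_derive_minus (fun x => 3 / 5 * J x)%R F); [|apply DF].
          apply (is_derive_scal J t (3 / 5)%R), DJ.
        + assert (E0 := exp_pos (- s * t)). assert (E1 := exp_pos (- s * d)).
          destruct (Rlt_dec t d) as [L|L].
          * destruct (Hst t ltac:(lra)) as [S1 _].
            assert (0 <= 2 * B * exp (- s * d))%R by nra. nra.
          * assert (E2 : (exp (- s * t) <= exp (- s * d))%R) by (apply exp_le; nra).
            assert (Q1 := fst_le_Cmod (om * g t)). rewrite Cmod_mult, Hom, Rmult_1_l in Q1.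
            assert (Q2 := Rabs_maj2 (fst (om * g t)%C)).
            specialize (HB t ltac:(lra)). assert (G0 := Cmod_ge_0 (g t)).
            apply Rle_trans with (exp (- s * t) * (2 * B))%R; [|nra].
            replace (3 / 5 * (exp (- s * t) * Cmod (g t)) - exp (- s * t) * fst (om * g t)%C)%R
              with (exp (- s * t) * (3 / 5 * Cmod (g t) - fst (om * g t)%C))%R by ring.
            apply Rmult_le_compat_l; lra. }
    assert (Z1 : J 0%R = 0%R) by (unfold J; now rewrite RInt_point).
    assert (Z2 : F 0%R = 0%R) by (unfold F; rewrite CI_0; simpl; ring).
    rewrite Z1, Z2 in Q. lra. }
  assert (FI : (F PI <= Cmod (laplace g s))%R).
  { unfold F. fold (laplace g s). eapply Rle_trans; [apply Rle_abs|].
    eapply Rle_trans; [apply fst_le_Cmod|]. rewrite Cmod_mult, Hom. lra. }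
  assert (Hs1 : (1 <= s)%R) by lra.
  assert (Low : (c1 / s ^ S k <= J PI)%R).
  { assert (Is : (0 < / s)%R) by (apply Rinv_0_lt_compat; lra).
    assert (Sd : (/ s < d)%R).
    { apply Rle_lt_trans with (d / 2)%R; [|lra].
      replace (d / 2)%R with (/ (2 / d))%R by (field; lra). apply Rinv_le_contravar; [|lra].
      apply Rdiv_lt_0_compat; lra. }
    assert (Sp : (/ s <= PI)%R).
    { apply Rle_trans with 1%R; [rewrite <- Rinv_1; apply Rinv_le_contravar; lra|].
      assert (Q := PI2_1). lra. }
    assert (Mono : forall u v, (0 <= u <= v)%R -> (J u <= J v)%R).
    { intros u v Huv. assert (Q : (- J v - - J u <= 0 * (v - u))%R); [|lra].
      apply (mean_value_le (fun x => - J x)%R).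
      - intros t. now apply (continuous_opp (V := R_NormedModule) J).
      - lra.
      - intros t Ht. eexists. split; [apply (is_derive_opp J), DJ|].
        unfold opp; simpl. assert (E0 := exp_pos (- s * t)). assert (G0 := Cmod_ge_0 (g t)). nra. }
    assert (Q : (- J (/ s) - - J (/ s / 2) <= - (c * (/ 2 * / s) ^ k * exp (-1)) * (/ s - / s / 2))%R).
    { apply (mean_value_le (fun x => - J x)%R).
      - intros t. now apply (continuous_opp (V := R_NormedModule) J).
      - lra.
      - intros t Ht. eexists. split; [apply (is_derive_opp J), DJ|].
        unfold opp; simpl. destruct (Hst t ltac:(lra)) as [_ S2].
        assert (P1 : ((/ 2 * / s) ^ k <= t ^ k)%R) by (apply pow_incr; lra).
        assert (P2 : (exp (-1) <= exp (- s * t))%R).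
        { apply exp_le. assert (s * t <= 1)%R; [|lra].
          replace 1%R with (s * / s)%R by (field; lra). apply Rmult_le_compat_l; lra. }
        assert (P3 := exp_pos (-1)).
        assert (P4 : (0 <= (/ 2 * / s) ^ k)%R) by (apply pow_le; lra).
        assert (P5 : (c * (/ 2 * / s) ^ k <= Cmod (g t))%R) by nra.
        assert (P6 : (0 <= c * (/ 2 * / s) ^ k)%R) by nra.
        assert (c * (/ 2 * / s) ^ k * exp (-1) <= Cmod (g t) * exp (- s * t))%R by (apply Rmult_le_compat; lra).
        lra. }
    assert (M1 := Mono (/ s)%R PI ltac:(lra)). assert (M2 := Mono 0%R (/ s / 2)%R ltac:(lra)).
    assert (Z1 : J 0%R = 0%R) by (unfold J; now rewrite RInt_point).
    replace (c1 / s ^ S k)%R with (c * (/ 2 * / s) ^ k * exp (-1) * (/ s - / s / 2))%R; [lra|].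
    unfold c1. rewrite Rpow_mult_distr, !pow_inv. simpl. field.
    repeat split; try apply pow_nonzero; lra. }
  assert (Ps : (0 < s ^ S k)%R) by (apply pow_lt; lra).
  assert (Tail : (2 * B * PI * exp (- s * d) <= c1 / s ^ S k / 10)%R).
  { specialize (Hexp s ltac:(lra)).
    assert (E : (exp (d * s) * exp (- s * d) = 1)%R).
    { rewrite <- exp_plus. replace (d * s + - s * d)%R with 0%R by ring. apply exp_0. }
    apply Rmult_le_reg_r with (s ^ S k)%R; [exact Ps|].
    replace (c1 / s ^ S k / 10 * s ^ S k)%R with (c1 / 10 * (exp (d * s) * exp (- s * d)))%R
      by (rewrite E; field; lra).
    assert (E0 := exp_pos (- s * d)). rewrite <- (Rmult_assoc (c1 / 10)).
    replace (2 * B * PI * exp (- s * d) * s ^ S k)%R with (2 * B * PI * s ^ S k * exp (- s * d))%R by ring.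
    apply Rmult_le_compat_r; lra. }
  assert (J0 : (J PI / 2 <= Cmod (laplace g s))%R).
  { lra. }
  split; [|unfold laplace_abs; fold (J PI); lra].
  apply Rmult_le_reg_r with (/ s ^ S k)%R; [now apply Rinv_0_lt_compat|].
  rewrite Rmult_assoc, Rinv_r, Rmult_1_r by lra. lra.
Qed.

Lemma RInt_reflect (f : R -> R) : (forall x, continuous f x) ->
  RInt (fun t => f (PI - t)%R) 0 PI = RInt f 0 PI.
Proof.
  intros Hf.
  assert (E : forall u v, ex_RInt f u v).
  { intros u v. apply (ex_RInt_continuous (V := R_CompleteNormedModule)). auto. }
  assert (Q := RInt_comp_lin f (-1) PI 0 PI (E _ _)).
  replace (-1 * 0 + PI)%R with PI in Q by ring. replace (-1 * PI + PI)%R with 0%R in Q by ring.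
  rewrite <- (opp_RInt_swap f 0 PI) in Q by apply E.
  rewrite RInt_scal in Q.
  - unfold scal, opp in Q; simpl in Q. unfold mult in Q; simpl in Q.
    rewrite <- (RInt_ext (fun y => f (-1 * y + PI)%R)); [lra|].
    intros x _. f_equal. ring.
  - apply (ex_RInt_continuous (V := R_CompleteNormedModule)). intros t _.
    apply (continuous_comp (fun y => (-1 * y + PI)%R) f); [|apply Hf].
    apply (is_derive_continuous_R _ t (-1)%R). auto_derive; [exact I|ring].
Qed.

Lemma CI_reflect (f : R -> C) : (forall x, ccont f x) -> CI (fun t => f (PI - t)%R) PI = CI f PI.
Proof.
  intros Hf. unfold CI. f_equal.
  - apply (RInt_reflect (fun t => fst (f t))). intros x. exact (proj1 (Hf x)).
  - apply (RInt_reflect (fun t => snd (f t))). intros x. exact (proj2 (Hf x)).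
Qed.

Lemma CI_scal c f x : (forall t, ccont f t) -> (0 <= x)%R -> CI (fun t => c * f t) x = c * CI f x.
Proof.
  intros Hf Hx.
  assert (Q := cderiv_FTC (fun x => c * CI f x) (fun t => c * f t) x).
  simpl in Q. rewrite Q; auto.
  - rewrite CI_0. ring.
  - intros t. apply ccont_mult; [apply ccont_const|]. eapply cderiv_ccont, cderiv_CI, Hf.
  - intros t. apply ccont_mult; [apply ccont_const|apply Hf].
  - intros t _. apply cderiv_scal. now apply cderiv_CI.
Qed.

Lemma CI_ext f g x : (forall t, f t = g t) -> CI f x = CI g x.
Proof. intros E. unfold CI. f_equal; apply RInt_ext; intros t _; now rewrite E. Qed.

Lemma RtoC_exp_plus u v : RtoC (exp (u + v)) = RtoC (exp u) * RtoC (exp v).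
Proof. now rewrite exp_plus, RtoC_mult. Qed.

Lemma continuous_reflect x : continuous (fun t => PI - t)%R x.
Proof. apply (is_derive_continuous_R _ x (-1)%R). auto_derive; [exact I|ring]. Qed.

Lemma laplace_reflect a s : (forall x, ccont a x) ->
  laplace (fun t => a (PI - t)%R) s = RtoC (exp (- s * PI)) * CI (fun t => RtoC (exp (s * t)) * a t) PI.
Proof.
  intros Ha.
  assert (C1 : forall x, ccont (fun t => RtoC (exp (s * t)) * a t) x).
  { intros x. apply ccont_mult; [apply ccont_RtoC, continuous_exp_scal|apply Ha]. }
  rewrite <- CI_scal, <- CI_reflect; [| |exact C1|left; apply PI_RGT_0].
  - unfold laplace. apply CI_ext. intros t. rewrite Cmult_assoc, <- RtoC_exp_plus. do 3 f_equal. ring.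
  - intros x. apply ccont_mult; [apply ccont_const|apply C1].
Qed.

Lemma laplace_abs_reflect a s : (forall x, ccont a x) ->
  laplace_abs (fun t => a (PI - t)%R) s = (exp (- s * PI) * RInt (fun t => exp (s * t) * Cmod (a t)) 0 PI)%R.
Proof.
  intros Ha.
  assert (C1 : forall x, continuous (fun t => exp (s * t) * Cmod (a t))%R x).
  { intros x. apply continuous_Rmult; [apply continuous_exp_scal|now apply ccont_Cmod]. }
  change (exp (- s * PI) * RInt (fun t => exp (s * t) * Cmod (a t)) 0 PI)%R with
    (scal (exp (- s * PI)) (RInt (V := R_CompleteNormedModule) (fun t => exp (s * t) * Cmod (a t))%R 0 PI)).
  rewrite <- RInt_scal by (apply (ex_RInt_continuous (V := R_CompleteNormedModule)); auto).
  rewrite <- RInt_reflect.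
  - unfold laplace_abs. apply RInt_ext. intros t _. unfold scal; simpl; unfold mult; simpl.
    rewrite <- Rmult_assoc, <- exp_plus. do 2 f_equal. ring.
  - intros x. apply continuous_Rmult; [apply continuous_const|apply C1].
Qed.

Lemma cderiv_exp_scal (k x : R) : cderiv (fun t => RtoC (exp (k * t))) x (RtoC k * RtoC (exp (k * x))).
Proof.
  rewrite <- RtoC_mult. split; simpl; [apply is_derive_exp_scal|apply (is_derive_const (K := R_AbsRing) (V := R_NormedModule))].
Qed.

(* To leading order [phi (PI, - i s)] is the product of the Laplace transforms of [b] at [0]
   and of [a] at [PI], neither of which decays faster than a power of [s]. *)
Theorem phi_lower_bound a b : (forall x, ccont a x) -> (forall x, ccont b x) ->
  power_like b -> power_like (fun t => a (PI - t)%R) ->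
  exists (c : R) (k : nat) (t0 : R), (0 < c)%R /\ (1 <= t0)%R /\ forall s, (t0 <= s)%R ->
    forall y w, system a b (0%R, (- s)%R) y w -> y 0%R = 1 -> w 0%R = 0 ->
    (c <= Cmod (y PI) * s ^ k)%R.
Proof.
  intros Ha Hb Pb Pa.
  assert (Ha' : forall x, ccont (fun t => a (PI - t)%R) x).
  { intros x. apply (ccont_comp a (fun t => PI - t)%R); [apply Ha|apply continuous_reflect]. }
  destruct (laplace_lower b Hb Pb) as [cb [kb [tb [Hcb [Htb Lb]]]]].
  destruct (laplace_lower _ Ha' Pa) as [ca [ka [ta [Hca [Hta La]]]]].
  destruct (seg_bound a b Ha Hb) as [A [A0 HA]]. assert (PI0 := PI_RGT_0).
  set (C1 := (16 * PI * A * A)%R). assert (HC1 : (0 <= C1)%R) by (unfold C1; nra).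
  set (C2 := (1 + 4 * A * A * PI)%R). assert (HC2 : (0 <= C2)%R) by (unfold C2; nra).
  destruct (exp_beats_pow PI C2 (ca * cb / 4) (ka + kb)%nat PI0) as [te [Hte He]].
  { apply Rdiv_lt_0_compat; [now apply Rmult_lt_0_compat|lra]. }
  set (t0 := (ta + tb + te + 16 * C1 + 4 * PI * A * A)%R).
  exists (ca * cb / 4)%R, (ka + kb)%nat, t0. split.
  { apply Rdiv_lt_0_compat; [now apply Rmult_lt_0_compat|lra]. }
  assert (T0 : (0 <= 4 * PI * A * A)%R) by nra.
  split; [unfold t0; lra|]. intros s Hs y w [Hc Hd] Y0 W0.
  assert (Hs1 : (1 <= s)%R) by (unfold t0 in Hs; lra).
  destruct (Lb s ltac:(unfold t0 in Hs; lra)) as [Lb1 Lb2].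
  destruct (La s ltac:(unfold t0 in Hs; lra)) as [La1 La2].
  specialize (He s ltac:(unfold t0 in Hs; lra)). clear Lb La.
  set (Ib := laplace b s) in *. set (Jb := laplace_abs b s) in *.
  set (Ia := laplace (fun t => a (PI - t)%R) s) in *. set (Ja := laplace_abs (fun t => a (PI - t)%R) s) in *.
  assert (Ez : - (Ci * (0%R, (- s)%R)) = RtoC (- s)).
  { unfold Ci, Cmult, Copp, RtoC. simpl. f_equal; ring. }
  assert (Cy : forall x, ccont y x) by (intros x; exact (proj1 (Hc x))).
  assert (Cw : forall x, ccont w x) by (intros x; exact (proj2 (Hc x))).
  assert (Dy : forall x, (0 < x < PI)%R -> cderiv y x (RtoC (- s) * y x + a x * w x)).
  { intros x Hx. destruct (Hd x Hx) as [D _]. rewrite Ez in D. eapply cderiv_eq; [exact D|]. ring. }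
  assert (Dw : forall x, (0 < x < PI)%R -> cderiv w x (b x * y x)) by (intros x Hx; apply (Hd x Hx)).
  assert (Cm : forall x, ccont (fun t => RtoC (exp (- s * t))) x).
  { intros x. apply ccont_RtoC, continuous_exp_scal. }
  assert (Cp : forall x, ccont (fun t => RtoC (exp (s * t))) x).
  { intros x. apply ccont_RtoC, continuous_exp_scal. }
  destruct (continuity_ab_maj (fun t => Cmod (w t)) 0 PI ltac:(lra)) as [xm [Hm Hxm]].
  { intros t _. now apply continuous_continuity_pt, ccont_Cmod. }
  set (m := Cmod (w xm)) in *. assert (m0 : (0 <= m)%R) by apply Cmod_ge_0.
  set (e := fun x => y x - RtoC (exp (- s * x))).
  assert (Ce : forall x, ccont e x) by (intros x; apply ccont_minus; auto).
  assert (De : forall x, (0 < x < PI)%R -> cderiv e x (RtoC (- s) * e x + a x * w x)).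
  { intros x Hx. eapply cderiv_eq; [apply cderiv_minus; [now apply Dy|apply cderiv_exp_scal]|].
    unfold e. ring. }
  assert (E0 : e 0%R = 0).
  { unfold e. rewrite Y0, Rmult_0_r, exp_0. ring. }
  assert (Be : forall x, (0 <= x <= PI)%R -> (Cmod (e x) <= A * m / s)%R).
  { intros x Hx. apply (damped_bound a (0%R, (- s)%R) e w A m s); auto; simpl; try lra.
    - intros t Ht. rewrite Ez. now apply De.
    - intros t Ht. split; [apply (HA t Ht)|now apply Hm]. }
  set (w0 := CI (fun t => RtoC (exp (- s * t)) * b t)).
  assert (Cb : forall x, ccont (fun t => RtoC (exp (- s * t)) * b t) x) by (intros x; apply ccont_mult; auto).
  assert (Dw0 : forall x, cderiv w0 x (RtoC (exp (- s * x)) * b x)).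
  { intros x. exact (cderiv_CI _ x Cb). }
  assert (Cw0 : forall x, ccont w0 x) by (intros x; eapply cderiv_ccont, Dw0).
  assert (Bw0 : forall x, (0 <= x <= PI)%R -> (Cmod (w x - w0 x) <= 2 * (A * (A * m / s) * PI))%R).
  { intros x Hx.
    assert (Q : (Cmod ((w x - w0 x) - (w 0%R - w0 0%R)) <= 2 * (A * (A * m / s) * x))%R).
    { apply (cderiv_bounded (fun x => w x - w0 x) (fun x => b x * y x - RtoC (exp (- s * x)) * b x)); [|lra|].
      - intros t. apply ccont_minus; auto.
      - intros t Ht. split; [apply cderiv_minus; [apply Dw; lra|apply Dw0]|].
        replace (b t * y t - RtoC (exp (- s * t)) * b t) with (b t * e t) by (unfold e; ring).
        rewrite Cmod_mult. apply Rmult_le_compat; try apply Cmod_ge_0; [apply HA; lra|apply Be; lra]. }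
    unfold w0 in Q at 2. rewrite W0, CI_0 in Q.
    replace (w x - w0 x - (0 - 0)) with (w x - w0 x) in Q by ring.
    eapply Rle_trans; [exact Q|]. apply Rmult_le_compat_l; [lra|]. apply Rmult_le_compat_l; [|lra].
    apply Rmult_le_pos; [lra|]. apply Rdiv_le_0_compat; nra. }
  set (Jx := fun x => RInt (fun t => exp (- s * t) * Cmod (b t))%R 0 x).
  assert (CJb : forall x, continuous (fun t => exp (- s * t) * Cmod (b t))%R x).
  { intros x. apply continuous_Rmult; [apply continuous_exp_scal|now apply ccont_Cmod]. }
  assert (DJ : forall x, is_derive Jx x (exp (- s * x) * Cmod (b x))%R).
  { intros x. exact (is_derive_primitive _ x CJb). }
  assert (J00 : Jx 0%R = 0%R) by (unfold Jx; now rewrite RInt_point).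
  assert (JxJ : forall x, (0 <= x <= PI)%R -> (Jx x <= Jb)%R).
  { intros x Hx. assert (Q : (- Jx PI - - Jx x <= 0 * (PI - x))%R).
    { apply (mean_value_le (fun x => - Jx x)%R).
      - intros t. apply (continuous_opp (V := R_NormedModule) Jx). eapply is_derive_continuous_R, DJ.
      - lra.
      - intros t Ht. eexists. split; [apply (is_derive_opp Jx), DJ|].
        unfold opp; simpl. assert (X := exp_pos (- s * t)). assert (G0 := Cmod_ge_0 (b t)). nra. }
    unfold Jb, laplace_abs. fold (Jx PI). lra. }
  assert (Mw0 : forall x, (0 <= x <= PI)%R -> (Cmod (w0 x) <= 2 * Jb)%R).
  { intros x Hx.
    assert (Q : (Cmod (w0 x - w0 0%R) <= 2 * (Jx x - Jx 0))%R).
    { apply (cderiv_majorant w0 (fun t => RtoC (exp (- s * t)) * b t) Jx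
        (fun t => exp (- s * t) * Cmod (b t))%R); auto; [lra|].
      intros t Ht. split; [apply Dw0|]. rewrite Cmod_mult, Cmod_R, Rabs_pos_eq; [lra|left; apply exp_pos]. }
    unfold w0 in Q at 2. rewrite CI_0, J00 in Q. replace (w0 x - 0) with (w0 x) in Q by ring.
    specialize (JxJ x Hx). lra. }
  assert (Bm : (m <= 4 * Jb)%R).
  { assert (Q1 := Bw0 xm Hxm). assert (Q2 := Mw0 xm Hxm).
    assert (T := Cmod_triangle_minus (w xm) (w0 xm)). fold m in T.
    assert (Q3 : (2 * (A * (A * m / s) * PI) <= m / 2)%R).
    { replace (2 * (A * (A * m / s) * PI))%R with ((4 * PI * A * A) * (m / (2 * s)))%R by (field; lra).
      apply Rle_trans with (s * (m / (2 * s)))%R; [|right; field; lra].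
      apply Rmult_le_compat_r; [apply Rdiv_le_0_compat; lra|]. unfold t0 in Hs; lra. }
    lra. }
  assert (Jb0 : (0 <= Jb)%R) by lra.
  assert (D1 : forall x, (0 <= x <= PI)%R -> (Cmod (w x - w0 x) <= C1 / 2 * Jb / s)%R).
  { intros x Hx. eapply Rle_trans; [apply (Bw0 x Hx)|]. unfold C1.
    replace (2 * (A * (A * m / s) * PI))%R with (m * (2 * PI * A * A / s))%R by (field; lra).
    replace (16 * PI * A * A / 2 * Jb / s)%R with (4 * Jb * (2 * PI * A * A / s))%R by (field; lra).
    apply Rmult_le_compat_r; [apply Rdiv_le_0_compat; nra|exact Bm]. }
  assert (D2 : forall x, (0 <= x <= PI)%R -> (Cmod (w0 x - Ib) <= 2 * A * exp (- s * x) / s)%R).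
  { intros x Hx.
    assert (Q : (Cmod (w0 PI - w0 x) <= 2 * ((- (A / s) * exp (- s * PI)) - (- (A / s) * exp (- s * x))))%R).
    { apply (cderiv_majorant w0 (fun t => RtoC (exp (- s * t)) * b t) (fun t => - (A / s) * exp (- s * t))%R
        (fun t => A * exp (- s * t))%R); auto; [lra| |].
      - intros t. auto_derive; [exact I|]. field. lra.
      - intros t Ht. split; [apply Dw0|].
        assert (X := exp_pos (- s * t)).
        rewrite Cmod_mult, Cmod_R, Rabs_pos_eq by lra.
        rewrite (Rmult_comm A). apply Rmult_le_compat_l; [lra|]. apply HA; lra. }
    rewrite Cmod_minus_sym. unfold Ib, laplace. fold w0.
    assert (X := exp_pos (- s * PI)). assert (As : (0 <= A / s)%R) by (apply Rdiv_le_0_compat; lra).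
    assert (0 <= A / s * exp (- s * PI))%R by nra.
    replace (2 * A * exp (- s * x) / s)%R with (2 * (A / s * exp (- s * x)))%R by (field; lra). lra. }
  set (Ka := fun x => RInt (fun t => exp (s * t) * Cmod (a t))%R 0 x).
  assert (CKa : forall x, continuous (fun t => exp (s * t) * Cmod (a t))%R x).
  { intros x. apply continuous_Rmult; [apply continuous_exp_scal|now apply ccont_Cmod]. }
  assert (DK : forall x, is_derive Ka x (exp (s * x) * Cmod (a x))%R).
  { intros x. exact (is_derive_primitive _ x CKa). }
  assert (K00 : Ka 0%R = 0%R) by (unfold Ka; now rewrite RInt_point).
  assert (Ca : forall x, ccont (fun t => RtoC (exp (s * t)) * a t) x) by (intros x; apply ccont_mult; auto).
  set (q := fun x => RtoC (exp (s * x)) * e x - Ib * CI (fun t => RtoC (exp (s * t)) * a t) x).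
  assert (Bq : (Cmod (q PI - q 0%R) <= 2 * ((C1 / 2 * Jb / s * Ka PI + 2 * A * A / s * PI) -
                                            (C1 / 2 * Jb / s * Ka 0 + 2 * A * A / s * 0)))%R).
  { apply (cderiv_majorant q (fun t => RtoC (exp (s * t)) * a t * (w t - Ib))
      (fun t => C1 / 2 * Jb / s * Ka t + 2 * A * A / s * t)%R
      (fun t => C1 / 2 * Jb / s * (exp (s * t) * Cmod (a t)) + 2 * A * A / s)%R); [|lra| |].
    - intros t. apply ccont_minus; apply ccont_mult; auto; [apply ccont_const|].
      eapply cderiv_ccont, cderiv_CI, Ca.
    - intros t. apply (is_derive_plus (fun t => C1 / 2 * Jb / s * Ka t)%R (fun t => 2 * A * A / s * t)%R).
      + apply (is_derive_scal Ka t (C1 / 2 * Jb / s)%R), DK.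
      + auto_derive; [exact I|ring].
    - intros t Ht. split.
      + eapply cderiv_eq.
        * apply cderiv_minus; [apply cderiv_mult; [apply cderiv_exp_scal|now apply De]|].
          apply cderiv_scal. now apply cderiv_CI.
        * cbv beta. replace (RtoC (- s)) with (- RtoC s) by now rewrite RtoC_opp. ring.
      + assert (X := exp_pos (s * t)).
        rewrite !Cmod_mult, Cmod_R, Rabs_pos_eq by lra.
        assert (Q1 := D1 t ltac:(lra)). assert (Q2 := D2 t ltac:(lra)).
        assert (T : (Cmod (w t - Ib) <= C1 / 2 * Jb / s + 2 * A * exp (- s * t) / s)%R).
        { replace (w t - Ib) with ((w t - w0 t) + (w0 t - Ib)) by ring.
          eapply Rle_trans; [apply Cmod_triangle|lra]. }
        assert (G0 := Cmod_ge_0 (a t)). destruct (HA t ltac:(lra)) as [HAt _].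
        apply Rle_trans with (exp (s * t) * Cmod (a t) * (C1 / 2 * Jb / s + 2 * A * exp (- s * t) / s))%R.
        * apply Rmult_le_compat_l; [nra|exact T].
        * rewrite Rmult_plus_distr_l.
          assert (E : (exp (s * t) * exp (- s * t) = 1)%R).
          { rewrite <- exp_plus. replace (s * t + - s * t)%R with 0%R by ring. apply exp_0. }
          replace (exp (s * t) * Cmod (a t) * (2 * A * exp (- s * t) / s))%R
            with (Cmod (a t) * (2 * A / s) * (exp (s * t) * exp (- s * t)))%R by (field; lra).
          rewrite E, Rmult_1_r.
          assert (S2 : (0 <= 2 * A / s)%R) by (apply Rdiv_le_0_compat; lra).
          replace (2 * A * A / s)%R with (A * (2 * A / s))%R by (field; lra).
          assert (Cmod (a t) * (2 * A / s) <= A * (2 * A / s))%R by (apply Rmult_le_compat_r; lra). lra. }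
  assert (q0 : q 0%R = 0).
  { unfold q. rewrite E0, CI_0. ring. }
  rewrite q0, K00, !Rmult_0_r, Rplus_0_r, Rminus_0_r in Bq.
  replace (q PI - 0) with (q PI) in Bq by ring.
  assert (EIa := laplace_reflect a s Ha). fold Ia in EIa.
  assert (EJa := laplace_abs_reflect a s Ha). fold (Ka PI) Ja in EJa.
  assert (X := exp_pos (- s * PI)).
  assert (Ee : (exp (- s * PI) * exp (s * PI) = 1)%R).
  { rewrite <- exp_plus. replace (- s * PI + s * PI)%R with 0%R by ring. apply exp_0. }
  assert (F1 : e PI - Ib * Ia = RtoC (exp (- s * PI)) * q PI).
  { unfold q. rewrite EIa.
    transitivity (RtoC (exp (- s * PI) * exp (s * PI)) * e PI -
      Ib * (RtoC (exp (- s * PI)) * CI (fun t => RtoC (exp (s * t)) * a t) PI)).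
    - rewrite Ee. ring.
    - rewrite RtoC_mult. ring. }
  assert (F2 : (Cmod (e PI - Ib * Ia) <= C1 * Jb * Ja / s + 4 * A * A * PI * exp (- s * PI))%R).
  { rewrite F1, Cmod_mult, Cmod_R, Rabs_pos_eq by lra. rewrite EJa.
    apply Rle_trans with (exp (- s * PI) * (2 * (C1 / 2 * Jb / s * Ka PI + 2 * A * A / s * PI)))%R.
    - apply Rmult_le_compat_l; lra.
    - assert (S3 : (2 * A * A / s * PI <= 2 * A * A * PI)%R).
      { apply Rmult_le_compat_r; [lra|]. apply Rmult_le_reg_r with s; [lra|].
        replace (2 * A * A / s * s)%R with (2 * A * A)%R by (field; lra). nra. }
      replace (C1 * Jb * (exp (- s * PI) * Ka PI) / s)%R with (exp (- s * PI) * (C1 * Jb * Ka PI / s))%R by (field; lra).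
      replace (4 * A * A * PI * exp (- s * PI))%R with (exp (- s * PI) * (4 * A * A * PI))%R by ring.
      rewrite <- Rmult_plus_distr_l. apply Rmult_le_compat_l; [lra|].
      replace (C1 * Jb * Ka PI / s)%R with (2 * (C1 / 2 * Jb / s * Ka PI))%R by (field; lra). lra. }
  assert (Gb := Cmod_ge_0 Ib). assert (Ga := Cmod_ge_0 Ia).
  assert (Ja0 : (0 <= Ja)%R).
  { unfold Ja, laplace_abs. apply RInt_ge_0; [lra| |].
    - apply (ex_RInt_continuous (V := R_CompleteNormedModule)). intros t _.
      apply continuous_Rmult; [apply continuous_exp_scal|now apply ccont_Cmod].
    - intros t _. apply Rmult_le_pos; [left; apply exp_pos|apply Cmod_ge_0]. }
  assert (F3 : (C1 * Jb * Ja / s <= Cmod Ib * Cmod Ia / 4)%R).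
  { apply Rle_trans with (C1 * (4 * (Cmod Ib * Cmod Ia)) / s)%R.
    - apply Rmult_le_compat_r; [left; apply Rinv_0_lt_compat; lra|].
      rewrite Rmult_assoc. apply Rmult_le_compat_l; [exact HC1|].
      replace (4 * (Cmod Ib * Cmod Ia))%R with (2 * Cmod Ib * (2 * Cmod Ia))%R by ring.
      apply Rmult_le_compat; lra.
    - apply Rmult_le_reg_r with s; [lra|].
      replace (C1 * (4 * (Cmod Ib * Cmod Ia)) / s * s)%R with (16 * C1 * (Cmod Ib * Cmod Ia / 4))%R by (field; lra).
      rewrite (Rmult_comm _ s). assert (P0 := Rmult_le_pos _ _ Gb Ga).
      apply Rmult_le_compat_r; [lra|]. unfold t0 in Hs; lra. }
  assert (F4 : (3 / 4 * (Cmod Ib * Cmod Ia) - C2 * exp (- s * PI) <= Cmod (y PI))%R).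
  { assert (T1 := Cmod_triangle_minus (Ib * Ia) (e PI)). rewrite Cmod_minus_sym, Cmod_mult in T1.
    assert (T2 : (Cmod (e PI) <= Cmod (y PI) + exp (- s * PI))%R).
    { unfold e. eapply Rle_trans; [apply Cmod_triangle|]. rewrite Cmod_opp, Cmod_R, Rabs_pos_eq; lra. }
    unfold C2. lra. }
  set (P := (s ^ (ka + kb))%R). assert (HP : (0 < P)%R) by (apply pow_lt; lra).
  assert (F5 : (ca * cb <= Cmod Ib * Cmod Ia * P)%R).
  { unfold P. rewrite pow_add.
    replace (Cmod Ib * Cmod Ia * (s ^ ka * s ^ kb))%R with ((Cmod Ia * s ^ ka) * (Cmod Ib * s ^ kb))%R by ring.
    apply Rmult_le_compat; lra. }
  assert (F6 : (C2 * exp (- s * PI) * P <= ca * cb / 4)%R).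
  { fold P in He.
    replace (C2 * exp (- s * PI) * P)%R with (C2 * P * exp (- s * PI))%R by ring.
    replace (ca * cb / 4)%R with (ca * cb / 4 * exp (PI * s) * exp (- s * PI))%R.
    - apply Rmult_le_compat_r; lra.
    - rewrite Rmult_assoc, (Rmult_comm PI s), (Rmult_comm (exp (s * PI))), Ee. ring. }
  assert (Pc := Rmult_lt_0_compat _ _ Hca Hcb).
  apply Rle_trans with ((3 / 4 * (Cmod Ib * Cmod Ia) - C2 * exp (- s * PI)) * P)%R; [lra|].
  apply Rmult_le_compat_r; lra.
Qed.

(** * Transfer matrices *)

Theorem quotient_vanishes (D N G : C -> C) (K c t0 : R) (k : nat) :
  entire D -> entire G -> (forall z, D z * G z = N z) ->
  (1 <= K)%R -> (0 < c)%R -> (1 <= t0)%R ->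
  (forall z, (Cmod (D z) <= exp (K + K * Cmod z))%R /\ (Cmod (N z) <= exp (K + K * Cmod z))%R) ->
  (forall z : C, (0 < snd z)%R -> (Cmod (D z - 1) <= K / snd z)%R /\ (Cmod (N z) <= K / snd z)%R) ->
  (forall t : R, (t0 <= t)%R -> (Cmod (N (0, - t)%R) <= K * exp (PI * t))%R /\
     (c * exp (PI * t) <= Cmod (D (0, - t)%R) * t ^ k)%R) ->
  forall z, G z = 0.
Proof.
  intros HD HG E HK Hc Ht0 Hexp Hup Hlow.
  set (T := (2 * K)%R).
  assert (HDT : forall z : C, (T <= snd z)%R -> (1 / 2 <= Cmod (D z))%R).
  { intros z Hz. unfold T in Hz. destruct (Hup z ltac:(lra)) as [Q _].
    assert (Q2 : (K / snd z <= 1 / 2)%R).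
    { apply Rmult_le_reg_r with (snd z); [lra|]. replace (K / snd z * snd z)%R with K by (field; lra). lra. }
    assert (T1 := Cmod_triangle_minus 1 (D z)). rewrite Cmod_1, Cmod_minus_sym in T1. lra. }
  assert (HGT : forall z : C, (T <= snd z)%R -> (Cmod (G z) <= 2 * K / snd z)%R).
  { intros z Hz. assert (Q := HDT z Hz). unfold T in Hz. destruct (Hup z ltac:(lra)) as [_ Q2].
    rewrite <- E, Cmod_mult in Q2. assert (G0 := Cmod_ge_0 (G z)).
    replace (2 * K / snd z)%R with (2 * (K / snd z))%R by (field; lra). nra. }
  set (iT := (0%R, T) : C).
  assert (CT : Cmod iT = T) by (apply Cmod_imag; unfold T; lra).
  assert (Ets : forall F : C -> C, entire F -> entire (fun z => F (z + iT))).
  { intros F HF z. apply (holo_comp F (fun z => z + iT)); [apply HF|].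
    apply holo_plus; auto using holo_id, holo_const. }
  assert (Lz : (forall z : C, (Cmod (G (z + iT)%C) <= exp (12 * ((K + K * T + 1) + K) + 96 * K * Cmod z))%R)).
  { apply (quotient_exp_type (fun z => 2 * D (z + iT)) (fun z => G (z + iT)) (K + K * T + 1) K).
    - intros z. apply holo_mult; [apply holo_const|]. now apply (Ets D).
    - now apply (Ets G).
    - rewrite Cmod_mult, Cmod_R, Rabs_pos_eq by lra.
      assert (Q := HDT (0 + iT)). simpl in Q. specialize (Q ltac:(lra)). lra.
    - unfold T. nra.
    - lra.
    - intros z.
      assert (B : (2 * exp (K + K * Cmod (z + iT)%C) <= exp (K + K * T + 1 + K * Cmod z))%R).
      { assert (E1 : (2 <= exp 1)%R) by (assert (Q := exp_ineq1 1 ltac:(lra)); lra).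
        apply Rle_trans with (exp 1 * exp (K + K * Cmod (z + iT)))%R.
        - apply Rmult_le_compat_r; [left; apply exp_pos|exact E1].
        - rewrite <- exp_plus. apply exp_le. assert (Q := Cmod_triangle z iT). rewrite CT in Q. nra. }
      destruct (Hexp (z + iT)) as [Q1 Q2].
      replace (2 * D (z + iT) * G (z + iT)) with (2 * N (z + iT)) by (rewrite <- E; ring).
      rewrite !Cmod_mult, Cmod_R, Rabs_pos_eq by lra. split; lra. }
  destruct (entire_bounded G t0 HG) as [M1 HM1].
  set (M := (1 + Rabs M1 + K / c)%R).
  assert (Kc : (0 < K / c)%R) by (apply Rdiv_lt_0_compat; lra).
  assert (MP := Rabs_pos M1). assert (MA := Rle_abs M1).
  apply (entire_zero_criterion G (12 * ((K + K * T + 1) + K) + 96 * K * T) (96 * K) M T k);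
    [exact HG|lra|unfold M; lra|unfold T; lra| | | |].
  - intros z. specialize (Lz (z - iT)). replace (z - iT + iT) with z in Lz by ring.
    eapply Rle_trans; [exact Lz|]. apply exp_le.
    assert (Q := Cmod_triangle z (- iT)). rewrite Cmod_opp, CT in Q.
    change (z + - iT) with (z - iT) in Q. nra.
  - intros z Hz. eapply Rle_trans; [apply (HGT z Hz)|]. unfold T in Hz.
    apply Rle_trans with 1%R; [|unfold M; lra].
    apply Rmult_le_reg_r with (snd z); [lra|]. replace (2 * K / snd z * snd z)%R with (2 * K)%R by (field; lra). lra.
  - intros t Ht. assert (Pk : (1 <= t ^ k)%R) by now apply pow_R1_Rle.
    destruct (Rle_dec t0 t) as [L|L].
    + destruct (Hlow t L) as [Q1 Q2]. rewrite <- E, Cmod_mult in Q1.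
      assert (X := exp_pos (PI * t)). set (x := exp (PI * t)) in *.
      set (d := Cmod (D (0, - t)%R)) in *. set (g := Cmod (G (0, - t)%R)) in *.
      assert (g0 : (0 <= g)%R) by apply Cmod_ge_0.
      assert (Q3 : (c * x * g <= K * x * t ^ k)%R).
      { apply Rle_trans with (d * t ^ k * g)%R; [apply Rmult_le_compat_r; lra|].
        replace (d * t ^ k * g)%R with (d * g * t ^ k)%R by ring. apply Rmult_le_compat_r; lra. }
      assert (Q4 : (g <= K / c * t ^ k)%R).
      { apply Rmult_le_reg_l with (c * x)%R; [nra|].
        replace (c * x * (K / c * t ^ k))%R with (K * x * t ^ k)%R by (field; lra). exact Q3. }
      unfold M. nra.
    + assert (Q : (Cmod (G (0, - t)%R) <= M1)%R).
      { apply HM1. eapply Rle_trans; [apply Cmod_le_abs|]. simpl.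
        rewrite Rabs_R0, Rabs_Ropp, Rabs_pos_eq by lra. lra. }
      unfold M. nra.
  - intros e He. exists (Rmax T (2 * K / e + 1)). intros t Ht.
    assert (T1 := Rle_trans _ _ _ (Rmax_l _ _) Ht). assert (T2 := Rle_trans _ _ _ (Rmax_r _ _) Ht).
    assert (Q := HGT (0%R, t) T1). simpl in Q.
    assert (P0 : (0 < 2 * K / e)%R) by (apply Rdiv_lt_0_compat; lra).
    eapply Rle_lt_trans; [exact Q|].
    apply Rmult_lt_reg_r with t; [lra|]. replace (2 * K / t * t)%R with (e * (2 * K / e))%R by (field; lra).
    apply Rmult_lt_compat_l; lra.
Qed.

Lemma wronskian_const a b z y w y' w' x : system a b z y w -> system a b z y' w' ->
  (0 <= x <= PI)%R ->
  cexp (Ci * z * RtoC x) * (y x * w' x - y' x * w x) = y 0%R * w' 0%R - y' 0%R * w 0%R.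
Proof.
  intros [C1 D1] [C2 D2] Hx.
  assert (Q := cderiv_0_const (fun x => cexp (Ci * z * RtoC x) * (y x * w' x - y' x * w x)) x).
  cbv beta in Q. rewrite Q; [| |lra|].
  - replace (Ci * z * RtoC 0) with (RtoC 0) by ring. rewrite cexp_0. ring.
  - intros t. destruct (C1 t), (C2 t).
    apply (ccont_mult_cexp _ (fun x => y x * w' x - y' x * w x)). apply ccont_minus; now apply ccont_mult.
  - intros t Ht. destruct (D1 t ltac:(lra)) as [D11 D12], (D2 t ltac:(lra)) as [D21 D22].
    eapply cderiv_eq.
    + apply (cderiv_mult_cexp _ (fun x => y x * w' x - y' x * w x)).
      apply cderiv_minus; apply cderiv_mult; eassumption.
    + cbv beta. ring.
Qed.

Lemma system_unique a b z y w y' w' : (forall x, ccont a x) -> (forall x, ccont b x) ->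
  system a b z y w -> system a b z y' w' -> y 0%R = y' 0%R -> w 0%R = w' 0%R ->
  forall x, (0 <= x <= PI)%R -> y x = y' x /\ w x = w' x.
Proof.
  intros Ha Hb H H' Ey Ew x Hx.
  assert (S : system a b z (fun x => y x + - (1) * y' x) (fun x => w x + - (1) * w' x)).
  { apply (forced_system_comb a b (fun _ => 0) (fun _ => 0)); auto. intros; ring. }
  destruct (system_zero a b z _ _ Ha Hb S) with (x := x) as [Z1 Z2]; auto.
  - rewrite Ey. ring.
  - rewrite Ew. ring.
  - split; apply Ceq_minus; [rewrite <- Z1|rewrite <- Z2]; ring.
Qed.

Lemma system_family_exists a b y0 w0 : (forall x, ccont a x) -> (forall x, ccont b x) ->
  exists y w : C -> R -> C, forall z, system a b z (y z) (w z) /\ y z 0%R = y0 /\ w z 0%R = w0.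
Proof.
  intros Ha Hb.
  assert (H : forall z, exists p : (R -> C) * (R -> C),
    system a b z (fst p) (snd p) /\ fst p 0%R = y0 /\ snd p 0%R = w0).
  { intros z. destruct (forced_system_exists a b (fun _ => 0) z y0 w0 Ha Hb) as [y [w Q]].
    - intros x. apply ccont_const.
    - now exists (y, w). }
  exists (fun z => fst (proj1_sig (constructive_indefinite_description _ (H z)))),
         (fun z => snd (proj1_sig (constructive_indefinite_description _ (H z)))).
  intros z. now destruct (constructive_indefinite_description _ (H z)) as [p Hp].
Qed.

Lemma cderiv_reflect f x l : cderiv f (PI - x)%R l -> cderiv (fun t => f (PI - t)%R) x (- l).
Proof.
  assert (D : forall (g : R -> R) k, is_derive g (PI - x)%R k -> is_derive (fun t => g (PI - t)%R) x (- k)%R).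
  { intros g k Hg. evar_last.
    - apply (is_derive_comp g (fun t => PI - t)%R x k (-1)%R Hg). auto_derive; [exact I|ring].
    - unfold scal; simpl; unfold mult; simpl. ring. }
  intros [H1 H2]. split; [apply (D (fun t => fst (f t)))|apply (D (fun t => snd (f t)))]; auto.
Qed.

Lemma system_reflect a b z y w :
  system (fun t => - b (PI - t)%R) (fun t => - a (PI - t)%R) z y w ->
  system a b z (fun x => cexp (Ci * z * RtoC (PI - x)) * w (PI - x)%R)
               (fun x => cexp (Ci * z * RtoC (PI - x)) * y (PI - x)%R).
Proof.
  intros [Hc Hd]. split.
  - intros x. destruct (Hc (PI - x)%R) as [C1 C2].
    split; apply (ccont_comp (fun s => cexp (Ci * z * RtoC s) * _ s) (fun t => PI - t)%R);
      try apply continuous_reflect; now apply ccont_mult_cexp.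
  - intros x Hx. destruct (Hd (PI - x)%R ltac:(lra)) as [D1 D2].
    replace (PI - (PI - x))%R with x in D1, D2 by ring. split.
    + eapply cderiv_eq.
      * apply (cderiv_reflect (fun s => cexp (Ci * z * RtoC s) * w s)).
        apply cderiv_mult_cexp. exact D2.
      * cbv beta. ring.
    + eapply cderiv_eq.
      * apply (cderiv_reflect (fun s => cexp (Ci * z * RtoC s) * y s)).
        apply cderiv_mult_cexp. exact D1.
      * cbv beta. ring.
Qed.

Lemma fst_i_mult_real (z : C) (x : R) : fst (Ci * z * RtoC x) = (- snd z * x)%R.
Proof. simpl. ring. Qed.

Lemma Cmod_cexp_le (z : C) x : (0 <= x <= PI)%R -> (Cmod (cexp (Ci * z * RtoC x)) <= exp (PI * Cmod z))%R.
Proof.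
  intros Hx. rewrite Cmod_cexp, fst_i_mult_real. apply exp_le.
  assert (Q := snd_le_Cmod z). assert (Q1 := Rabs_maj2 (snd z)). assert (Q2 := Cmod_ge_0 z). nra.
Qed.

(* The behaviour of a component of the solution started at [0]: [l] is its limit, after
   removal of the factor [e^{-izx}], as [Im z -> +oo]. *)
Definition left_like (K x : R) (l : C) (L : C -> C) : Prop :=
  entire L /\ forall z, (Cmod (L z) <= exp (K + K * Cmod z))%R /\
    ((snd z <= 0)%R -> (Cmod (L z) <= K)%R) /\
    ((0 < snd z)%R -> (Cmod (cexp (Ci * z * RtoC x) * L z) <= K)%R /\
                      (Cmod (cexp (Ci * z * RtoC x) * L z - l) <= K / snd z)%R).

(* The same for the solution ending at [PI]. *)
Definition right_like (K x : R) (l : C) (Q : C -> C) : Prop :=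
  entire Q /\ forall z, (Cmod (Q z) <= exp (K + K * Cmod z))%R /\
    ((snd z <= 0)%R -> (Cmod (Q z) <= exp (- snd z * (PI - x)) * K)%R) /\
    ((0 < snd z)%R -> (Cmod (Q z) <= K)%R /\ (Cmod (Q z - l) <= K / snd z)%R).

Lemma right_like_intro K x l L : (0 <= x <= PI)%R -> (0 <= K)%R -> left_like K (PI - x) l L ->
  right_like (K + PI) x l (fun z => cexp (Ci * z * RtoC (PI - x)) * L z).
Proof.
  intros Hx HK [HL H]. assert (PI0 := PI_RGT_0). split.
  - intros z. apply holo_mult; [apply (entire_cexp_linear (PI - x))|apply HL].
  - intros z. destruct (H z) as [H1 [H2 H3]]. split; [|split; intros Hz].
    + rewrite Cmod_mult. assert (Q := Cmod_cexp_le z (PI - x) ltac:(lra)).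
      apply Rle_trans with (exp (PI * Cmod z) * exp (K + K * Cmod z))%R.
      * apply Rmult_le_compat; auto using Cmod_ge_0.
      * rewrite <- exp_plus. apply exp_le. lra.
    + specialize (H2 Hz). rewrite Cmod_mult, Cmod_cexp, fst_i_mult_real.
      assert (P := exp_pos (- snd z * (PI - x))). apply Rmult_le_compat_l; lra.
    + destruct (H3 Hz) as [Q1 Q2]. split; [lra|]. eapply Rle_trans; [exact Q2|].
      apply Rmult_le_compat_r; [left; now apply Rinv_0_lt_compat|lra].
Qed.

Lemma unit_solution_left_like a b (y w : C -> R -> C) :
  (forall x, ccont a x) -> (forall x, ccont b x) ->
  (forall z, system a b z (y z) (w z) /\ y z 0%R = 1 /\ w z 0%R = 0) ->
  exists K0 : R, forall K x, (K0 <= K)%R -> (0 <= x <= PI)%R ->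
    left_like K x 1 (fun z => y z x) /\ left_like K x 0 (fun z => w z x).
Proof.
  intros Ha Hb Hyw. destruct (seg_bound a b Ha Hb) as [A [A0 HA]]. assert (PI0 := PI_RGT_0).
  set (C0 := exp ((2 * A + 1) * PI)). set (p := (2 * A + 1)%R).
  assert (HC0 : (1 <= C0)%R).
  { unfold C0. assert (Q := exp_ineq1_le ((2 * A + 1) * PI)). nra. }
  exists (C0 + A * C0 + 2 * (A * (A * C0) * PI) + (p + 2) * PI)%R.
  intros K x HK Hx.
  assert (P1 : (0 <= A * C0)%R) by nra. assert (P2 : (0 <= A * (A * C0) * PI)%R).
  { apply Rmult_le_pos; [|lra]. nra. }
  assert (P3 : (0 <= (p + 2) * PI)%R) by (unfold p; nra).
  destruct (system_entire a b y w 1 0 Ha Hb Hyw x Hx) as [Ey Ew].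
  assert (HA' : forall x, (0 <= x <= PI)%R -> (Cmod (b x) <= A)%R /\ (Cmod (a x) <= A)%R).
  { intros t Ht. destruct (HA t Ht). auto. }
  assert (Bd : forall a b z y w s, (forall x, (0 <= x <= PI)%R -> (Cmod (a x) <= A)%R /\ (Cmod (b x) <= A)%R) ->
    system a b z y w -> (0 <= s)%R -> (snd z <= s)%R ->
    (Cmod (y 0%R) * Cmod (y 0%R) + Cmod (w 0%R) * Cmod (w 0%R) = 1)%R ->
    forall x, (0 <= x <= PI)%R -> (Cmod (y x) <= exp ((2 * s + 2 * A + 1) * PI))%R /\
                                  (Cmod (w x) <= exp ((2 * s + 2 * A + 1) * PI))%R).
  { clear - A0 PI0. intros a b z y w s HA H Hs Hz N0 x Hx.
    assert (Q := system_bounded a b A z y w s A0 HA H Hs Hz x Hx). rewrite N0, Rmult_1_l in Q.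
    assert (X1 : (1 <= exp ((2 * s + 2 * A + 1) * PI))%R).
    { assert (Q1 := exp_ineq1_le ((2 * s + 2 * A + 1) * PI)).
      assert (0 <= (2 * s + 2 * A + 1) * PI)%R by (apply Rmult_le_pos; lra). lra. }
    assert (Y0 := Cmod_ge_0 (y x)). assert (W0 := Cmod_ge_0 (w x)). split; nra. }
  assert (B : forall z,
    ((Cmod (y z x) <= exp (K + K * Cmod z))%R /\ (Cmod (w z x) <= exp (K + K * Cmod z))%R) /\
    ((snd z <= 0)%R -> (Cmod (y z x) <= K)%R /\ (Cmod (w z x) <= K)%R) /\
    ((0 < snd z)%R -> let e := cexp (Ci * z * RtoC x) in
       ((Cmod (e * y z x) <= K)%R /\ (Cmod (e * y z x - 1) <= K / snd z)%R) /\
       ((Cmod (e * w z x) <= K)%R /\ (Cmod (e * w z x - 0) <= K / snd z)%R))).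
  2: { split; (split; [assumption|]); intros z; destruct (B z) as [[B1 B2] [B3 B4]];
       (split; [assumption|split; intros Hz]); first [apply (B3 Hz)|apply (B4 Hz)]. }
  intros z. destruct (Hyw z) as [H [Y0 W0]].
  assert (N0 : (Cmod (y z 0%R) * Cmod (y z 0%R) + Cmod (w z 0%R) * Cmod (w z 0%R) = 1)%R).
  { rewrite Y0, W0, Cmod_0, Cmod_1. ring. }
  split; [|split; intros Hz].
  - assert (Sz : (snd z <= Cmod z)%R) by (eapply Rle_trans; [apply Rle_abs|apply snd_le_Cmod]).
    assert (Z0 := Cmod_ge_0 z).
    destruct (Bd a b z _ _ (Cmod z) HA H Z0 Sz N0 x Hx) as [Q1 Q2].
    assert (X2 : (exp ((2 * Cmod z + 2 * A + 1) * PI) <= exp (K + K * Cmod z))%R).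
    { apply exp_le.
      assert (J1 : ((2 * A + 1) * PI <= K)%R) by (unfold p in *; nra).
      assert (J2 : (2 * PI <= K)%R) by (unfold p in *; nra).
      assert (J3 : (2 * PI * Cmod z <= K * Cmod z)%R) by (apply Rmult_le_compat_r; lra). lra. }
    split; lra.
  - destruct (Bd a b z _ _ 0 HA H ltac:(lra) Hz N0 x Hx) as [Q1 Q2].
    replace (2 * 0 + 2 * A + 1)%R with (2 * A + 1)%R in Q1, Q2 by ring. fold C0 in Q1, Q2. split; lra.
  - intros e. assert (Sw := system_swap a b z _ _ H).
    assert (I0 : cexp (Ci * z * RtoC 0) = 1).
    { replace (Ci * z * RtoC 0) with (RtoC 0) by ring. apply cexp_0. }
    assert (Bs : forall x, (0 <= x <= PI)%R -> (Cmod (cexp (Ci * z * RtoC x) * w z x) <= C0)%R /\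
                                               (Cmod (cexp (Ci * z * RtoC x) * y z x) <= C0)%R).
    { unfold C0. replace (2 * A + 1)%R with (2 * 0 + 2 * A + 1)%R by ring.
      apply (Bd b a (- z) _ _ 0%R HA' Sw); [lra|simpl; lra|].
      cbv beta. rewrite I0, Y0, W0, !Cmod_mult, Cmod_0, Cmod_1. ring. }
    destruct Sw as [SC SD].
    assert (Dm : forall x, (0 <= x <= PI)%R -> (Cmod (cexp (Ci * z * RtoC x) * w z x) <= A * C0 / snd z)%R).
    { apply (damped_bound b (- z) (fun x => cexp (Ci * z * RtoC x) * w z x)
        (fun x => cexp (Ci * z * RtoC x) * y z x) A C0 (snd z)); try lra.
      - intros t. exact (proj1 (SC t)).
      - intros t Ht. destruct (SD t Ht) as [D1 _]. eapply cderiv_eq; [exact D1|]. cbv beta. ring.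
      - rewrite W0. ring.
      - simpl. lra.
      - intros t Ht. split; [apply (HA t Ht)|apply (Bs t Ht)]. }
    assert (Dy : (Cmod (e * y z x - 1) <= 2 * (A * (A * C0 / snd z) * x))%R).
    { assert (Q := cderiv_bounded (fun x => cexp (Ci * z * RtoC x) * y z x)
        (fun x => a x * (cexp (Ci * z * RtoC x) * w z x)) (A * (A * C0 / snd z)) x).
      cbv beta in Q. rewrite I0, Y0 in Q. replace (1 * 1) with (RtoC 1) in Q by ring.
      apply Q; [|lra|].
      - intros t. exact (proj2 (SC t)).
      - intros t Ht. destruct (SD t ltac:(lra)) as [_ D2]. split; [exact D2|].
        rewrite Cmod_mult. apply Rmult_le_compat; try apply Cmod_ge_0; [apply HA; lra|apply Dm; lra]. }
    destruct (Bs x Hx) as [B1 B2]. fold e in B1, B2. specialize (Dm x Hx). fold e in Dm.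
    assert (Iz : (0 < / snd z)%R) by now apply Rinv_0_lt_compat.
    replace (e * w z x - 0) with (e * w z x) by ring.
    repeat split; try lra.
    + eapply Rle_trans; [exact Dy|].
      apply Rle_trans with (2 * (A * (A * C0) * PI) / snd z)%R; [|apply Rmult_le_compat_r; lra].
      replace (2 * (A * (A * C0) * PI) / snd z)%R with (2 * (A * (A * C0 / snd z) * PI))%R by (field; lra).
      apply Rmult_le_compat_l; [lra|]. apply Rmult_le_compat_l; [|lra].
      apply Rmult_le_pos; [lra|]. apply Rdiv_le_0_compat; lra.
    + eapply Rle_trans; [exact Dm|]. apply Rmult_le_compat_r; lra.
Qed.

(* [(ph, W)] and [(th, X)] are the columns of the transfer matrix from [0], and [(et, Z)] is
   the solution that equals [(0, 1)] at [PI]. *)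
Record transfer (a b : R -> C) (ph W th X et Z : C -> R -> C) (K : R) : Prop := {
  tr_phi : forall z, system a b z (ph z) (W z) /\ ph z 0%R = 1 /\ W z 0%R = 0;
  tr_th : forall z, system a b z (th z) (X z) /\ th z 0%R = 0 /\ X z 0%R = 1;
  tr_det : forall z x, (0 <= x <= PI)%R ->
    cexp (Ci * z * RtoC x) * (ph z x * X z x - th z x * W z x) = 1;
  tr_right : forall z x, (0 <= x <= PI)%R ->
    et z x = et z 0%R * ph z x + Z z 0%R * th z x /\ Z z x = et z 0%R * W z x + Z z 0%R * X z x;
  tr_D : forall z, Z z 0%R = cexp (Ci * z * RtoC PI) * ph z PI;
  tr_E : forall z, et z 0%R = - (cexp (Ci * z * RtoC PI) * th z PI);
  tr_entire : forall x, (0 <= x <= PI)%R -> entire (fun z => th z x) /\ entire (fun z => X z x);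
  tr_left : forall x, (0 <= x <= PI)%R ->
    left_like K x 1 (fun z => ph z x) /\ left_like K x 0 (fun z => W z x);
  tr_right_like : forall x, (0 <= x <= PI)%R ->
    right_like K x 1 (fun z => Z z x) /\ right_like K x 0 (fun z => et z x)
}.

Arguments tr_phi {a b ph W th X et Z K}.
Arguments tr_th {a b ph W th X et Z K}.
Arguments tr_det {a b ph W th X et Z K}.
Arguments tr_right {a b ph W th X et Z K}.
Arguments tr_D {a b ph W th X et Z K}.
Arguments tr_E {a b ph W th X et Z K}.
Arguments tr_entire {a b ph W th X et Z K}.
Arguments tr_left {a b ph W th X et Z K}.
Arguments tr_right_like {a b ph W th X et Z K}.

Lemma transfer_exists a b : (forall x, ccont a x) -> (forall x, ccont b x) ->
  exists ph W th X et Z : C -> R -> C, exists K0 : R, forall K, (K0 <= K)%R ->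
    transfer a b ph W th X et Z K.
Proof.
  intros Ha Hb. assert (PI0 := PI_RGT_0).
  assert (Ha' : forall x, ccont (fun t => - b (PI - t)%R) x).
  { intros x. apply ccont_opp. apply (ccont_comp b (fun t => PI - t)%R); [apply Hb|apply continuous_reflect]. }
  assert (Hb' : forall x, ccont (fun t => - a (PI - t)%R) x).
  { intros x. apply ccont_opp. apply (ccont_comp a (fun t => PI - t)%R); [apply Ha|apply continuous_reflect]. }
  destruct (system_family_exists a b 1 0 Ha Hb) as [ph [W HphW]].
  destruct (system_family_exists a b 0 1 Ha Hb) as [th [X HthX]].
  destruct (system_family_exists _ _ 1 0 Ha' Hb') as [pr [wr Hr]].
  set (et := fun z x => cexp (Ci * z * RtoC (PI - x)) * wr z (PI - x)%R).
  set (Z := fun z x => cexp (Ci * z * RtoC (PI - x)) * pr z (PI - x)%R).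
  assert (Hs : forall z, system a b z (et z) (Z z)).
  { intros z. apply system_reflect, Hr. }
  assert (Epi : forall z, et z PI = 0 /\ Z z PI = 1).
  { intros z. unfold et, Z. replace (PI - PI)%R with 0%R by ring.
    destruct (Hr z) as [_ [-> ->]]. replace (Ci * z * RtoC 0) with (RtoC 0) by ring.
    rewrite cexp_0. split; ring. }
  destruct (unit_solution_left_like a b _ _ Ha Hb HphW) as [K1 HK1].
  destruct (unit_solution_left_like _ _ _ _ Ha' Hb' Hr) as [K2 HK2].
  exists ph, W, th, X, et, Z, (Rabs K1 + Rabs K2 + PI)%R. intros K HK.
  assert (A1 := Rle_abs K1). assert (A2 := Rle_abs K2).
  assert (A3 := Rabs_pos K1). assert (A4 := Rabs_pos K2).
  constructor.
  - exact HphW.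
  - exact HthX.
  - intros z x Hx. destruct (HphW z) as [S1 [E1 E2]], (HthX z) as [S2 [E3 E4]].
    rewrite (wronskian_const a b z _ _ _ _ x S1 S2 Hx), E1, E2, E3, E4. ring.
  - intros z x Hx. destruct (HphW z) as [S1 [E1 E2]], (HthX z) as [S2 [E3 E4]].
    assert (Z0 : system a b z (fun _ => 0) (fun _ => 0)).
    { split; [intros t; split; apply ccont_const|]. intros t Ht.
      split; (eapply cderiv_eq; [apply cderiv_const|ring]). }
    assert (S3 : system a b z (fun x => (0 + et z 0%R * ph z x) + Z z 0%R * th z x)
                              (fun x => (0 + et z 0%R * W z x) + Z z 0%R * X z x)).
    { apply (forced_system_comb a b (fun _ => 0) (fun _ => 0)); [|exact S2|intros; ring].
      apply (forced_system_comb a b (fun _ => 0) (fun _ => 0) (fun _ => 0) z (fun _ => 0) (fun _ => 0));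
        auto. intros; ring. }
    destruct (system_unique a b z _ _ _ _ Ha Hb (Hs z) S3) with (x := x) as [Q1 Q2]; auto.
    + rewrite E1, E3. ring.
    + rewrite E2, E4. ring.
    + rewrite Q1, Q2. split; ring.
  - intros z. destruct (HphW z) as [S1 [E1 E2]]. destruct (Epi z) as [E5 E6].
    assert (Q := wronskian_const a b z _ _ _ _ PI S1 (Hs z) ltac:(lra)).
    rewrite E1, E2, E5, E6 in Q.
    transitivity (1 * Z z 0%R - et z 0%R * 0); [ring|]. rewrite <- Q. ring.
  - intros z. destruct (HthX z) as [S1 [E1 E2]]. destruct (Epi z) as [E5 E6].
    assert (Q := wronskian_const a b z _ _ _ _ PI S1 (Hs z) ltac:(lra)).
    rewrite E1, E2, E5, E6 in Q.
    transitivity (- (0 * Z z 0%R - et z 0%R * 1)); [ring|]. rewrite <- Q. ring.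
  - exact (system_entire a b th X 0 1 Ha Hb HthX).
  - intros x Hx. apply HK1; [lra|exact Hx].
  - intros x Hx. destruct (HK2 (K - PI)%R (PI - x)%R) as [Q1 Q2]; [lra|lra|].
    replace K with (K - PI + PI)%R by ring. split.
    + apply (right_like_intro (K - PI) x 1 (fun z => pr z (PI - x)%R) Hx); [lra|exact Q1].
    + apply (right_like_intro (K - PI) x 0 (fun z => wr z (PI - x)%R) Hx); [lra|exact Q2].
Qed.

Lemma C_derive_n_entire f k : entire f -> entire (C_derive_n f k).
Proof. intros H. induction k as [|k IH]; [exact H|]. simpl. now apply entire_C_derive. Qed.

Lemma C_derive_n_minus f g k : entire f -> entire g -> forall z,
  C_derive_n (fun w => f w - g w) k z = C_derive_n f k z - C_derive_n g k z.
Proof.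
  intros Hf Hg. induction k as [|k IH]; intros z; [reflexivity|].
  simpl. apply C_derive_eq.
  destruct (complex_deriv_exists _ z (C_derive_n_entire f k Hf z)) as [p [Hp [E1 E2]]].
  destruct (complex_deriv_exists _ z (C_derive_n_entire g k Hg z)) as [q [Hq [E3 E4]]].
  exists (fun w => p w - q w). split; [now apply holo_minus|]. split.
  - intros w. rewrite !IH, (E1 w), (E3 w). ring.
  - now rewrite E2, E4.
Qed.

Lemma exp_3_le K z : (0 <= z)%R -> (1 <= K)%R ->
  (3 * (exp (K + K * z) * exp (K + K * z) * exp (PI * z)) <= exp ((2 * K + 6) + (2 * K + 6) * z))%R.
Proof.
  intros Hz HK. rewrite <- !exp_plus.
  assert (E : (3 <= exp 2)%R) by (assert (Q := exp_ineq1_le 2); lra).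
  apply Rle_trans with (exp 2 * exp (K + K * z + (K + K * z) + PI * z))%R.
  - apply Rmult_le_compat_r; [left; apply exp_pos|exact E].
  - rewrite <- exp_plus. apply exp_le. assert (P := PI_4). nra.
Qed.

Section TwoProblems.
Variables a b a' b' : R -> C.
Variables ph W th X et Z pht Wt tht Xt ett Zt : C -> R -> C.
Variables (K c t0 : R) (k : nat).
Hypothesis T : transfer a b ph W th X et Z K.
Hypothesis Tt : transfer a' b' pht Wt tht Xt ett Zt K.
Hypothesis HK : (1 <= K)%R.
Hypothesis Hc : (0 < c)%R.
Hypothesis Ht0 : (1 <= t0)%R.
Hypothesis Hlow : forall t : R, (t0 <= t)%R -> (c <= Cmod (ph (0%R, (- t)%R) PI) * t ^ k)%R.

Lemma bilinear_vanishes (x : R) (L1 L2 R1 R2 G : C -> C) (l1 l2 r1 r2 : C) : (0 <= x <= PI)%R ->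
  (Cmod l1 <= 1)%R -> (Cmod l2 <= 1)%R -> (Cmod (l1 * r1 - r2 * l2) <= 1)%R ->
  left_like K x l1 L1 -> left_like K x l2 L2 -> right_like K x r1 R1 -> right_like K x r2 R2 ->
  entire G ->
  (forall z, Z z 0%R * G z =
     cexp (Ci * z * RtoC x) * (L1 z * R1 z - R2 z * L2 z) - (l1 * r1 - r2 * l2) * Z z 0%R) ->
  forall z, G z = 0.
Proof.
  intros Hx B1 B2 Bd [_ HL1] [_ HL2] [_ HR1] [_ HR2] HG E. set (del := l1 * r1 - r2 * l2) in *.
  assert (PI0 := PI_RGT_0). assert (KK : (K <= K * K)%R) by nra.
  destruct (tr_right_like T 0%R ltac:(lra)) as [[EZ HZ] _].
  assert (PB : forall u v A B, (0 <= A)%R -> (0 <= B)%R -> (Cmod u <= A)%R -> (Cmod v <= B)%R ->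
             (Cmod (u * v) <= A * B)%R).
  { intros u v A B HA HB Hu Hv. rewrite Cmod_mult. apply Rmult_le_compat; auto using Cmod_ge_0. }
  assert (Dl : forall u B, (0 <= B)%R -> (Cmod u <= B)%R -> (Cmod (del * u) <= B)%R).
  { intros u B HB Hz. replace B with (1 * B)%R by ring. apply PB; lra. }
  set (L := (8 * (K * K) + 6)%R).
  assert (Lx : forall z : C, (exp ((2 * K + 6) + (2 * K + 6) * Cmod z) <= exp (L + L * Cmod z))%R).
  { intros z. apply exp_le. assert (Q := Cmod_ge_0 z). unfold L. nra. }
  apply (quotient_vanishes (fun z => Z z 0%R) _ G L c t0 k EZ HG E); auto; [unfold L; nra| | |].
  - intros z. destruct (HZ z) as [Q5 _]. destruct (HL1 z) as [Q1 _], (HL2 z) as [Q2 _].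
    destruct (HR1 z) as [Q3 _], (HR2 z) as [Q4 _].
    assert (Qe := Cmod_cexp_le z x Hx). assert (Z0 := Cmod_ge_0 z). split.
    { eapply Rle_trans; [exact Q5|]. apply exp_le. assert (J : (K <= L)%R) by (unfold L; lra). nra. }
    assert (q1 : (1 <= exp (K + K * Cmod z))%R) by (assert (Q := exp_ineq1_le (K + K * Cmod z)); nra).
    assert (p1 : (1 <= exp (PI * Cmod z))%R) by (assert (Q := exp_ineq1_le (PI * Cmod z)); nra).
    assert (E3 := exp_3_le K (Cmod z) Z0 HK). specialize (Lx z).
    set (q := exp (K + K * Cmod z)) in *. set (p := exp (PI * Cmod z)) in *.
    assert (J1 : (Cmod (L1 z * R1 z - R2 z * L2 z) <= 2 * (q * q))%R).
    { eapply Rle_trans; [apply Cmod_triangle|]. rewrite Cmod_opp.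
      assert (A1 := PB (L1 z) (R1 z) q q ltac:(lra) ltac:(lra) Q1 Q3).
      assert (A2 := PB (R2 z) (L2 z) q q ltac:(lra) ltac:(lra) Q4 Q2). lra. }
    assert (J2 := PB _ _ p (2 * (q * q))%R ltac:(lra) ltac:(nra) Qe J1).
    eapply Rle_trans; [apply Cmod_triangle|]. rewrite Cmod_opp.
    assert (J3 := Dl _ q ltac:(lra) Q5).
    assert (J4 : (1 <= q * p)%R) by nra.
    assert (J5 : (q <= q * q * p)%R) by (rewrite Rmult_assoc; nra). lra.
  - intros z Hz. destruct (HZ z) as [_ [_ Q0]], (Q0 Hz) as [_ Q1].
    destruct (HL1 z) as [_ [_ P1]], (P1 Hz) as [A1 A2], (HL2 z) as [_ [_ P2]], (P2 Hz) as [A3 A4].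
    destruct (HR1 z) as [_ [_ P3]], (P3 Hz) as [A5 A6], (HR2 z) as [_ [_ P4]], (P4 Hz) as [A7 A8].
    set (e := cexp (Ci * z * RtoC x)) in *. set (m := (K / snd z)%R) in *.
    assert (Iz : (0 < / snd z)%R) by now apply Rinv_0_lt_compat.
    assert (m0 : (0 <= m)%R) by (apply Rdiv_le_0_compat; lra).
    assert (Lm : forall B, (B <= L)%R -> (B / K * m <= L / snd z)%R).
    { intros B HB. replace (B / K * m)%R with (B / snd z)%R by (unfold m; field; lra).
      apply Rmult_le_compat_r; lra. }
    split.
    { eapply Rle_trans; [exact Q1|]. replace m with (K / K * m)%R by (field; lra).
      apply Lm. unfold L. lra. }
    replace (e * (L1 z * R1 z - R2 z * L2 z) - del * Z z 0%R) with
      (((e * L1 z - l1) * R1 z + l1 * (R1 z - r1)) + - ((e * L2 z - l2) * R2 z + l2 * (R2 z - r2))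
        + - (del * (Z z 0%R - 1))) by (unfold del; ring).
    eapply Rle_trans; [apply Cmod_triangle|]. eapply Rle_trans; [apply Rplus_le_compat_r, Cmod_triangle|].
    rewrite !Cmod_opp.
    assert (T1 := Cmod_triangle ((e * L1 z - l1) * R1 z) (l1 * (R1 z - r1))).
    assert (T2 := Cmod_triangle ((e * L2 z - l2) * R2 z) (l2 * (R2 z - r2))).
    assert (J1 := PB _ _ m K m0 ltac:(lra) A2 A5). assert (J2 := PB _ _ m K m0 ltac:(lra) A4 A7).
    assert (J3 := PB _ _ 1%R m ltac:(lra) m0 B1 A6). assert (J4 := PB _ _ 1%R m ltac:(lra) m0 B2 A8).
    assert (J5 := Dl _ m m0 Q1).
    apply Rle_trans with (2 * (m * K) + 3 * m)%R; [lra|].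
    replace (2 * (m * K) + 3 * m)%R with ((2 * (K * K) + 3 * K) / K * m)%R by (field; lra).
    apply Lm. unfold L. nra.
  - intros t Ht.
    assert (S : (snd ((0, - t)%R : C) <= 0)%R) by (simpl; lra).
    destruct (HZ (0, - t)%R) as [_ [P0 _]], (HL1 (0, - t)%R) as [_ [P1 _]], (HL2 (0, - t)%R) as [_ [P2 _]].
    destruct (HR1 (0, - t)%R) as [_ [P3 _]], (HR2 (0, - t)%R) as [_ [P4 _]].
    specialize (P0 S). specialize (P1 S). specialize (P2 S). specialize (P3 S). specialize (P4 S).
    simpl snd in *. replace (- - t * (PI - x))%R with (t * (PI - x))%R in P3, P4 by ring.
    replace (- - t * (PI - 0))%R with (PI * t)%R in P0 by ring.
    assert (X1 := exp_pos (PI * t)). assert (X2 := exp_pos (t * (PI - x))).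
    assert (Ee : (exp (t * x) * exp (t * (PI - x)) = exp (PI * t))%R).
    { rewrite <- exp_plus. f_equal. ring. }
    set (r := exp (t * (PI - x))) in *. split.
    + set (u := L1 (0, - t)%R * R1 (0, - t)%R - R2 (0, - t)%R * L2 (0, - t)%R).
      assert (J1 : (Cmod u <= 2 * (K * K) * r)%R).
      { eapply Rle_trans; [apply Cmod_triangle|]. rewrite Cmod_opp.
        assert (A1 := PB _ _ K (r * K)%R ltac:(lra) ltac:(nra) P1 P3).
        assert (A2 := PB _ _ (r * K)%R K ltac:(nra) ltac:(lra) P4 P2). lra. }
      eapply Rle_trans; [apply Cmod_triangle|]. rewrite Cmod_opp, Cmod_mult, Cmod_cexp, fst_i_mult_real.
      simpl snd. replace (- - t * x)%R with (t * x)%R by ring.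
      assert (J3 := Dl _ (exp (PI * t) * K)%R ltac:(nra) P0).
      assert (J4 : (exp (t * x) * Cmod u <= 2 * (K * K) * exp (PI * t))%R).
      { rewrite <- Ee. replace (2 * (K * K) * (exp (t * x) * r))%R with (exp (t * x) * (2 * (K * K) * r))%R by ring.
        apply Rmult_le_compat_l; [left; apply exp_pos|exact J1]. }
      unfold L. nra.
    + rewrite (tr_D T), Cmod_mult, Cmod_cexp, fst_i_mult_real. simpl snd.
      replace (- - t * PI)%R with (PI * t)%R by ring.
      rewrite (Rmult_comm c), Rmult_assoc. apply Rmult_le_compat_l; [lra|now apply Hlow].
Qed.

Lemma Cmod_const_le : (Cmod 1 <= 1)%R /\ (Cmod 0 <= 1)%R.
Proof. rewrite Cmod_0, Cmod_1. lra. Qed.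

Lemma weyl_data_unique :
  (forall z, ph z PI = 0 -> exists m, zero_mult (fun z => ph z PI) z m /\ forall k, (k < m)%nat ->
     C_derive_n (fun z => pht z PI) k z = 0 /\
     C_derive_n (fun z => et z 0%R) k z = C_derive_n (fun z => ett z 0%R) k z) ->
  forall z, Z z 0%R = Zt z 0%R /\ et z 0%R = ett z 0%R.
Proof.
  intros Hz. assert (PI0 := PI_RGT_0). assert (S0 : (0 <= 0 <= PI)%R) by lra.
  destruct (tr_left T 0%R S0) as [L0 _].
  destruct (tr_right_like T 0%R S0) as [RZ Re]. destruct (tr_right_like Tt 0%R S0) as [RZt Ret].
  assert (Ep : entire (fun z => ph z PI)) by (apply (tr_left T PI); lra).
  assert (Ept : entire (fun z => pht z PI)) by (apply (tr_left Tt PI); lra).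
  assert (Diff : forall (Q Q' G : C -> C) l, right_like K 0 l Q -> right_like K 0 l Q' -> entire G ->
    (forall z, Z z 0%R * G z = Q' z - Q z) -> forall z, Q z = Q' z).
  { intros Q Q' G l HQ HQ' HG E z.
    assert (G0 : G z = 0).
    { revert z. destruct Cmod_const_le as [c1 c0].
      apply (bilinear_vanishes 0 (fun z => ph z 0%R) (fun z => ph z 0%R) Q' Q G 1 1 l l); auto.
      - now replace (1 * l - l * 1) with (RtoC 0) by ring.
      - intros z. destruct (tr_phi T z) as [_ [-> _]]. rewrite E.
        replace (Ci * z * RtoC 0) with (RtoC 0) by ring. rewrite cexp_0. ring. }
    symmetry. apply Ceq_minus. rewrite <- E, G0. ring. }
  destruct (entire_divide (fun z => ph z PI) (fun z => pht z PI - ph z PI)) as [g1 [Hg1 E1]]; auto.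
  { intros z. now apply holo_minus. }
  { intros z Z0. destruct (Hz z Z0) as [m [Hm Hk]]. exists m. split; [exact Hm|].
    intros j Hj. rewrite (C_derive_n_minus (fun z => pht z PI) (fun z => ph z PI)) by auto.
    destruct (Hk j Hj) as [-> _]. destruct Hm as [Hm _]. rewrite (Hm j Hj). ring. }
  destruct (entire_divide (fun z => ph z PI) (fun z => ett z 0%R - et z 0%R)) as [g2 [Hg2 E2]]; auto.
  { intros z. apply holo_minus; [apply Ret|apply Re]. }
  { intros z Z0. destruct (Hz z Z0) as [m [Hm Hk]]. exists m. split; [exact Hm|].
    intros j Hj. rewrite (C_derive_n_minus (fun z => ett z 0%R) (fun z => et z 0%R)) by (apply Ret || apply Re).
    destruct (Hk j Hj) as [_ ->]. ring. }
  intros z. split; revert z.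
  - apply (Diff (fun z => Z z 0%R) (fun z => Zt z 0%R) g1 1); auto.
    intros z. rewrite (tr_D T), (tr_D Tt), <- Cmult_assoc, <- E1. ring.
  - apply (Diff (fun z => et z 0%R) (fun z => ett z 0%R) (fun z => cexp (- (Ci * z * RtoC PI)) * g2 z) 0); auto.
    + intros z. apply holo_mult; [|apply Hg2]. apply (holo_cexp (fun z => - (Ci * z * RtoC PI))).
      apply holo_opp. apply holo_mult; [|apply holo_const]. apply holo_mult; auto using holo_id, holo_const.
    + intros z. rewrite (tr_D T), E2.
      transitivity (cexp (Ci * z * RtoC PI) * cexp (- (Ci * z * RtoC PI)) * (ph z PI * g2 z)); [ring|].
      rewrite cexp_opp. ring.
Qed.

Lemma transfer_unique : (forall z, Z z 0%R = Zt z 0%R /\ et z 0%R = ett z 0%R) ->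
  forall x, (0 <= x <= PI)%R -> forall z,
  ph z x = pht z x /\ th z x = tht z x /\ W z x = Wt z x /\ X z x = Xt z x.
Proof.
  intros HZ x Hx. destruct Cmod_const_le as [c1 c0].
  set (e := fun z => cexp (Ci * z * RtoC x)).
  destruct (tr_entire T x Hx) as [Eth EX]. destruct (tr_entire Tt x Hx) as [Etht EXt].
  destruct (tr_left T x Hx) as [Lp Lw]. destruct (tr_left Tt x Hx) as [Lpt Lwt].
  destruct (tr_right_like T x Hx) as [RZ Re]. destruct (tr_right_like Tt x Hx) as [RZt Ret].
  assert (Ent : forall f1 f2 f3 f4 : C -> C, forall d, entire f1 -> entire f2 -> entire f3 -> entire f4 ->
    entire (fun z => e z * (f1 z * f2 z - f3 z * f4 z) - d)).
  { intros f1 f2 f3 f4 d H1 H2 H3 H4 z. apply holo_minus; [|apply holo_const]. apply holo_mult.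
    - apply (entire_cexp_linear x).
    - apply holo_minus; now apply holo_mult. }
  assert (Ep := proj1 Lp). assert (Ew := proj1 Lw). assert (Ept := proj1 Lpt). assert (Ewt := proj1 Lwt).
  assert (N1 : 1 * 1 - 0 * 0 = 1) by ring.
  assert (G11 : forall z, e z * (ph z x * Xt z x - th z x * Wt z x) - 1 = 0).
  { apply (bilinear_vanishes x (fun z => ph z x) (fun z => Wt z x) (fun z => Zt z x) (fun z => et z x)
      (fun z => e z * (ph z x * Xt z x - th z x * Wt z x) - 1) 1 0 1 0 Hx); auto; [now rewrite N1|].
    intros z. destruct (tr_right T z x Hx) as [-> _], (tr_right Tt z x Hx) as [_ ->].
    destruct (HZ z) as [<- <-]. unfold e. ring. }
  assert (G12 : forall z, e z * (th z x * pht z x - ph z x * tht z x) - 0 = 0).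
  { apply (bilinear_vanishes x (fun z => pht z x) (fun z => ph z x) (fun z => et z x) (fun z => ett z x)
      (fun z => e z * (th z x * pht z x - ph z x * tht z x) - 0) 1 1 0 0 Hx); auto;
      [now replace (1 * 0 - 0 * 1) with (RtoC 0) by ring|].
    intros z. destruct (tr_right T z x Hx) as [-> _], (tr_right Tt z x Hx) as [-> _].
    destruct (HZ z) as [<- <-]. unfold e. ring. }
  assert (G21 : forall z, e z * (W z x * Xt z x - X z x * Wt z x) - 0 = 0).
  { apply (bilinear_vanishes x (fun z => W z x) (fun z => Wt z x) (fun z => Zt z x) (fun z => Z z x)
      (fun z => e z * (W z x * Xt z x - X z x * Wt z x) - 0) 0 0 1 1 Hx); auto;
      [now replace (0 * 1 - 1 * 0) with (RtoC 0) by ring|].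
    intros z. destruct (tr_right T z x Hx) as [_ ->], (tr_right Tt z x Hx) as [_ ->].
    destruct (HZ z) as [<- <-]. unfold e. ring. }
  assert (G22 : forall z, e z * (X z x * pht z x - W z x * tht z x) - 1 = 0).
  { apply (bilinear_vanishes x (fun z => pht z x) (fun z => W z x) (fun z => Z z x) (fun z => ett z x)
      (fun z => e z * (X z x * pht z x - W z x * tht z x) - 1) 1 0 1 0 Hx); auto; [now rewrite N1|].
    intros z. destruct (tr_right T z x Hx) as [_ ->], (tr_right Tt z x Hx) as [-> _].
    destruct (HZ z) as [<- <-]. unfold e. ring. }
  (* The four entries say that the quotient of the two transfer matrices is the identity. *)
  intros z. specialize (G11 z). specialize (G12 z). specialize (G21 z). specialize (G22 z).
  assert (Zr : forall u : C, u - 0 = u) by (intros; ring). rewrite Zr in G12, G21.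
  assert (Dt := tr_det Tt z x Hx). fold (e z) in Dt.
  set (E := e z) in *. set (p := ph z x) in *. set (q := th z x) in *. set (r := W z x) in *. set (s := X z x) in *.
  set (p' := pht z x) in *. set (q' := tht z x) in *. set (r' := Wt z x) in *. set (s' := Xt z x) in *.
  repeat split.
  - transitivity (p * (E * (p' * s' - q' * r'))); [rewrite Dt; ring|].
    transitivity ((E * (p * s' - q * r') - 1) * p' + E * (q * p' - p * q') * r' + p'); [ring|].
    rewrite G11, G12. ring.
  - transitivity (q * (E * (p' * s' - q' * r'))); [rewrite Dt; ring|].
    transitivity ((E * (p * s' - q * r') - 1) * q' + E * (q * p' - p * q') * s' + q'); [ring|].
    rewrite G11, G12. ring.
  - transitivity (r * (E * (p' * s' - q' * r'))); [rewrite Dt; ring|].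
    transitivity (E * (r * s' - s * r') * p' + (E * (s * p' - r * q') - 1) * r' + r'); [ring|].
    rewrite G21, G22. ring.
  - transitivity (s * (E * (p' * s' - q' * r'))); [rewrite Dt; ring|].
    transitivity (E * (r * s' - s * r') * q' + (E * (s * p' - r * q') - 1) * s' + s'); [ring|].
    rewrite G21, G22. ring.
Qed.

End TwoProblems.

(* On the interior the coefficients are read off the derivatives of the columns; the
   determinant of the transfer matrix never vanishes. *)
Lemma coefficients_unique a b a' b' ph W th X et Z ph' W' th' X' et' Z' K :
  transfer a b ph W th X et Z K -> transfer a' b' ph' W' th' X' et' Z' K ->
  (forall x, (0 <= x <= PI)%R -> forall z,
     ph z x = ph' z x /\ th z x = th' z x /\ W z x = W' z x /\ X z x = X' z x) ->
  forall x, (0 < x < PI)%R -> a x = a' x /\ b x = b' x.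
Proof.
  intros T T' E x Hx.
  assert (U : forall (y y' : R -> C) l l', (forall t, (0 <= t <= PI)%R -> y t = y' t) ->
    cderiv y x l -> cderiv y' x l' -> l = l').
  { intros y y' l l' Ey H [D1 D2].
    assert (H' : cderiv y' x l).
    { apply cderiv_loc with y (Rmin x (PI - x)); [apply Rmin_glb_lt; lra| |exact H].
      intros t Ht. apply Ey. assert (T1 := Rlt_le_trans _ _ _ Ht (Rmin_l _ _)).
      assert (T2 := Rlt_le_trans _ _ _ Ht (Rmin_r _ _)).
      apply Rabs_def2 in T1. apply Rabs_def2 in T2. lra. }
    destruct H' as [D3 D4]. rewrite (surjective_pairing l), (surjective_pairing l').
    f_equal; [rewrite <- (is_derive_unique _ _ _ D1); now apply eq_sym, is_derive_unique
             |rewrite <- (is_derive_unique _ _ _ D2); now apply eq_sym, is_derive_unique]. }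
  assert (Hs : (0 <= x <= PI)%R) by lra.
  destruct (proj2 (proj1 (tr_phi T 0)) x Hx) as [A1 A2].
  destruct (proj2 (proj1 (tr_th T 0)) x Hx) as [A3 A4].
  destruct (proj2 (proj1 (tr_phi T' 0)) x Hx) as [B1 B2].
  destruct (proj2 (proj1 (tr_th T' 0)) x Hx) as [B3 B4].
  assert (V1 := U _ _ _ _ (fun t Ht => proj1 (E t Ht 0)) A1 B1).
  assert (V2 := U _ _ _ _ (fun t Ht => proj1 (proj2 (proj2 (E t Ht 0)))) A2 B2).
  assert (V3 := U _ _ _ _ (fun t Ht => proj1 (proj2 (E t Ht 0))) A3 B3).
  assert (V4 := U _ _ _ _ (fun t Ht => proj2 (proj2 (proj2 (E t Ht 0)))) A4 B4).
  destruct (E x Hs 0) as [E1 [E2 [E3 E4]]].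
  rewrite <- E1, <- E3 in V1. rewrite <- E1 in V2. rewrite <- E2, <- E4 in V3. rewrite <- E2 in V4.
  assert (D := tr_det T 0 x Hs).
  set (e := cexp (Ci * 0 * RtoC x)) in *.
  split; apply Ceq_minus.
  - transitivity ((a x - a' x) * (e * (ph 0 x * X 0 x - th 0 x * W 0 x))); [rewrite D; ring|].
    transitivity (e * ph 0 x * ((- (Ci * 0) * th 0 x + a x * X 0 x + 0) - (- (Ci * 0) * th 0 x + a' x * X 0 x + 0))
      - e * th 0 x * ((- (Ci * 0) * ph 0 x + a x * W 0 x + 0) - (- (Ci * 0) * ph 0 x + a' x * W 0 x + 0))); [ring|].
    rewrite V1, V3. ring.
  - transitivity ((b x - b' x) * (e * (ph 0 x * X 0 x - th 0 x * W 0 x))); [rewrite D; ring|].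
    transitivity (e * X 0 x * (b x * ph 0 x - b' x * ph 0 x) - e * W 0 x * (b x * th 0 x - b' x * th 0 x)); [ring|].
    rewrite V2, V4. ring.
Qed.

(** * The boundary value problem as a first-order system *)

Lemma norm_C_R (z : C) : @norm R_AbsRing C_R_NormedModule z = Cmod z.
Proof.
  destruct z as [x y]. unfold norm; simpl. unfold prod_norm, Cmod. simpl.
  f_equal. unfold norm; simpl. unfold abs; simpl.
  rewrite !Rmult_1_r. f_equal; symmetry; apply Rsqr_abs.
Qed.

Lemma is_derive_seg_eps y x l : seg x -> is_derive_seg y x l -> forall eps : R, (0 < eps)%R ->
  exists d : R, (0 < d)%R /\ forall t, seg t -> (Rabs (t - x) < d)%R ->
    (Cmod (y t - y x - RtoC (t - x) * l) <= eps * Rabs (t - x))%R.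
Proof.
  intros Hx [_ H] eps He.
  assert (F : is_filter_lim (within seg (locally x)) x).
  { intros P HP. unfold within. apply filter_imp with (2 := HP). auto. }
  destruct (H x F (mkposreal eps He)) as [d Hd].
  exists d. split; [apply cond_pos|]. intros t Ht Htd.
  specialize (Hd t Htd Ht). rewrite norm_C_R in Hd. simpl in Hd.
  change (norm (minus t x)) with (Rabs (t - x)) in Hd.
  eapply Rle_trans; [right|exact Hd]. f_equal.
  destruct (y t) as [p q], (y x) as [p' q'], l as [l1 l2].
  unfold minus, plus, opp, scal; simpl. unfold prod_plus, prod_opp, prod_scal, scal; simpl.
  unfold plus, opp, mult; simpl. unfold Cminus, Cplus, Copp, Cmult; simpl. f_equal; ring.
Qed.

Lemma ccont_clamp_intro (f : R -> C) :
  (forall x, seg x -> forall eps : R, (0 < eps)%R -> exists d : R, (0 < d)%R /\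
     forall t, seg t -> (Rabs (t - x) < d)%R -> (Cmod (f t - f x) < eps)%R) ->
  forall x, ccont (fun t => f (clamp t)) x.
Proof.
  intros H x.
  assert (Q : forall eps : posreal, exists d : posreal, forall t, (Rabs (t - x) < d)%R ->
    (Cmod (f (clamp t) - f (clamp x)) < eps)%R).
  { intros eps. destruct (H (clamp x) (clamp_seg x) eps (cond_pos eps)) as [d [Hd Hf]].
    exists (mkposreal d Hd). intros t Ht. apply Hf; [apply clamp_seg|].
    eapply Rle_lt_trans; [apply clamp_lipschitz|exact Ht]. }
  split; intros P [e He]; destruct (Q e) as [d Hd]; exists d; intros t Ht; apply He; specialize (Hd t Ht).
  - eapply Rle_lt_trans; [|exact Hd]. apply (fst_le_Cmod (f (clamp t) - f (clamp x))).
  - eapply Rle_lt_trans; [|exact Hd]. apply (snd_le_Cmod (f (clamp t) - f (clamp x))).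
Qed.

Lemma continuous_on_seg_clamp (f : R -> C) :
  @continuous_on R_UniformSpace C_UniformSpace seg f -> forall x, ccont (fun t => f (clamp t)) x.
Proof.
  intros H. apply ccont_clamp_intro. intros x Hx eps He.
  assert (He2 : (0 < eps / 2)%R) by lra.
  destruct (H x Hx (ball (f x) (mkposreal _ He2)) (locally_ball _ _)) as [d Hd].
  exists d. split; [apply cond_pos|]. intros t Ht Htd.
  destruct (Hd t Htd Ht) as [B1 B2]. simpl in B1, B2.
  unfold ball in B1, B2; simpl in B1, B2. unfold AbsRing_ball, abs, minus, plus, opp in B1, B2; simpl in B1, B2.
  eapply Rle_lt_trans; [apply Cmod_le_abs|]. simpl. unfold Rminus in *. lra.
Qed.

Lemma is_derive_seg_clamp_cont y : (forall x, seg x -> exists l, is_derive_seg y x l) ->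
  forall x, ccont (fun t => y (clamp t)) x.
Proof.
  intros H. apply ccont_clamp_intro. intros x Hx eps He.
  destruct (H x Hx) as [l Hl].
  destruct (is_derive_seg_eps y x l Hx Hl 1 ltac:(lra)) as [d [Hd Q]].
  assert (L0 := Cmod_ge_0 l).
  exists (Rmin d (eps / (Cmod l + 2)))%R. split.
  { apply Rmin_glb_lt; [exact Hd|]. apply Rdiv_lt_0_compat; lra. }
  intros t Ht Htd. assert (T1 := Rlt_le_trans _ _ _ Htd (Rmin_l _ _)).
  assert (T2 := Rlt_le_trans _ _ _ Htd (Rmin_r _ _)).
  specialize (Q t Ht T1).
  replace (y t - y x) with ((y t - y x - RtoC (t - x) * l) + RtoC (t - x) * l) by ring.
  eapply Rle_lt_trans; [apply Cmod_triangle|]. rewrite Cmod_mult, Cmod_R.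
  assert (A0 := Rabs_pos (t - x)).
  assert (T3 : (Rabs (t - x) * (Cmod l + 2) < eps)%R).
  { replace eps with (eps / (Cmod l + 2) * (Cmod l + 2))%R by (field; lra).
    apply Rmult_lt_compat_r; lra. }
  nra.
Qed.

Lemma is_derive_seg_clamp y x l : (0 < x < PI)%R -> is_derive_seg y x l ->
  cderiv (fun t => y (clamp t)) x l.
Proof.
  intros Hx H. assert (Hs : seg x) by (unfold seg; lra).
  assert (Q : forall eps : R, (0 < eps)%R -> exists d : posreal, forall h, h <> 0%R -> (Rabs h < d)%R ->
    (Cmod (y (clamp (x + h)) - y (clamp x) - RtoC h * l) < eps * Rabs h)%R).
  { intros eps He. destruct (is_derive_seg_eps y x l Hs H (eps / 2) ltac:(lra)) as [d [Hd Q]].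
    assert (P : (0 < Rmin d (Rmin x (PI - x)))%R) by (repeat apply Rmin_glb_lt; lra).
    exists (mkposreal _ P). intros h Nh Hh. simpl in Hh.
    assert (T1 := Rlt_le_trans _ _ _ Hh (Rmin_l _ _)).
    assert (T2 := Rlt_le_trans _ _ _ Hh (Rmin_r _ _)).
    assert (T3 := Rlt_le_trans _ _ _ T2 (Rmin_l _ _)).
    assert (T4 := Rlt_le_trans _ _ _ T2 (Rmin_r _ _)).
    apply Rabs_def2 in T3. apply Rabs_def2 in T4.
    rewrite !clamp_id by lra. specialize (Q (x + h)%R). replace (x + h - x)%R with h in Q by ring.
    specialize (Q ltac:(unfold seg; lra) T1).
    assert (A := Rabs_pos_lt h Nh). eapply Rle_lt_trans; [exact Q|]. nra. }
  split; apply is_derive_Reals; intros eps He; destruct (Q eps He) as [d Hd]; exists d; intros h Nh Hh;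
    specialize (Hd h Nh Hh); assert (A := Rabs_pos_lt h Nh); apply Rmult_lt_reg_r with (Rabs h); auto;
    rewrite <- Rabs_mult; (eapply Rle_lt_trans; [|exact Hd]).
  - eapply Rle_trans; [|apply fst_le_Cmod]. right. f_equal. simpl. field. exact Nh.
  - eapply Rle_trans; [|apply snd_le_Cmod]. right. f_equal. simpl. field. exact Nh.
Qed.

Lemma is_RInt_CI (f : R -> C) u x : (forall t, ccont f t) ->
  @is_RInt C_R_NormedModule f u x (RInt (fun t => fst (f t)) u x, RInt (fun t => snd (f t)) u x).
Proof.
  intros H. apply (is_RInt_fct_extend_pair (U := R_NormedModule) (V := R_NormedModule) f);
    apply (RInt_correct (V := R_CompleteNormedModule)); apply (ex_RInt_continuous (V := R_CompleteNormedModule));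
    intros t _; apply H.
Qed.

Lemma RIntC_eq (f g : R -> C) u x : (u <= x)%R -> (forall t, ccont g t) ->
  (forall t, (u < t < x)%R -> f t = g t) ->
  RIntC f u x = CI g x - CI g u.
Proof.
  intros Hux Hg E. unfold RIntC.
  rewrite (RInt_ext (V := C_R_CompleteNormedModule) f g).
  2: { intros t. rewrite Rmin_left, Rmax_right by lra. apply E. }
  rewrite (is_RInt_unique (V := C_R_CompleteNormedModule) _ _ _ _ (is_RInt_CI g u x Hg)).
  assert (Ch : forall h : R -> R, (forall t, continuous h t) -> RInt h u x = (RInt h 0 x - RInt h 0 u)%R).
  { intros h Hh. assert (I : forall p q, ex_RInt h p q).
    { intros p q. apply (ex_RInt_continuous (V := R_CompleteNormedModule)). auto. }
    assert (Q := RInt_Chasles h 0 u x (I _ _) (I _ _)). unfold plus in Q; simpl in Q. lra. }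
  unfold CI, Cminus, Cplus, Copp. simpl.
  rewrite (Ch (fun t => fst (g t)) (fun t => proj1 (Hg t))).
  rewrite (Ch (fun t => snd (g t)) (fun t => proj2 (Hg t))). reflexivity.
Qed.

Definition coef_a (r : R -> C) (x : R) : C := Ci * r (clamp x).
Definition coef_b (v : R -> C) (x : R) : C := v (clamp x).

Lemma Ci_Ci : Ci * Ci = - (1).
Proof. unfold Ci, Cmult, Copp, RtoC. simpl. f_equal; ring. Qed.

Lemma is_phi_system r v z y : (forall x, ccont (coef_b v) x) -> is_phi r v z y ->
  exists w, system (coef_a r) (coef_b v) z (fun x => y (clamp x)) w /\ w 0%R = 0.
Proof.
  intros Cv [H Y0].
  assert (Cy : forall x, ccont (fun t => y (clamp t)) x).
  { apply is_derive_seg_clamp_cont. intros x Hx. destruct (H x Hx) as [l [Hl _]]. now exists l. }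
  set (g := fun t => coef_b v t * y (clamp t)).
  assert (Cg : forall x, ccont g x) by (intros x; apply ccont_mult; auto).
  exists (CI g). split; [|apply CI_0]. split.
  - intros x. split; [apply Cy|]. eapply cderiv_ccont, cderiv_CI, Cg.
  - intros x Hx. split; [|now apply cderiv_CI].
    assert (Hs : seg x) by (unfold seg; lra).
    destruct (H x Hs) as [l [Hl E]].
    eapply cderiv_eq; [exact (is_derive_seg_clamp y x l Hx Hl)|].
    rewrite (RIntC_eq _ (fun t => r x * g t)) in E; [|lra| |].
    + rewrite !CI_scal in E by (auto; lra). rewrite CI_0 in E.
      unfold coef_a. rewrite clamp_id by exact Hs.
      transitivity (- Ci * (Ci * l)); [transitivity (- (Ci * Ci) * l); [rewrite Ci_Ci|]; ring|].
      replace (Ci * l) with (z * y x - (r x * CI g x - r x * 0)) by (rewrite <- E; ring). ring.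
    + intros t. apply ccont_mult; [apply ccont_const|apply Cg].
    + intros t Ht. unfold g, coef_b. rewrite clamp_id by (unfold seg in Hs; lra). ring.
Qed.

Lemma is_eta_system r v z y : (forall x, ccont (coef_b v) x) -> is_eta r v z y ->
  exists w, system (coef_a r) (coef_b v) z (fun x => y (clamp x)) w /\ w PI = 1.
Proof.
  intros Cv [H Y0].
  assert (Cy : forall x, ccont (fun t => y (clamp t)) x).
  { apply is_derive_seg_clamp_cont. intros x Hx. destruct (H x Hx) as [l [Hl _]]. now exists l. }
  set (g := fun t => coef_b v t * y (clamp t)).
  assert (Cg : forall x, ccont g x) by (intros x; apply ccont_mult; auto).
  exists (fun x => 1 - CI g PI + CI g x). split; [|ring]. split.
  - intros x. split; [apply Cy|]. apply ccont_plus; [apply ccont_const|].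
    eapply cderiv_ccont, cderiv_CI, Cg.
  - intros x Hx. assert (Hs : seg x) by (unfold seg; lra). split.
    + destruct (H x Hs) as [l [Hl E]].
      eapply cderiv_eq; [exact (is_derive_seg_clamp y x l Hx Hl)|].
      rewrite (RIntC_eq _ g) in E; [|lra|exact Cg|].
      * unfold coef_a. rewrite clamp_id by exact Hs.
        transitivity (- Ci * (Ci * l)); [transitivity (- (Ci * Ci) * l); [rewrite Ci_Ci|]; ring|].
        replace (Ci * l) with (z * y x - (r x - r x * (CI g PI - CI g x))) by (rewrite <- E; ring). ring.
      * intros t Ht. unfold g, coef_b. rewrite clamp_id by (unfold seg in Hs; lra). ring.
    + eapply cderiv_eq; [apply cderiv_plus; [apply cderiv_const|now apply cderiv_CI]|].
      unfold g. ring.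
Qed.

Lemma power_like_of_equiv (g : R -> C) (D : C) (be : R) : D <> 0 ->
  is_equiv_right0 g (fun x => D * RtoC (Rpower x be)) -> power_like g.
Proof.
  intros ND H. assert (PD := Cmod_pos D ND).
  destruct (H (mkposreal (1 / 4) ltac:(lra))) as [d Hd].
  destruct (INR_unbounded be) as [k Hk].
  exists (Rmin d 1), (3 / 4 * Cmod D)%R, k, (Cconj D / RtoC (Cmod D)).
  assert (NC : RtoC (Cmod D) <> 0) by (intros E; injection E; lra).
  split; [apply Rmin_glb_lt; [apply cond_pos|lra]|]. split; [lra|]. split.
  { rewrite Cmod_div, Cmod_conj, Cmod_R, Rabs_pos_eq by (auto; lra). field. lra. }
  intros t Ht. assert (T1 := Rlt_le_trans _ _ _ (proj2 Ht) (Rmin_l _ _)).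
  assert (T2 := Rlt_le_trans _ _ _ (proj2 Ht) (Rmin_r _ _)).
  assert (Bt : ball (0%R : R_UniformSpace) d t).
  { unfold ball; simpl. unfold AbsRing_ball, abs, minus, plus, opp; simpl.
    replace (t + - 0)%R with t by ring. rewrite Rabs_pos_eq; lra. }
  specialize (Hd t Bt (proj1 Ht)). rewrite !norm_C_R in Hd. simpl in Hd.
  set (G := D * RtoC (Rpower t be)) in *.
  assert (EG : Cmod G = (Cmod D * Rpower t be)%R).
  { unfold G. rewrite Cmod_mult, Cmod_R, Rabs_pos_eq; [reflexivity|left; apply exp_pos]. }
  change (Cmod (G - g t) <= 1 / 4 * Cmod G)%R in Hd.
  set (om := Cconj D / RtoC (Cmod D)).
  assert (Eo : om * G = RtoC (Cmod G)).
  { rewrite EG, RtoC_mult. unfold om, G.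
    assert (E2 : Cconj D * D = RtoC (Cmod D) * RtoC (Cmod D)).
    { rewrite <- RtoC_mult, Cmod_sq. destruct D as [p q]. unfold Cconj, Cmult, RtoC. simpl. f_equal; ring. }
    replace (Cconj D / RtoC (Cmod D) * (D * RtoC (Rpower t be)))
      with (Cconj D * D / RtoC (Cmod D) * RtoC (Rpower t be)) by (field; exact NC).
    rewrite E2. field. exact NC. }
  assert (Mo : Cmod om = 1%R).
  { unfold om. rewrite Cmod_div, Cmod_conj, Cmod_R, Rabs_pos_eq by (auto; lra). field. lra. }
  assert (Q1 : (Cmod G - 1 / 4 * Cmod G <= fst (om * g t)%C)%R).
  { replace (om * g t) with (om * G - om * (G - g t)) by ring. rewrite Eo.
    assert (Q := fst_le_Cmod (om * (G - g t))). rewrite Cmod_mult, Mo in Q.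
    assert (Q2 := Rle_abs (fst (om * (G - g t))%C)). simpl fst at 1. simpl in *. unfold Rminus in *. lra. }
  assert (Q2 := Cmod_triangle_minus (g t) G). rewrite Cmod_minus_sym in Q2.
  assert (Q3 := Cmod_triangle_minus G (g t)). assert (G0 := Cmod_ge_0 G).
  split; [lra|].
  assert (Q4 : (t ^ k <= Rpower t be)%R).
  { rewrite <- Rpower_pow by lra. unfold Rpower. apply exp_le.
    assert (L : (ln t < 0)%R) by (rewrite <- ln_1; apply ln_increasing; lra). nra. }
  rewrite EG in *. assert (P0 := pow_le t k ltac:(lra)). nra.
Qed.

Lemma power_like_ext (f g : R -> C) : (forall t, (0 < t < PI)%R -> f t = g t) -> power_like f -> power_like g.
Proof.
  intros E [d [c [k [om [Hd [Hc [Ho H]]]]]]]. assert (P := PI_RGT_0).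
  exists (Rmin d PI), c, k, om. split; [apply Rmin_glb_lt; lra|]. split; [exact Hc|]. split; [exact Ho|].
  intros t Ht. assert (T1 := Rlt_le_trans _ _ _ (proj2 Ht) (Rmin_l _ _)).
  assert (T2 := Rlt_le_trans _ _ _ (proj2 Ht) (Rmin_r _ _)).
  rewrite <- E by lra. apply H. lra.
Qed.

Lemma power_like_scal (f : R -> C) (u : C) : Cmod u = 1%R -> power_like f -> power_like (fun t => u * f t).
Proof.
  intros Hu [d [c [k [om [Hd [Hc [Ho H]]]]]]].
  assert (Nu : u <> 0) by (apply Cmod_pos_neq; lra).
  exists d, c, k, (om / u). split; [exact Hd|]. split; [exact Hc|]. split.
  { rewrite Cmod_div, Ho, Hu by exact Nu. field. }
  intros t Ht. replace (om / u * (u * f t)) with (om * f t) by (field; exact Nu).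
  rewrite Cmod_mult, Hu, Rmult_1_l. now apply H.
Qed.

Lemma admissible_coefs r v : admissible r v ->
  (forall x, ccont (coef_a r) x) /\ (forall x, ccont (coef_b v) x) /\
  power_like (coef_b v) /\ power_like (fun t => coef_a r (PI - t)%R).
Proof.
  intros [Hr [Hv [[al [be [Ca [Db [N [Er Ev]]]]]] _]]].
  assert (NC : Ca <> 0) by (intros E; apply N; rewrite E; ring).
  assert (ND : Db <> 0) by (intros E; apply N; rewrite E; ring).
  split; [intros x; apply ccont_mult; [apply ccont_const|now apply continuous_on_seg_clamp]|].
  split; [now apply continuous_on_seg_clamp|]. split.
  - apply power_like_ext with v; [|now apply power_like_of_equiv with Db be].
    intros t Ht. unfold coef_b. rewrite clamp_id by lra. reflexivity.
  - apply power_like_ext with (fun t => Ci * r (PI - t)%R).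
    + intros t Ht. unfold coef_a. rewrite clamp_id by lra. reflexivity.
    + apply (power_like_scal (fun t => r (PI - t)%R)); [apply Cmod_Ci|].
      now apply power_like_of_equiv with Ca al.
Qed.

Lemma is_phi_eq r v ph W th X et Z K z y x : transfer (coef_a r) (coef_b v) ph W th X et Z K ->
  (forall x, ccont (coef_a r) x) -> (forall x, ccont (coef_b v) x) ->
  is_phi r v z y -> seg x -> y x = ph z x.
Proof.
  intros T Ca Cb H Hx. destruct (is_phi_system r v z y Cb H) as [w [S W0]].
  destruct (tr_phi T z) as [S' [E1 E2]].
  destruct (system_unique _ _ z _ _ _ _ Ca Cb S S') with (x := x) as [Q _]; auto.
  - assert (P := PI_RGT_0). rewrite clamp_id, E1 by lra. apply H.
  - now rewrite W0, E2.
  - now rewrite clamp_id in Q by exact Hx.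
Qed.

Lemma is_eta_at_0 r v ph W th X et Z K z y : transfer (coef_a r) (coef_b v) ph W th X et Z K ->
  (forall x, ccont (coef_b v) x) -> is_eta r v z y -> y 0%R = et z 0%R.
Proof.
  intros T Cb H. destruct (is_eta_system r v z y Cb H) as [w [S W1]].
  destruct (tr_th T z) as [S' [E1 E2]]. assert (P := PI_RGT_0).
  assert (Q := wronskian_const _ _ z _ _ _ _ PI S' S ltac:(lra)). cbv beta in Q.
  rewrite !clamp_id in Q by lra. destruct H as [_ Y0]. rewrite Y0, W1, E1, E2 in Q.
  rewrite (tr_E T).
  transitivity (- (0 * w 0%R - y 0%R * 1)); [ring|]. rewrite <- Q. ring.
Qed.

Lemma ccont_eq_endpoint (f g : R -> C) (x : R) : (forall t, ccont f t) -> (forall t, ccont g t) ->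
  (forall t, (0 < t < PI)%R -> f t = g t) -> (0 <= x <= PI)%R -> f x = g x.
Proof.
  intros Hf Hg E Hx. assert (P := PI_RGT_0).
  destruct (Ceq_dec (f x) (g x)) as [|N]; [assumption|exfalso].
  assert (Pc : (0 < Cmod (f x - g x))%R) by now apply Cmod_pos, Cminus_neq.
  assert (Cc := ccont_Cmod _ x (ccont_minus f g x (Hf x) (Hg x))).
  destruct (Cc _ (locally_ball (Cmod (f x - g x)) (mkposreal _ Pc))) as [d Hd].
  assert (Hd0 := cond_pos d).
  assert (T : exists t, (0 < t < PI)%R /\ (Rabs (t - x) < d)%R).
  { destruct (Rle_dec x (PI / 2)) as [L|L].
    - exists (x + Rmin d (PI / 2) / 2)%R.
      assert (0 < Rmin d (PI / 2))%R by (apply Rmin_glb_lt; lra).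
      assert (Q1 := Rmin_l d (PI / 2)). assert (Q2 := Rmin_r d (PI / 2)).
      split; [lra|]. rewrite Rabs_pos_eq; lra.
    - exists (x - Rmin d (PI / 2) / 2)%R.
      assert (0 < Rmin d (PI / 2))%R by (apply Rmin_glb_lt; lra).
      assert (Q1 := Rmin_l d (PI / 2)). assert (Q2 := Rmin_r d (PI / 2)).
      split; [lra|]. rewrite Rabs_left; lra. }
  destruct T as [t [Ht1 Ht2]]. specialize (Hd t Ht2).
  unfold ball in Hd; simpl in Hd. unfold AbsRing_ball, abs, minus, plus, opp in Hd; simpl in Hd.
  rewrite (E t Ht1), Cdiff_0, Cmod_0, Rplus_0_l, Rabs_Ropp, Rabs_pos_eq in Hd; lra.
Qed.

Lemma numbering_block D D' lam lam' z :
  eigenvalue_numbering D lam -> eigenvalue_numbering D' lam' ->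
  (forall n, (1 <= n)%nat -> lam n = lam' n) -> D z = 0 ->
  exists n m, (1 <= n)%nat /\ lam n = z /\ in_S lam n /\ in_S lam' n /\
    zero_mult D z m /\ zero_mult D' z m.
Proof.
  intros [_ H1] [H2 H3] E Z0.
  destruct (H1 z Z0) as [n [m [Hn [Hm [Hz Hk]]]]].
  assert (Ln : lam n = z) by (apply Hk; [exact Hn|lia]).
  assert (Z1 : D' z = 0) by (rewrite <- Ln, E by exact Hn; now apply H2).
  destruct (H3 z Z1) as [n' [m' [Hn' [Hm' [Hz' Hk']]]]].
  assert (B : forall j, (1 <= j)%nat -> ((n <= j < n + m)%nat <-> (n' <= j < n' + m')%nat)).
  { intros j Hj. rewrite <- Hk, <- Hk', E by exact Hj. reflexivity. }
  assert (En : n = n').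
  { destruct (proj1 (B n Hn)) as [Q1 _]; [lia|]. destruct (proj2 (B n' Hn')) as [Q2 _]; [lia|]. lia. }
  subst n'. assert (Em : m = m').
  { destruct (proj1 (B (n + m - 1)%nat ltac:(lia))) as [_ Q1]; [lia|].
    destruct (proj2 (B (n + m' - 1)%nat ltac:(lia))) as [_ Q2]; [lia|]. lia. }
  subst m'. exists n, m.
  assert (S : n = 1%nat \/ (2 <= n)%nat /\ lam (n - 1)%nat <> z).
  { destruct (Nat.eq_dec n 1) as [->|N]; [now left|right]. split; [lia|].
    intros Q. apply Hk in Q; lia. }
  repeat split; auto.
  - destruct S as [->|[S1 S2]]; [now left|right]. now rewrite Ln.
  - destruct S as [->|[S1 S2]]; [now left|right]. rewrite <- !E by lia. now rewrite Ln.
  - apply Hz.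
  - apply Hz.
  - apply Hz'.
  - apply Hz'.
Qed.

Lemma taylor_coef_inj f g k z : taylor_coef f k z = taylor_coef g k z ->
  C_derive_n f k z = C_derive_n g k z.
Proof.
  unfold taylor_coef. intros E. assert (P := INR_fact_lt_0 k).
  assert (N : RtoC (/ INR (Factorial.fact k)) <> 0).
  { intros Q. injection Q. intros Q1. assert (R := Rinv_0_lt_compat _ P). lra. }
  apply Ceq_minus. apply Ceq_minus in E.
  replace (C_derive_n f k z - C_derive_n g k z) with
    ((RtoC (/ INR (Factorial.fact k)) * C_derive_n f k z - RtoC (/ INR (Factorial.fact k)) * C_derive_n g k z)
       / RtoC (/ INR (Factorial.fact k))) by (field; exact N).
  rewrite E. field. exact N.
Qed.

Theorem theorem1
  (r v rt vt : R -> C)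
  (Hrv : admissible r v) (Hrvt : admissible rt vt)
  (lam beta lamt betat : nat -> C)
  (Hdata : spectral_data r v lam beta)
  (Hdatat : spectral_data rt vt lamt betat)
  (Hlam : forall n : nat, (1 <= n)%nat -> lam n = lamt n)
  (Hbeta : forall n : nat, (1 <= n)%nat -> beta n = betat n) :
  forall x : R, (0 <= x <= PI)%R -> r x = rt x /\ v x = vt x.
Proof.
  assert (PI0 := PI_RGT_0).
  destruct (admissible_coefs r v Hrv) as [Ca [Cb [Pb Pa]]].
  destruct (admissible_coefs rt vt Hrvt) as [Ca' [Cb' _]].
  destruct (transfer_exists _ _ Ca Cb) as [ph [W [th [X [et [Z [K0 HT]]]]]]].
  destruct (transfer_exists _ _ Ca' Cb') as [pht [Wt [tht [Xt [ett [Zt [K0' HTt]]]]]]].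
  set (K := (Rabs K0 + Rabs K0' + 1)%R).
  assert (A1 := Rle_abs K0). assert (A2 := Rle_abs K0').
  assert (A3 := Rabs_pos K0). assert (A4 := Rabs_pos K0').
  assert (T := HT K ltac:(unfold K; lra)). assert (Tt := HTt K ltac:(unfold K; lra)). clear HT HTt.
  assert (HK : (1 <= K)%R) by (unfold K; lra).
  destruct (phi_lower_bound _ _ Ca Cb Pb Pa) as [c [k [t0 [Hc [Ht0 Hlow]]]]].
  destruct Hdata as [phi [eta [Hphi [Heta [Hnum Hw]]]]].
  destruct Hdatat as [phit [etat [Hphit [Hetat [Hnumt Hwt]]]]].
  assert (Sg0 : seg 0) by (unfold seg; lra). assert (SgP : seg PI) by (unfold seg; lra).
  assert (EphP : phi PI = fun z => ph z PI).
  { apply functional_extensionality. intros z.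
    exact (is_phi_eq r v _ _ _ _ _ _ K z (fun x => phi x z) PI T Ca Cb (Hphi z) SgP). }
  assert (EphPt : phit PI = fun z => pht z PI).
  { apply functional_extensionality. intros z.
    exact (is_phi_eq rt vt _ _ _ _ _ _ K z (fun x => phit x z) PI Tt Ca' Cb' (Hphit z) SgP). }
  assert (Ee : eta 0%R = fun z => et z 0%R).
  { apply functional_extensionality. intros z.
    exact (is_eta_at_0 r v _ _ _ _ _ _ K z (fun x => eta x z) T Cb (Heta z)). }
  assert (Eet : etat 0%R = fun z => ett z 0%R).
  { apply functional_extensionality. intros z.
    exact (is_eta_at_0 rt vt _ _ _ _ _ _ K z (fun x => etat x z) Tt Cb' (Hetat z)). }
  assert (Ep0 : phit 0%R = phi 0%R).
  { apply functional_extensionality. intros z. destruct (Hphi z) as [_ ->], (Hphit z) as [_ ->]. reflexivity. }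
  assert (U : forall z, Z z 0%R = Zt z 0%R /\ et z 0%R = ett z 0%R).
  { apply (weyl_data_unique _ _ _ _ ph W th X et Z pht Wt tht Xt ett Zt K c t0 k T Tt HK Hc Ht0).
    - intros t Ht. destruct (tr_phi T (0%R, (- t)%R)) as [S [E1 E2]].
      exact (Hlow t Ht _ _ S E1 E2).
    - intros z Hz.
      destruct (numbering_block (phi PI) (phit PI) lam lamt z Hnum Hnumt Hlam) as [n [m [Hn [Ln [S1 [S2 [M1 M2]]]]]]].
      { now rewrite EphP. }
      exists m. split; [now rewrite <- EphP|]. intros j Hj. split.
      + rewrite <- EphPt. now apply M2.
      + rewrite <- Ee, <- Eet. apply taylor_coef_inj.
        assert (Lt : lamt n = z) by (rewrite <- Hlam; auto).
        assert (Q1 := Hw n m j Hn S1 ltac:(now rewrite Ln) Hj 0%R Sg0).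
        assert (Q2 := Hwt n m j Hn S2 ltac:(now rewrite Lt) Hj 0%R Sg0).
        rewrite Ln in Q1. rewrite Lt in Q2. rewrite Q1, Q2, Ep0.
        apply sum_n_ext_loc. intros i Hi. rewrite Hbeta by lia. reflexivity. }
  assert (V := transfer_unique _ _ _ _ ph W th X et Z pht Wt tht Xt ett Zt K c t0 k T Tt HK Hc Ht0).
  assert (V' : forall x, (0 <= x <= PI)%R -> forall z,
    ph z x = pht z x /\ th z x = tht z x /\ W z x = Wt z x /\ X z x = Xt z x).
  { apply V; [|exact U]. intros t Ht. destruct (tr_phi T (0%R, (- t)%R)) as [S [E1 E2]].
    exact (Hlow t Ht _ _ S E1 E2). }
  assert (I := coefficients_unique _ _ _ _ _ _ _ _ _ _ _ _ _ _ _ _ K T Tt V').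
  intros x Hx.
  assert (Qa := ccont_eq_endpoint _ _ x Ca Ca' (fun t Ht => proj1 (I t Ht)) Hx).
  assert (Qb := ccont_eq_endpoint _ _ x Cb Cb' (fun t Ht => proj2 (I t Ht)) Hx).
  unfold coef_a, coef_b in Qa, Qb. rewrite clamp_id in Qa, Qb by exact Hx.
  split; [|exact Qb].
  transitivity (- Ci * (Ci * r x)); [transitivity (- (Ci * Ci) * r x); [rewrite Ci_Ci|]; ring|].
  rewrite Qa. transitivity (- (Ci * Ci) * rt x); [ring|]. rewrite Ci_Ci. ring.
Qed.
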